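(* Let $p$ be a prime. The subgroup of $\Gamma(p)$ generated by three independent Haar random elements has $1$-dimensional closure with probability $1$.
   Context: Let $T$ be the infinite rooted $p$-ary tree whose vertices are the finite sequences over $X=\{0,\dots,p-1\}$ (level $n$ = sequences of length $n$). Let $C_p$ be the cyclic group generated by $x\mapsto x+1\pmod p$ on $X$. $\Gamma=\Gamma(p)$ is the profinite group of all tree automorphisms given by maps $g:V(T)\to C_p$, acting by $(x_1,\dots,x_\ell)^g=(x_1^{g(())},x_2^{g((x_1))},\dots,x_\ell^{g((x_1,\dots,x_{\ell-1}))})$. $\Gamma^{(n)}$ is the pointwise stabilizer of level $n$, and $\Gamma_n=\Gamma/\Gamma^{(n)}$. Dimension means Hausdorff dimension with respect to the metric $\mathrm{dist}(g,h)=|\Gamma_n|^{-1}$, $n$ greatest with $gh^{-1}\in\Gamma^{(n)}$. For a closed subgroup $G$ it equals $\liminf_{n\to\infty}\log|G\Gamma^{(n)}/\Gamma^{(n)}|/\log|\Gamma_n|$. *)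

(* Defs.v *)
From HB Require Import structures.
From mathcomp Require Import all_boot all_order all_algebra all_fingroup.
From mathcomp Require Import finmap.
From mathcomp Require Import all_classical all_reals all_analysis.

Set Implicit Arguments.
Unset Strict Implicit.
Unset Printing Implicit Defensive.

Import Order.TTheory GRing.Theory Num.Theory.

Local Open Scope classical_set_scope.
Local Open Scope group_scope.

(* X = 'I_p, and C_p is the subgroup of Sym(X) generated by x |-> x + 1 mod p
   (ordS). *)
Definition rot_perm (p : nat) : {perm 'I_p} := perm (@ordS_inj p).
Definition Cp (p : nat) : finGroupType := subg_of <[rot_perm p]>.

(* Vertices of T are words over 'I_p, and an element of Gamma(p) is the map
   V(T) -> C_p that defines it. *)
Definition Gamma (p : nat) : Type := seq 'I_p -> Cp p.

Section GammaGroup.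
Variable p : nat.
Implicit Types (g h k : Gamma p) (v : seq 'I_p).

(* g restricted to the subtree below the first-level vertex x. *)
Definition subtree g (x : 'I_p) : Gamma p := fun v => g (x :: v).

(* The action v^g; the closed formula is tree_actE below. *)
Fixpoint tree_act g v : seq 'I_p :=
  if v is x :: v' then sgval (g [::]) x :: tree_act (subtree g x) v' else [::].

Fixpoint tree_actV g v : seq 'I_p :=
  if v is x :: v' then
    let y := sgval (g [::])^-1 x in y :: tree_actV (subtree g y) v'
  else [::].

Lemma size_tree_act g v : size (tree_act g v) = size v.
Proof. by elim: v g => //= x v IH g; rewrite IH. Qed.

Lemma tree_actE g v (x0 : 'I_p) (i : nat) : (i < size v)%N ->
  nth x0 (tree_act g v) i = sgval (g (take i v)) (nth x0 v i).
Proof. by elim: v g i => //= x v IH g [|i] //= iv; rewrite IH. Qed.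

Lemma tree_actK g : cancel (tree_act g) (tree_actV g).
Proof.
move=> v; elim: v g => //= x v IH g.
by rewrite permK IH.
Qed.

Lemma tree_actVK g : cancel (tree_actV g) (tree_act g).
Proof.
move=> v; elim: v g => //= x v IH g.
by rewrite permKV IH.
Qed.

(* Products are composed from left to right: see tree_actM. *)
Definition Gamma_one : Gamma p := fun=> 1.
Definition Gamma_mul g h : Gamma p := fun v => g v * h (tree_act g v).
Definition Gamma_inv g : Gamma p := fun v => (g (tree_actV g v))^-1.

Lemma tree_act1 v : tree_act Gamma_one v = v.
Proof. by elim: v => //= x v IH; rewrite perm1 -[in RHS]IH. Qed.

Lemma tree_actM g h v : tree_act (Gamma_mul g h) v = tree_act h (tree_act g v).
Proof. by elim: v g h => //= x v IH g h; rewrite -IH permM. Qed.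

Lemma tree_act_inv g v : tree_act (Gamma_inv g) v = tree_actV g v.
Proof. by elim: v g => //= x v IH g; rewrite -IH. Qed.

(* An element of Gamma(p) is determined by the tree automorphism it defines. *)
Lemma tree_act_inj g h : (forall v, tree_act g v = tree_act h v) -> g = h.
Proof.
move=> gh; apply/funext => v; apply/val_inj/permP => x /=.
have sz : (size v < size (v ++ [:: x]))%N by rewrite size_cat addn1.
have := congr1 (fun w => nth x w (size v)) (gh (v ++ [:: x])).
by rewrite !tree_actE // take_size_cat // nth_cat ltnn subnn.
Qed.

Lemma Gamma_mulA : associative Gamma_mul.
Proof. by move=> g h k; apply: tree_act_inj => v; rewrite !tree_actM. Qed.
Lemma Gamma_mul1g : left_id Gamma_one Gamma_mul.
Proof. by move=> g; apply: tree_act_inj => v; rewrite tree_actM tree_act1. Qed.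
Lemma Gamma_mulg1 : right_id Gamma_one Gamma_mul.
Proof. by move=> g; apply: tree_act_inj => v; rewrite tree_actM tree_act1. Qed.
Lemma Gamma_mulVg : left_inverse Gamma_one Gamma_inv Gamma_mul.
Proof.
move=> g; apply: tree_act_inj => v.
by rewrite tree_actM tree_act1 tree_act_inv tree_actVK.
Qed.
Lemma Gamma_mulgV : right_inverse Gamma_one Gamma_inv Gamma_mul.
Proof.
move=> g; apply: tree_act_inj => v.
by rewrite tree_actM tree_act1 tree_act_inv tree_actK.
Qed.

HB.instance Definition _ := Choice.copy (Gamma p) (seq 'I_p -> Cp p).
HB.instance Definition _ := isPointed.Build (Gamma p) Gamma_one.
HB.instance Definition _ := isGroup.Build (Gamma p)
  Gamma_mulA Gamma_mul1g Gamma_mulg1 Gamma_mulVg Gamma_mulgV.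

End GammaGroup.

(* Gamma^(n) *)
Definition level_stab (p n : nat) : set (Gamma p) :=
  [set g | forall v : seq 'I_p, size v = n -> tree_act g v = v].

Definition stab_coset (p n : nat) (g : Gamma p) : set (Gamma p) :=
  [set h | level_stab n (h * g^-1)].

(* |Gamma_n|, the number of cosets of Gamma^(n); there are finitely many since
   level n is finite. *)
Definition quo_card (p n : nat) : nat :=
  #|` fset_set [set stab_coset n g | g in [set: Gamma p]] |.

Section GammaTopology.
Variable p : nat.

Definition Gamma_open (U : set (Gamma p)) : Prop :=
  forall g, U g -> exists n, stab_coset n g `<=` U.

(* The stabilizers decrease with n. *)
Lemma level_stabS (m n : nat) : (m <= n)%N ->
  @level_stab p n `<=` @level_stab p m.
Proof.
move=> mn g gn v vm.
case: v vm => [//|x v] vm.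
pose w := (x :: v) ++ nseq (n - m) x.
have := gn w; rewrite size_cat size_nseq vm subnKC // => /(_ erefl) gw.
apply: (@eq_from_nth _ x) => [|i]; rewrite size_tree_act // => iv.
have := congr1 (fun u => nth x u i) gw.
have iw : (i < size w)%N by rewrite size_cat ltn_addr.
by rewrite !tree_actE // /w nth_cat iv take_cat iv.
Qed.

Lemma Gamma_openT : Gamma_open setT.
Proof. by move=> g _; exists 0%N. Qed.

Lemma Gamma_openI : setI_closed Gamma_open.
Proof.
move=> U V oU oV g [/oU[m mU] /oV[n nV]]; exists (maxn m n) => h hg.
split; [apply: mU|apply: nV]; apply: level_stabS hg.
  exact: leq_maxl.
exact: leq_maxr.
Qed.

Lemma Gamma_open_bigU (I : Type) (f : I -> set (Gamma p)) :
  (forall i, Gamma_open (f i)) -> Gamma_open (\bigcup_i f i).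
Proof.
move=> fo g [i _ /fo[n nf]]; exists n => h /nf fh.
by exists i.
Qed.

(* The profinite topology: the cosets of the Gamma^(n) are a base. *)
HB.instance Definition _ := isOpenTopological.Build (Gamma p)
  Gamma_openT Gamma_openI Gamma_open_bigU.

(* The Borel sigma-algebra. *)
HB.instance Definition _ := Measurable.copy (Gamma p)
  (g_sigma_algebraType (@open (Gamma p))).

End GammaTopology.

Local Open Scope ring_scope.

(* The greatest n such that g h^-1 lies in Gamma^(n); meaningful for g != h. *)
Definition agree_level (p : nat) (g h : Gamma p) : nat :=
  get [set n : nat | level_stab n (g * h^-1)%g /\
    forall m : nat, level_stab m (g * h^-1)%g -> (m <= n)%N].

Definition Gamma_dist (R : realType) (p : nat) (g h : Gamma p) : R :=
  if g == h then 0 else ((quo_card p (agree_level g h))%:R)^-1.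

Section Hausdorff.
Variables (R : realType) (T : Type) (dist : T -> T -> R).
Local Open Scope ereal_scope.

Definition diam (U : set T) : \bar R :=
  ereal_sup [set (dist z.1 z.2)%:E | z in U `*` U].

(* diam(U)^s, with the empty set contributing 0 also when s = 0. *)
Definition diam_pow (s : R) (U : set T) : \bar R :=
  if `[< U = set0 >] then 0 else diam U `^ s.

Definition delta_cover (delta : R) (A : set T) : set (nat -> set T) :=
  [set U | A `<=` \bigcup_i U i /\ forall i, diam (U i) <= delta%:E].

Definition hausdorff_content (s delta : R) (A : set T) : \bar R :=
  ereal_inf [set \sum_(0 <= i <oo) diam_pow s (U i) | U in delta_cover delta A].

Definition hausdorff_measure (s : R) (A : set T) : \bar R :=
  ereal_sup [set hausdorff_content s delta A | delta in [set e : R | (0 < e)%R]].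

Definition hausdorff_dim (A : set T) : \bar R :=
  ereal_inf
    [set s%:E | s in [set s : R | (0 <= s)%R /\ hausdorff_measure s A = 0]].

End Hausdorff.

Definition is_subgroup (G : groupType) (H : set G) : Prop :=
  [/\ H 1%g, (forall x y, H x -> H y -> H (x * y)%g) &
     forall x, H x -> H (x^-1)%g].

Definition generated_subgroup (G : groupType) (S : set G) : set G :=
  smallest (@is_subgroup G) S.

(* Borel probability measures invariant under left translation. *)
Definition is_haar (R : realType) (p : nat)
    (mu : probability (Gamma p) R) : Prop :=
  forall (g : Gamma p) (A : set (Gamma p)), measurable A ->
    mu [set (g * h)%g | h in A] = mu A.

Definition mutually_independent (R : realType) (d d' : measure_display)
    (Omega : measurableType d) (T : measurableType d') (P : probability Omega R)
    (I : finType) (X : I -> {RV P >-> T}) : Prop :=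
  forall (J : {set I}) (A : I -> set T),
    (forall i, i \in J -> measurable (A i)) ->
    P (\bigcap_(i in [set` J]) X i @^-1` A i) =
    (\prod_(i in J) P (X i @^-1` A i))%E.

(* Main.v *)
(* Let H be the subgroup generated by the three elements, acting on words over
   'I_p. Suppose that any two distinct words x, y of length m have distinct
   prefixes x', y' of a common length t <= m such that the pairs of sections at
   x', y' of the elements of H fixing both words are arbitrary modulo level
   N - t. Commutators of elements of H whose supports meet in a single subtree
   then show that, modulo level N, H contains every commutator carried by one
   subtree of level M = O(m), hence every automorphism whose labels start at
   level M and sum to zero on each level of each such subtree. If m = O(log N)
   this makes log |H_n| / log |Gamma_n| close to 1 for all n <= N.

   Since the finite quotients are p-groups, the pair of sections at x', y' can
   only fail to be arbitrary if a nonzero linear form in the level sums of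
   their labels vanishes on the stabilizers. Fix the labels of the generators
   above level t; the labels below the orbit of x' are still free, and a
   relation of this kind determines all but few of them, so it has probability
   exponentially small in the size of that orbit. Orbits are large because the
   expected value of the sum over a level of |orbit|^-3 decreases geometrically
   from level to level. With N = 2^(l+1) and m = O(l) the exceptional
   probabilities are summable over l, and Borel-Cantelli applies.

   The Hausdorff dimension is bounded below by counting cosets: in a cover of
   the compact group by cylinders, the cylinders of level n_i satisfy
   sum_i 1 / |H_(n_i)| >= 1. *)

Require Import Defs.
From HB Require Import structures.
From mathcomp Require Import all_boot all_order all_algebra all_fingroup all_solvable.
From mathcomp Require Import all_classical all_reals all_analysis.
From mathcomp Require Import finmap zify ring lra.

Set Implicit Arguments.
Unset Strict Implicit.
Unset Printing Implicit Defensive.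

Import Order.TTheory GRing.Theory Num.Theory.

(* The number three enters through a count of free labels. Along an orbit O, a relation prescribes
   about |O| values, while three generators have 3|O| labels there. If both words lie in one orbit,
   only the labels off a half transversal can be varied; there are at least 3|O|/2 of them, still
   more than |O|, whereas two generators would leave no margin. The same surplus gives the
   probability p^-2 of no growth in the orbit recursion, against the p children of a vertex. Two
   levels i = 10 l and j = 90 p l appear because of one obstruction: elements fixing x' may have
   labels at y' proportional to those at x'. This has to be treated on the elements that also fix
   all words of level i, a condition invariant under conjugation by H. Fixing these words costs a
   factor p^(i p^i) in the count, so the orbits on level j must exceed a multiple of N + i p^i. On
   level i a multiple of N suffices, since p^O(N) pairs of forms have to be excluded. *)
Bind Scope group_scope with Gamma.
Bind Scope group_scope with Cp.

(** * Sections of tree automorphisms *)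

Section Tree.
Variable p : nat.
Local Open Scope group_scope.
Implicit Types (g h k : Gamma p) (u v w z : seq 'I_p).

Definition sec g z : Gamma p := fun u => g (z ++ u).

(* Equality in [Gamma_n]: see [level_stabP] and [eqp_of_act]. *)
Definition eqp (n : nat) g h := forall v, (size v < n)%N -> g v = h v.

Lemma GammaME g h v : (g * h) v = g v * h (tree_act g v).
Proof. by []. Qed.

Lemma Gamma1E v : (1 : Gamma p) v = 1.
Proof. by []. Qed.

Lemma tact1 v : tree_act (1 : Gamma p) v = v.
Proof. exact: tree_act1. Qed.

Lemma tactM g h v : tree_act (g * h) v = tree_act h (tree_act g v).
Proof. exact: tree_actM. Qed.

Lemma tactK g : cancel (tree_act g) (tree_act g^-1).
Proof. by move=> v; rewrite -tactM mulgV tact1. Qed.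

Lemma tactKV g : cancel (tree_act g^-1) (tree_act g).
Proof. by move=> v; rewrite -tactM mulVg tact1. Qed.

Lemma tact_inj g : injective (tree_act g).
Proof. exact: can_inj (tactK g). Qed.

Lemma GammaVE g v : (g^-1) v = (g (tree_act g^-1 v))^-1.
Proof.
have := GammaME g^-1 g v; rewrite mulVg Gamma1E => /esym/eqP.
by rewrite mulg_eq1 => /eqP.
Qed.

Lemma tact_cat g z u :
  tree_act g (z ++ u) = tree_act g z ++ tree_act (sec g z) u.
Proof. by elim: z g => [|x z IH] g //=; rewrite IH. Qed.

Lemma tact_rcons g z x :
  tree_act g (rcons z x) = rcons (tree_act g z) (sgval (g z) x).
Proof. by rewrite -!cats1 tact_cat /= /sec cats0. Qed.

Lemma tact_take g n v : take n (tree_act g v) = tree_act g (take n v).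
Proof.
rewrite -{1}(cat_take_drop n v) tact_cat; have [nv|vn] := leqP n (size v).
  by rewrite take_size_cat // size_tree_act size_takel.
by rewrite drop_oversize ?(ltnW vn) //= cats0 take_oversize // size_tree_act size_take; case: ifP => // _; rewrite ltnW.
Qed.

Lemma sec_cat g z u : sec (sec g z) u = sec g (z ++ u).
Proof. by apply/funext => v; rewrite /sec catA. Qed.

Lemma secM g h z : sec (g * h) z = sec g z * sec h (tree_act g z).
Proof. by apply/funext => u; rewrite GammaME /sec -tact_cat. Qed.

Lemma sec1 z : sec (1 : Gamma p) z = 1.
Proof. by []. Qed.

Lemma secV g z : sec g^-1 z = (sec g (tree_act g^-1 z))^-1.
Proof.
apply/eqP; rewrite -mulg_eq1; apply/eqP.
by rewrite -secM mulVg.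
Qed.

Lemma eqp_refl n g : eqp n g g. Proof. by []. Qed.
Lemma eqp_sym n g h : eqp n g h -> eqp n h g.
Proof. by move=> gh v vn; rewrite gh. Qed.
Lemma eqp_trans n g h k : eqp n g h -> eqp n h k -> eqp n g k.
Proof. by move=> gh hk v vn; rewrite gh ?hk. Qed.
Lemma eqp_le m n g h : (m <= n)%N -> eqp n g h -> eqp m g h.
Proof. by move=> mn gh v vm; rewrite gh // (leq_trans vm). Qed.

Lemma eqp_act n g h v : eqp n g h -> (size v <= n)%N -> tree_act g v = tree_act h v.
Proof.
move=> gh; elim/last_ind: v => [|v x IH] //; rewrite size_rcons => vn.
by rewrite !tact_rcons IH ?(ltnW vn) // gh.
Qed.

Lemma eqpM n g g' h h' : eqp n g g' -> eqp n h h' -> eqp n (g * h) (g' * h').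
Proof.
move=> gg hh v vn; rewrite !GammaME gg // hh ?size_tree_act //.
by rewrite (eqp_act gg) // ltnW.
Qed.

Lemma eqpV n g g' : eqp n g g' -> eqp n g^-1 g'^-1.
Proof.
move=> gg; have h : eqp n (g^-1 * g' * g'^-1) (g^-1 * g * g'^-1).
  by apply: eqpM => //; apply: eqpM => //; apply: eqp_sym.
by move: h; rewrite mulgK mulVg mul1g.
Qed.

Lemma eqpJ n g g' h h' : eqp n g g' -> eqp n h h' -> eqp n (g ^ h) (g' ^ h').
Proof. by move=> gg hh; rewrite !conjgE; do !apply: eqpM => //; apply: eqpV. Qed.

Lemma eqpR n g g' h h' : eqp n g g' -> eqp n h h' -> eqp n [~ g, h] [~ g', h'].
Proof. by move=> gg hh; rewrite !commgEl; apply: eqpM; [apply: eqpV|apply: eqpJ]. Qed.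

Lemma eqp_sec n g h z : eqp n g h -> eqp (n - size z) (sec g z) (sec h z).
Proof. by move=> gh v vn; apply: gh; rewrite size_cat; lia. Qed.

(** The label at a word of length below [n] shows in the action on any extension of length [n]. *)
Lemma eqp_of_act n g h :
  (forall v, size v = n -> tree_act g v = tree_act h v) -> eqp n g h.
Proof.
move=> gh v vn; apply/val_inj/permP => x /=.
have h1 : forall k, tree_act k (rcons v x) = take (size v).+1 (tree_act k (rcons v x ++ nseq (n - (size v).+1) x)).
  by move=> k; rewrite tact_take take_size_cat // size_rcons.
have := h1 g; rewrite [X in _ = take _ X]gh; last first.
  by rewrite size_cat size_rcons size_nseq; lia.
by rewrite -h1 !tact_rcons => /rcons_inj[].
Qed.

Lemma level_stabP n g : level_stab n g <-> eqp n g 1.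
Proof.
split=> [gn|gn v vn]; last by rewrite (eqp_act gn) ?vn // tact1.
by apply: eqp_of_act => v vn; rewrite tact1 gn.
Qed.

(** An element of the rigid stabilizer of the vertex [v]. *)
Definition rig v g : Gamma p :=
  fun u => if take (size v) u == v then g (drop (size v) u) else 1.

Lemma rigE v g u : rig v g (v ++ u) = g u.
Proof. by rewrite /rig take_size_cat // drop_size_cat // eqxx. Qed.

Lemma rig0 v g u : take (size v) u != v -> rig v g u = 1.
Proof. by rewrite /rig => /negbTE->. Qed.

Lemma sec_rig v g : sec (rig v g) v = g.
Proof. by apply/funext => u; rewrite /sec rigE. Qed.

Lemma eqp_rig1 v g n : (n <= size v)%N -> eqp n (rig v g) 1.
Proof.
move=> nv u un; rewrite rig0 //; apply: contraTneq un => /(congr1 size).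
by rewrite size_take_min -leqNgt => /minn_idPl; exact: leq_trans.
Qed.

End Tree.

Arguments eqp_sec {p n g h} z _.

(** * Labels as elements of the prime field *)

Section Label.
Variable p : nat.
Hypothesis p_prime : prime p.
Local Open Scope group_scope.
Implicit Types (g h k : Gamma p) (u v w z : seq 'I_p) (a b : Cp p).

Let p_gt0 : (0 < p)%N := prime_gt0 p_prime.
Definition ord_zero : 'I_p := Ordinal p_gt0.

Lemma rot_permX (k : nat) (x : 'I_p) :
  ((rot_perm p ^+ k) x : nat) = ((x + k) %% p)%N.
Proof.
rewrite permX; elim: k => [|k IH]; first by rewrite addn0 modn_small.
by rewrite iterS permE /= IH -addn1 modnDml addn1 addnS.
Qed.

Lemma CpP a : exists k : nat, sgval a = rot_perm p ^+ k.
Proof. by have /cycleP[k ->] := subgP a; exists k. Qed.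

(** [C_p] acts regularly on the letters, so the image of the letter 0 identifies it with the prime
    field. *)
Definition lab a : 'F_p := ((sgval a ord_zero : nat)%:R)%R.

Lemma natr_Fp_mod (n : nat) : ((n %% p)%:R = n%:R :> 'F_p)%R.
Proof.
by rewrite {2}(divn_eq n p) natrD natrM pchar_Fp_0 // mulr0 add0r.
Qed.

Lemma natr_Fp_eq (m n : nat) : (m%:R = n%:R :> 'F_p)%R -> (m %% p = n %% p)%N.
Proof.
by move=> /(congr1 (fun x : 'F_p => x : nat)); rewrite /= !val_Fp_nat.
Qed.

Lemma labE a (k : nat) : sgval a = rot_perm p ^+ k -> lab a = (k%:R)%R.
Proof. by move=> ak; rewrite /lab ak rot_permX add0n natr_Fp_mod. Qed.

Lemma labM a b : lab (a * b) = (lab a + lab b)%R.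
Proof.
have [k ak] := CpP a; have [l bl] := CpP b.
by rewrite (labE ak) (labE bl) (@labE _ (k + l)%N) ?natrD // sgvalM ?inE // ak bl expgD.
Qed.

Lemma lab1 : lab 1 = 0%R.
Proof. by rewrite (@labE _ 0%N). Qed.

Lemma labV a : lab a^-1 = (- lab a)%R.
Proof. by apply/eqP; rewrite -addr_eq0 -labM mulVg lab1. Qed.

Lemma lab_inj : injective lab.
Proof.
move=> a b; have [k ak] := CpP a; have [l bl] := CpP b.
rewrite (labE ak) (labE bl) => /natr_Fp_eq kl; apply/val_inj => /=.
rewrite ak bl; apply/permP => x; apply/val_inj => /=.
by rewrite !rot_permX -(modnDmr x k) kl modnDmr.
Qed.

Lemma lab_eq0 a : (lab a == 0%R) = (a == 1).
Proof. by rewrite -lab1 (inj_eq lab_inj). Qed.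

Lemma Cp_val a x : (sgval a x : nat) = ((x + lab a : nat) %% p)%N.
Proof.
have [k ak] := CpP a; rewrite (labE ak) ak rot_permX val_Fp_nat //.
by rewrite modnDmr.
Qed.

(** [p - x] stands for minus [x] modulo [p], which avoids truncated subtraction of [x] from [y]. *)
Definition rotto (x y : 'I_p) : Cp p := subg <[rot_perm p]> (rot_perm p ^+ (y + (p - x))).

Lemma rottoE x y : sgval (rotto x y) x = y.
Proof.
rewrite /rotto subgK ?mem_cycle //; apply/val_inj => /=; rewrite rot_permX.
have -> : (x + (y + (p - x)) = y + p)%N by have := ltn_ord x; lia.
by rewrite modnDr modn_small.
Qed.

Definition unlab (c : 'F_p) : Cp p := subg <[rot_perm p]> (rot_perm p ^+ (c : nat)).

Lemma unlabK : cancel unlab lab.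
Proof.
move=> c; rewrite (@labE _ (c : nat)) ?natr_Zp //.
by rewrite subgK ?mem_cycle.
Qed.

Lemma labK : cancel lab unlab.
Proof. by move=> a; apply: lab_inj; rewrite unlabK. Qed.

Lemma card_Cp : #|{: Cp p}| = p.
Proof.
rewrite -[RHS](card_Fp p_prime); apply: bij_eq_card.
by exists unlab; [exact: labK|exact: unlabK].
Qed.

Lemma Cp_fixP a x : sgval a x = x <-> a = 1.
Proof.
split=> [ax|->]; last by rewrite perm1.
apply/eqP; rewrite -lab_eq0; have := Cp_val a x; rewrite ax => h.
have xp := ltn_ord x; have ap : ((lab a : nat) < p)%N.
  by rewrite /lab val_Fp_nat // ltn_pmod.
apply/eqP/val_inj => /=; move: h.
have [h|h] := ltnP (x + lab a)%N p; first by rewrite modn_small //; lia.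
rewrite -{1}(@modn_small x p) // -(subnK h) modnDr modn_small; last by lia.
rewrite modn_small //; lia.
Qed.

Lemma CpXp a : a ^+ p = 1.
Proof.
apply: lab_inj; rewrite lab1.
suff -> : forall n : nat, lab (a ^+ n) = (lab a *+ n)%R.
  by rewrite -mulr_natr pchar_Fp_0 // mulr0.
by elim=> [|n IH]; rewrite ?expg0 ?lab1 ?mulr0n // expgS labM IH mulrS.
Qed.

End Label.

(** * Homomorphisms to the prime field *)

Section LevelSums.
Variable p : nat.
Hypothesis p_prime : prime p.
Local Open Scope group_scope.
Implicit Types (g h k : Gamma p) (u v w z : seq 'I_p) (a b : Cp p).
Local Notation lab := (lab p_prime).
Local Notation unlab := (@unlab p).

Lemma act_tupleP g j (u : j.-tuple 'I_p) : size (tree_act g u) == j.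
Proof. by rewrite size_tree_act size_tuple. Qed.
Definition act_tuple g j (u : j.-tuple 'I_p) : j.-tuple 'I_p :=
  Tuple (act_tupleP g u).

Lemma act_tuple_inj g j : injective (@act_tuple g j).
Proof. by move=> u v /(congr1 val) /= /tact_inj /val_inj. Qed.

(** A homomorphism, since an automorphism permutes each level. By [hom_lform] these sums span all
    homomorphisms to the prime field that factor through a level. *)
Definition lsum j g : 'F_p := (\sum_(u : j.-tuple 'I_p) lab (g u))%R.

Lemma lsumM j g h : lsum j (g * h) = (lsum j g + lsum j h)%R.
Proof.
rewrite /lsum [X in (_ + X)%R](reindex_inj (@act_tuple_inj g j)) -big_split /=.
by apply: eq_bigr => u _; rewrite GammaME labM.
Qed.

Definition lform (c : nat -> 'F_p) r g : 'F_p := (\sum_(j < r) c j * lsum j g)%R.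

Lemma lformM c r g h : lform c r (g * h) = (lform c r g + lform c r h)%R.
Proof.
rewrite /lform -big_split /=; apply: eq_bigr => j _.
by rewrite lsumM mulrDr.
Qed.

Lemma lsum_eqp j n g h : (j < n)%N -> eqp n g h -> lsum j g = lsum j h.
Proof.
by move=> jn gh; apply: eq_bigr => u _; rewrite gh ?size_tuple.
Qed.

Lemma lform_eqp c r g h : eqp r g h -> lform c r g = lform c r h.
Proof. by move=> gh; apply: eq_bigr => j _; rewrite (lsum_eqp _ gh). Qed.

Lemma lform1 c r : lform c r 1 = 0%R.
Proof.
by apply/eqP; rewrite -(inj_eq (addrI (lform c r 1))) -lformM mulg1 addr0.
Qed.

Lemma lformV c r g : lform c r g^-1 = (- lform c r g)%R.
Proof. by apply/eqP; rewrite -addr_eq0 -lformM mulVg lform1. Qed.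

Definition lev j (phi : seq 'I_p -> Cp p) : Gamma p :=
  fun v => if size v == j then phi v else 1.

Lemma lev_act j phi v : (size v <= j)%N -> tree_act (lev j phi) v = v.
Proof.
move=> vj; rewrite -[RHS]tact1; apply: (@eqp_act _ j) => // u uj.
by rewrite /lev ltn_eqF.
Qed.

Lemma levM j phi psi : lev j phi * lev j psi = lev j (fun v => phi v * psi v).
Proof.
apply/funext => v; rewrite GammaME {1 3}/lev; case: eqP => [vj|vj].
  by rewrite lev_act ?vj // /lev vj eqxx.
by rewrite /lev size_tree_act; case: eqP => // _; rewrite mulg1.
Qed.

Lemma lev_eq j phi psi :
  (forall v, size v = j -> phi v = psi v) -> lev j phi = lev j psi.
Proof. by move=> e; apply/funext => v; rewrite /lev; case: eqP => // /e. Qed.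

Lemma lev1 j : lev j (fun=> 1) = 1.
Proof. by apply/funext => v; rewrite /lev if_same. Qed.

Definition dlt u a : Gamma p := lev (size u) (fun v => if v == u then a else 1).

Lemma dltE u a v : dlt u a v = if v == u then a else 1.
Proof. by rewrite /dlt /lev; case: (v =P u) => [->|]; rewrite ?eqxx ?if_same. Qed.

Lemma dltM u a b : dlt u a * dlt u b = dlt u (a * b).
Proof.
by rewrite levM; congr lev; apply/funext => v; case: eqP; rewrite ?mulg1.
Qed.

(** Labels sit only on the path to [u], so the section at [u] is trivial and conjugation by [mv u v]
    carries a single label from [u] to [v] unchanged. *)
Fixpoint mv u v : Gamma p :=
  match u, v with
  | x :: u', y :: v' => fun w =>
      if w is z :: w' then (if z == x then mv u' v' w' else 1) else rotto x y
  | _, _ => 1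
  end.

Lemma mv_act u v : size u = size v -> tree_act (mv u v) u = v.
Proof.
elim: u v => [|x u IH] [|y v] //= [uv]; rewrite (rottoE p_prime); congr (_ :: _).
rewrite -[RHS](IH _ uv); congr (tree_act _ _).
by apply/funext => w; rewrite /subtree eqxx.
Qed.

Lemma mv_sec u v : size u = size v -> sec (mv u v) u = 1.
Proof.
elim: u v => [|x u IH] [|y v] // [uv].
rewrite -(IH _ uv); apply/funext => w; by rewrite /sec /= eqxx.
Qed.

Lemma act_dlt u a v : tree_act (dlt u a) v =
  if (take (size u) v == u) then
    (if drop (size u) v is x :: w then u ++ sgval a x :: w else v)
  else v.
Proof.
have out v' : ~~ ((size u < size v')%N && (take (size u) v' == u)) ->
    tree_act (dlt u a) v' = v'.
  elim/last_ind: v' => // v' x IH; rewrite size_rcons ltnS => h.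
  rewrite tact_rcons IH; last first.
    apply: contra h => /andP[uv]; rewrite (ltnW uv) -cats1 take_cat uv => /eqP->.
    by rewrite eqxx.
  rewrite dltE; case: eqP => [vu|_]; last by rewrite perm1.
  by move: h; rewrite -vu leqnn -cats1 take_size_cat // eqxx.
have [uv|vu] := leqP (size v) (size u).
  by rewrite out ?drop_oversize ?if_same // ltnNge uv.
case: eqP => [/esym e|/eqP e]; last by rewrite out // (negbTE e) andbF.
rewrite -{1}(cat_take_drop (size u) v) -e tact_cat lev_act //.
case: (drop _ _) (size_drop (size u) v) => [/eqP|x w _].
  by rewrite eq_sym subn_eq0 leqNgt vu.
congr (_ ++ _) => /=; rewrite /sec cats0 dltE eqxx; congr (_ :: _).
rewrite -[RHS]tact1; congr (tree_act _ _); apply/funext => y.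
rewrite /subtree dltE; case: eqP => // /(congr1 size) /eqP.
by rewrite size_cat /= -{2}[size u]addn0 eqn_add2l.
Qed.

Lemma dltJ u v a g : size u = size v -> tree_act g u = v -> sec g u = 1 ->
  dlt u a ^ g = dlt v a.
Proof.
move=> suv guv gs; suff e : dlt u a * g = g * dlt v a.
  by rewrite conjgE e mulKg.
apply: tree_act_inj => w; rewrite !tactM !act_dlt.
have e1 : take (size v) (tree_act g w) = tree_act g (take (size u) w).
  by rewrite tact_take suv.
rewrite e1 -guv (inj_eq (tact_inj (g := g))); case: eqP => // e2.
rewrite -[in tree_act g w](cat_take_drop (size u) w) e2 tact_cat gs tact1.
rewrite size_tree_act drop_size_cat ?size_tree_act //.
case: (drop _ _) (cat_take_drop (size u) w) => [e3|x w' _]; first by rewrite -{1}e3 e2 !cats0.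
by rewrite tact_cat gs tact1.
Qed.

Lemma lsum_dlt j u a : lsum j (dlt u a) = (if j == size u then lab a else 0)%R.
Proof.
rewrite /lsum; case: eqP => [->|ju].
  rewrite (bigD1 (in_tuple u)) //= dltE eqxx big1 ?addr0 // => v vu.
  rewrite dltE; case: eqP => [e|_]; last exact: lab1.
  by case/eqP: vu; apply: val_inj.
rewrite big1 // => v _; rewrite dltE; case: eqP => [e|_]; last exact: lab1.
by case: ju; rewrite -e size_tuple.
Qed.

Lemma lform_dlt c r u a : (size u < r)%N -> lform c r (dlt u a) = (c (size u) * lab a)%R.
Proof.
move=> ur; rewrite /lform (bigD1 (Ordinal ur)) //= lsum_dlt eqxx big1 ?addr0 //.
move=> j ju; rewrite lsum_dlt; case: eqP => [e|_]; last by rewrite mulr0.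
by case/eqP: ju; apply: val_inj.
Qed.

Section Hom.
Variables (r : nat) (f : Gamma p -> 'F_p).
Hypothesis fM : forall g h, f (g * h) = (f g + f h)%R.
Hypothesis f_eqp : forall g, eqp r g 1 -> f g = 0%R.

Lemma hom_one : f 1 = 0%R. Proof. exact: f_eqp. Qed.
Lemma hom_inv g : f g^-1 = (- f g)%R.
Proof. by apply/eqP; rewrite -addr_eq0 -fM mulVg hom_one. Qed.

(** A homomorphism to an abelian group is constant on conjugacy classes, and equal single labels on
    one level are conjugate. *)
Lemma hom_dlt u v a : size u = size v -> f (dlt u a) = f (dlt v a).
Proof.
move=> uv; rewrite -(@dltJ u v a (mv u v)) ?mv_act ?mv_sec //.
by rewrite conjgE !fM hom_inv; ring.
Qed.

(** Single labels generate the group modulo level [r]: peel off one level at a time and split each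
    level into its single labels. *)
Lemma hom_zero : (forall u a, (size u < r)%N -> f (dlt u a) = 0%R) ->
  forall g, f g = 0%R.
Proof.
move=> f0.
have flev j phi : (j < r)%N -> f (lev j phi) = 0%R.
  move=> jr; pose res (s : seq (seq 'I_p)) v := if v \in s then phi v else 1.
  have fres s : all (fun v => size v == j) s -> uniq s -> f (lev j (res s)) = 0%R.
    elim: s => [_ _|u s IH /= /andP[/eqP uj sj] /andP[us us']].
      by rewrite -hom_one; congr f; apply: lev1.
    have -> : lev j (res (u :: s)) = dlt u (phi u) * lev j (res s).
      rewrite /dlt uj levM; apply: lev_eq => v vj; rewrite /res inE.
      case: eqP => [->|_] /=; last by rewrite mul1g.
      by rewrite (negbTE us) mulg1.
    by rewrite fM f0 ?uj // IH // addr0.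
  have -> : lev j phi = lev j (res (map (@tval j 'I_p) (enum {: j.-tuple 'I_p}))).
    apply: lev_eq => v vj; rewrite /res; case: mapP => // -[].
    by exists (tcast vj (in_tuple v)); rewrite ?mem_enum ?val_tcast.
  apply: fres; last by rewrite map_inj_uniq ?enum_uniq //; apply: val_inj.
  by apply/allP => v /mapP[u _ ->]; rewrite size_tuple.
have H n g : eqp (r - n) g 1 -> f g = 0%R.
  elim: n g => [|n IH] g; first by rewrite subn0; apply: f_eqp.
  have [nr|rn] := ltnP n r; last by move=> e; apply: IH; apply: eqp_le e; lia.
  move=> e; set j := (r - n.+1)%N in e.
  have jr : (j < r)%N by rewrite /j; lia.
  have -> : g = lev j g * ((lev j g)^-1 * g) by rewrite mulKVg.
  rewrite fM flev // add0r; apply: IH => v vn.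
  have vj : (size v <= j)%N by move: vn; rewrite /j; lia.
  rewrite GammaME GammaVE.
  have -> : tree_act (lev j g)^-1 v = v.
    by apply: (tact_inj (g := lev j g)); rewrite tactKV lev_act.
  rewrite /lev; case: eqP => [_|/eqP vj']; first by rewrite mulVg.
  by rewrite invg1 mul1g e // ltn_neqAle vj'.
by move=> g; apply: (H r); rewrite subnn.
Qed.
End Hom.

(** The coefficients are the values of [f] at label 1 on words of zeros; by conjugacy the difference
    of [f] and the form vanishes on all single labels. *)
Lemma hom_lform (r : nat) (f : Gamma p -> 'F_p)
  (fM : forall g h, f (g * h) = (f g + f h)%R)
  (f_eqp : forall g, eqp r g 1 -> f g = 0%R) : exists c, forall g, f g = lform c r g.
Proof.
pose c j := f (dlt (nseq j (ord_zero p_prime)) (unlab 1%R)); exists c.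
suff : forall g, (f g - lform c r g)%R = 0%R.
  by move=> h g; apply/eqP; rewrite -subr_eq0 h.
have fM' g h : (f (g * h)%g - lform c r (g * h)%g =
   (f g - lform c r g) + (f h - lform c r h))%R by rewrite fM lformM; ring.
pose f' g := (f g - lform c r g)%R.
suff f'0 u a : (size u < r)%N -> f' (dlt u a) = 0%R.
  apply: (@hom_zero r f') => // g e.
  by rewrite /f' (f_eqp _ e) (lform_eqp _ e) lform1 subrr.
move=> ur; rewrite /f' lform_dlt // (@hom_dlt r f fM f_eqp u (nseq (size u) (ord_zero p_prime))); last by rewrite size_nseq.
set z := nseq _ _; rewrite -[a in dlt z a](labK p_prime).
have fn (n : nat) : f (dlt z (unlab n%:R%R)) = (c (size u) *+ n)%R.
  elim: n => [|n IH].
    rewrite [RHS]mulr0n -[RHS](hom_one f_eqp); congr f; apply/funext => v; rewrite dltE.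
    by case: eqP => // _; rewrite mulr0n -(lab1 p_prime) labK.
  rewrite [RHS]mulrSr -IH /c -/z -fM dltM; congr (f (dlt _ _)).
  by apply: (lab_inj (p_prime := p_prime)); rewrite labM !unlabK -natr1.
by rewrite -[in dlt z _](natr_Zp (lab a)) fn -mulr_natr natr_Zp subrr.
Qed.

End LevelSums.

(** * Proper subgroups of p-groups and surjectivity onto pairs *)

Lemma pgroup_proper_hom (p : nat) (gT : finGroupType) (G B : {group gT}) :
  prime p -> (p.-group G)%g -> B \subset G -> B != G ->
  exists chi : gT -> 'F_p, [/\ forall x y, x \in G -> y \in G -> chi (x * y)%g = chi x + chi y,
    forall x, x \in B -> chi x = 0 & exists2 x, x \in G & chi x != 0]%R.
Proof.
move=> p_pr pG sBG nBG.
(* A maximal subgroup of a p-group is normal of index [p]; exponents of a generator of the quotient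
   give the character. *)
have [eBG|[M maxM sBM]] := maximal_exists sBG.
  by case/eqP: nBG; apply/val_inj.
have nMG := p_maximal_normal pG maxM.
have iM := p_maximal_index pG maxM.
have cQ : #|G / M|%g = p by rewrite card_quotient ?normal_norm.
have /cyclicP[X defX] : cyclic (G / M) by apply: prime_cyclic; rewrite cQ.
have oX : #[X]%g = p by rewrite /order -defX cQ.
have ex x : exists k : nat, x \in G -> coset M x = (X ^+ k)%g.
  have [xG|] := boolP (x \in G); last by exists 0%N.
  have : coset M x \in (G / M)%g by apply: mem_quotient.
  by rewrite defX => /cycleP[k ->]; exists k.
pose kk x := sval (cid (ex x)).
have kkP x : x \in G -> coset M x = (X ^+ kk x)%g := svalP (cid (ex x)).
have GN x : x \in G -> x \in 'N(M)%g by exact: (fintype.subsetP (normal_norm nMG)).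
exists (fun x => (kk x)%:R%R); split.
- move=> x y xG yG; apply/eqP; rewrite -natrD -subr_eq0.
  have : (X ^+ kk (x * y) = X ^+ (kk x + kk y))%g.
    by rewrite -kkP ?groupM // expgD -!kkP // morphM ?GN.
  move/eqP; rewrite eq_expg_mod_order oX => /eqP e.
  by rewrite -(natr_Fp_mod p_pr) e (natr_Fp_mod p_pr) subrr.
- move=> x xB; have xG := fintype.subsetP sBG x xB.
  have : (X ^+ kk x = X ^+ 0)%g.
    by rewrite -kkP // expg0 coset_id // (fintype.subsetP sBM).
  by move/eqP; rewrite eq_expg_mod_order oX mod0n => /eqP e; rewrite -(natr_Fp_mod p_pr) e.
- have : X \in (G / M)%g by rewrite defX cycle_id.
  case/morphimP=> x xN xG /= eX; exists x => //.
  have : (X ^+ kk x = X ^+ 1)%g by rewrite -kkP // expg1.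
  move/eqP; rewrite eq_expg_mod_order oX => /eqP e.
  rewrite -(natr_Fp_mod p_pr) e (natr_Fp_mod p_pr) oner_neq0 //.
Qed.

Section Frattini.
Variable p : nat.
Hypothesis p_prime : prime p.
Local Open Scope group_scope.
Implicit Types (g h k : Gamma p) (u v w z : seq 'I_p) (a b : Cp p).

Definition act_perm n g : {perm n.-tuple 'I_p} := perm (@act_tuple_inj p g n).

Lemma act_permE n g (u : n.-tuple 'I_p) : act_perm n g u = tree_act g u :> seq _.
Proof. by rewrite permE. Qed.

Lemma act_permM n g h : act_perm n (g * h) = act_perm n g * act_perm n h.
Proof.
by apply/permP => u; rewrite permM; apply: val_inj; rewrite /= !act_permE tactM.
Qed.

Lemma act_perm_eqp n g h : eqp n g h <-> act_perm n g = act_perm n h.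
Proof.
split=> [gh|gh].
  by apply/permP => u; apply: val_inj; rewrite /= !act_permE (eqp_act gh) ?size_tuple.
apply: eqp_of_act => v vn.
pose u := tcast vn (in_tuple v); have uv : u = v :> seq _ by rewrite val_tcast.
by rewrite -uv -!act_permE gh.
Qed.

Lemma act_perm1 n : act_perm n 1 = 1.
Proof. by apply/permP => u; apply: val_inj; rewrite /= act_permE perm1 tact1. Qed.

Lemma act_permX n g m : act_perm n (g ^+ m) = act_perm n g ^+ m.
Proof. by elim: m => [|m IH]; rewrite ?expg0 ?act_perm1 // !expgS act_permM IH. Qed.

Lemma exp_fix n g v : tree_act g v = v -> tree_act (g ^+ n) v = v.
Proof. by move=> gv; elim: n => [|n IH]; rewrite ?expg0 ?tact1 // expgS tactM gv. Qed.

Lemma exp_label n g v : tree_act g v = v -> (g ^+ n) v = g v ^+ n.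
Proof.
move=> gv; elim: n => [|n IH]; first by rewrite !expg0.
by rewrite !expgS GammaME gv IH.
Qed.

(** Each further [p]-th power kills the label at a word already fixed, since [C_p] has exponent
    [p]. *)
Lemma exp_level n g v : (size v <= n)%N -> tree_act (g ^+ (p ^ n)) v = v.
Proof.
elim/last_ind: v n => [|v x IH] [|n] //=; rewrite size_rcons // => vn.
rewrite expnSr expgM tact_rcons exp_fix ?IH // exp_label ?IH //.
by rewrite CpXp // perm1.
Qed.

Lemma act_perm_pelt n g : p.-elt (act_perm n g).
Proof.
rewrite /p_elt; apply: (@pnat_dvd _ (p ^ n)%N); last by rewrite pnatX pnat_id.
rewrite order_dvdn -act_permX; apply/eqP/permP => u; apply: val_inj.
by rewrite /= act_permE perm1 exp_level ?size_tuple.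
Qed.

Lemma pgroup_elts (gT : finGroupType) (G : {group gT}) :
  (forall x, x \in G -> p.-elt x) -> p.-group G.
Proof.
move=> h; apply/pgroupP => q q_pr /(Cauchy q_pr)[x xG ox].
by have := h x xG; rewrite /p_elt ox pnatE.
Qed.

Definition act_img n : {set {perm n.-tuple 'I_p}} :=
  [set s | `[< exists g, act_perm n g = s >]].

Lemma act_imgP n s : reflect (exists g, act_perm n g = s) (s \in act_img n).
Proof. by rewrite inE; apply: asboolP. Qed.

Lemma act_img_group_set n : group_set (act_img n).
Proof.
apply/group_setP; split; first by apply/act_imgP; exists 1; rewrite act_perm1.
move=> _ _ /act_imgP[g <-] /act_imgP[h <-]; apply/act_imgP; exists (g * h).
by rewrite act_permM.
Qed.
Canonical act_img_group n := Group (act_img_group_set n).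

(* A proper subgroup of a finite p-group is killed by a nonzero homomorphism to
   'F_p, and [hom_lform] describes those of the tree group. *)
Lemma pair_onto r (B : set (Gamma p * Gamma p)%type) :
  B (1, 1) -> (forall x y, B x -> B y -> B (x.1 * y.1, x.2 * y.2)) ->
  (forall c c' : nat -> 'F_p, (exists j, (j < r)%N /\ (c j != 0 \/ c' j != 0)%R) ->
     exists x, B x /\ (lform p_prime c r x.1 + lform p_prime c' r x.2 != 0)%R) ->
  forall a b : Gamma p, exists x, [/\ B x, eqp r x.1 a & eqp r x.2 b].
Proof.
move=> B1 BM Bc a b.
pose G := [group of finset.setX (act_img r) (act_img r)].
pose pi2 (x : Gamma p * Gamma p) := (act_perm r x.1, act_perm r x.2).
have pi2M x y : pi2 (x.1 * y.1, x.2 * y.2) = pi2 x * pi2 y.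
  by rewrite /pi2 /= !act_permM.
pose B' := [set s | `[< exists x, B x /\ pi2 x = s >]]%SET.
have B'P s : reflect (exists x, B x /\ pi2 x = s) (s \in B').
  by rewrite finset.inE; apply: asboolP.
have gB : group_set B'.
  apply/group_setP; split.
    by apply/B'P; exists (1, 1); rewrite /pi2 /= !act_perm1.
  move=> _ _ /B'P[x [Bx <-]] /B'P[y [By <-]]; apply/B'P.
  by exists (x.1 * y.1, x.2 * y.2); rewrite /pi2 /= !act_permM; split=> //; apply: BM.
have memG x : pi2 x \in G.
  by rewrite finset.in_setX; apply/andP; split; apply/act_imgP; [exists x.1|exists x.2].
have pG : p.-group G.
  apply: pgroup_elts => -[s t]; rewrite finset.in_setX => /andP[/act_imgP[g /= <-] /act_imgP[h /= <-]].
  apply: (@pnat_dvd _ (p ^ r)%N); last by rewrite pnatX pnat_id.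
  rewrite order_dvdn; apply/eqP.
  have -> : forall n, (act_perm r g, act_perm r h) ^+ n = pi2 (g ^+ n, h ^+ n).
    elim=> [|n IH]; first by rewrite /pi2 !expg0 /= !act_perm1.
    by rewrite !expgS IH /pi2 /= !act_permM.
  rewrite /pi2 /=; congr (_, _); apply/permP => u; apply: val_inj;
    by rewrite /= act_permE perm1 exp_level ?size_tuple.
have sBG : B' \subset G.
  by apply/fintype.subsetP => _ /B'P[x [_ <-]]; apply: memG.
have [eBG|nBG] := eqVneq (Group gB) G.
  have : pi2 (a, b) \in Group gB by rewrite eBG.
  case/B'P=> x [Bx [e1 e2]]; exists x.
  by split=> //; apply/act_perm_eqp.
have [chi [chiM chiB [s sG chis]]] := @pgroup_proper_hom p _ G (Group gB) p_prime pG sBG nBG.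
(* The character is the sum of its restrictions to the two factors, and each of these is a form in
   the level sums. *)
pose f1 g := chi (pi2 (g, 1)); pose f2 g := chi (pi2 (1, g)).
have chi1 : chi (pi2 (1, 1)) = 0%R.
  by apply: chiB; apply/B'P; exists (1, 1).
have [c cP] : exists c, forall g, f1 g = lform p_prime c r g.
  apply: hom_lform => [g h|g e].
    by rewrite /f1 -chiM ?memG // -pi2M /= mulg1.
  by rewrite -[RHS]chi1 /f1; congr chi; rewrite /pi2 /=; congr (_, _); apply/act_perm_eqp.
have [c' cP'] : exists c, forall g, f2 g = lform p_prime c r g.
  apply: hom_lform => [g h|g e].
    by rewrite /f2 -chiM ?memG // -pi2M /= mulg1.
  by rewrite -[RHS]chi1 /f2; congr chi; rewrite /pi2 /=; congr (_, _); apply/act_perm_eqp.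
have chiE x : chi (pi2 x) = (lform p_prime c r x.1 + lform p_prime c' r x.2)%R.
  rewrite -cP -cP' -chiM ?memG //; congr chi.
  by rewrite -pi2M /= mulg1 mul1g; case: x.
have [|x [Bx]] := Bc c c'; last first.
  by rewrite -chiE chiB ?eqxx //; apply/B'P; exists x.
apply: contrapT => hn; case/eqP: chis.
move: sG; case: s => s t; rewrite finset.in_setX => /andP[/act_imgP[g /= <-] /act_imgP[h /= <-]].
have := chiE (g, h); rewrite /pi2 /= => ->; rewrite /lform !big1 ?addr0 // => j _.
  case: (eqVneq (c' j) 0%R) => [->|n]; first by rewrite mul0r.
  by case: hn; exists j; split; [exact: ltn_ord|right].
case: (eqVneq (c j) 0%R) => [->|n]; first by rewrite mul0r.
by case: hn; exists j; split; [exact: ltn_ord|left].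
Qed.

End Frattini.

(** * Commutators supported in one subtree *)

Section Rigid.
Variable p : nat.
Hypothesis p_prime : prime p.
Local Open Scope group_scope.
Implicit Types (g h k e f s : Gamma p) (u v w z : seq 'I_p).

Lemma rig_act v g u : tree_act (rig v g) (v ++ u) = v ++ tree_act g u.
Proof.
rewrite tact_cat sec_rig; congr (_ ++ _).
by rewrite (eqp_act (@eqp_rig1 p v g _ (leqnn _))) ?tact1.
Qed.

Lemma rig_act0 v g w : take (size v) w != v -> tree_act (rig v g) w = w.
Proof.
elim/last_ind: w => // w x IH h; rewrite tact_rcons.
have h' : take (size v) w != v.
  apply: contra h => /eqP e; rewrite -cats1 takel_cat ?e //.
  by rewrite -e size_take_min geq_minr.
by rewrite IH // rig0 // perm1.
Qed.

Lemma rig_eq v g h : (forall u, tree_act h (v ++ u) = v ++ tree_act g u) ->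
  (forall w, take (size v) w != v -> tree_act h w = w) -> h = rig v g.
Proof.
move=> h1 h2; apply: tree_act_inj => w.
have [e|ne] := eqVneq (take (size v) w) v; last by rewrite h2 // rig_act0.
by rewrite -(cat_take_drop (size v) w) e h1 rig_act.
Qed.

Lemma rigM v g h : rig v (g * h) = rig v g * rig v h.
Proof.
apply/esym/rig_eq => [u|w nw]; first by rewrite tactM !rig_act tactM.
by rewrite tactM !rig_act0 // rig_act0.
Qed.

Lemma rig1 v : rig v (1 : Gamma p) = 1.
Proof. by apply/esym/rig_eq => u; rewrite !tact1. Qed.

Lemma rigV v g : rig v g^-1 = (rig v g)^-1.
Proof. by apply/eqP; rewrite -mulg_eq1 -rigM mulVg rig1. Qed.

Lemma rigR v g h : rig v [~ g, h] = [~ rig v g, rig v h].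
Proof. by rewrite !commgEl !conjgE !(rigM, rigV). Qed.

Lemma rig_cat u v g : rig u (rig v g) = rig (u ++ v) g.
Proof.
apply: rig_eq => [w|w]; first by rewrite -[in LHS]catA !rig_act catA.
rewrite size_cat => nw; have [e|ne] := eqVneq (take (size u) w) u; last first.
  by rewrite rig_act0.
rewrite -(cat_take_drop (size u) w) e rig_act rig_act0 //.
apply: contra nw => /eqP e'.
by rewrite -(cat_take_drop (size u) w) e take_cat ltnNge leq_addr /= addKn e'.
Qed.

Lemma act_subtree e v w : tree_act e v = v ->
  (take (size v) (tree_act e w) == v) = (take (size v) w == v).
Proof. by move=> ev; rewrite tact_take -{2}ev (inj_eq (@tact_inj _ _)). Qed.

(** Outside the subtree of [v] the element [f] is trivial, and inside it but off [v ++ b] the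
    element [e] is, so they commute except on the subtree of [v ++ b]. *)
Lemma comm_rig v b e f g h :
  (forall u, tree_act e ((v ++ b) ++ u) = (v ++ b) ++ tree_act g u) ->
  (forall u, tree_act f ((v ++ b) ++ u) = (v ++ b) ++ tree_act h u) ->
  (forall w, take (size v) w != v -> tree_act f w = w) ->
  (forall w, take (size v) w = v -> take (size (v ++ b)) w != v ++ b ->
     tree_act e w = w) ->
  [~ e, f] = rig (v ++ b) [~ g, h].
Proof.
move=> eg fh fout eout.
have fixb k g' : (forall u, tree_act k ((v ++ b) ++ u) = (v ++ b) ++ tree_act g' u) ->
    tree_act k (v ++ b) = v ++ b by move=> /(_ [::]); rewrite !cats0.
have eb := fixb _ _ eg; have fb := fixb _ _ fh.
have fixv k : tree_act k (v ++ b) = v ++ b -> tree_act k v = v.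
  by move=> /(congr1 (take (size v))); rewrite tact_take take_size_cat.
have ev := fixv _ eb; have fv := fixv _ fb.
suff H : e * f = f * e * rig (v ++ b) [~ g, h].
  by move: H; rewrite commgC => /mulgI.
apply: tree_act_inj => w; rewrite !tactM.
have [eq1|ne1] := eqVneq (take (size (v ++ b)) w) (v ++ b).
  rewrite -(cat_take_drop (size (v ++ b)) w) eq1 eg !fh eg rig_act.
  by rewrite -!tactM [in LHS]commgC -[in LHS]mulgA.
have ne2 : take (size (v ++ b)) (tree_act e (tree_act f w)) != v ++ b.
  by rewrite act_subtree // act_subtree.
rewrite rig_act0 //.
have [eq3|ne3] := eqVneq (take (size v) w) v.
  rewrite (eout w) // (eout (tree_act f w)) //; last by rewrite act_subtree.
  by apply/eqP; rewrite act_subtree // eq3.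
by rewrite (fout w) // fout // act_subtree.
Qed.

(** As [s] moves [v], the conjugate by [s] of the inverse factor acts in another subtree. *)
Lemma comm_move s v b g w : tree_act s v <> v -> take (size v) w = v ->
  tree_act [~ s, rig (v ++ b) g] w = tree_act (rig (v ++ b) g) w.
Proof.
move=> sv wv; rewrite commgEl conjgE !tactM -rigV (@rig_act0 _ g^-1); first by rewrite tactKV.
apply: contra_not_neq sv => h.
have : take (size v) (tree_act s^-1 w) = v.
  have e : take (size v) (v ++ b) = v by rewrite take_size_cat.
  by rewrite -[RHS]e -h take_takel // size_cat leq_addr.
by rewrite tact_take wv => e; rewrite -{1}e tactKV.
Qed.

(** The inner commutator agrees with [rig v g] on the subtree of [v], and its action elsewhere
    commutes with [rig v h]. *)
Lemma comm_comm_rig s v g h : tree_act s v <> v ->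
  [~ [~ s, rig v g], rig v h] = rig v [~ g, h].
Proof.
move=> sv; have := @comm_rig v [::] [~ s, rig v g] (rig v h) g h.
rewrite cats0; apply.
- move=> u; have := @comm_move s v [::] g (v ++ u) sv; rewrite cats0 => ->.
    by rewrite rig_act.
  by rewrite take_size_cat.
- by move=> u; rewrite rig_act.
- by move=> w /rig_act0.
- by move=> w -> /eqP.
Qed.

Definition rot1 : Gamma p := lev 0 (fun=> unlab (1%R : 'F_p)).

Lemma rot1_act x u : tree_act rot1 (x :: u) = sgval (unlab (1%R : 'F_p)) x :: u.
Proof. by rewrite /= -[u in RHS]tact1. Qed.

Lemma rot1_neq x : sgval (unlab (1%R : 'F_p)) x <> x.
Proof.
move=> /(Cp_fixP p_prime) /(congr1 (lab p_prime)); rewrite unlabK lab1 => /eqP.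
by rewrite oner_eq0.
Qed.

(** Going down two letters leaves room for one element moving [[:: a]] and one moving [[:: a; b]]. A
    commutator of commutators is what the inductive step of [St_elt_comm] can produce. *)
Lemma rig_double_comm a b g h :
  exists e1 e2 f1 f2, [~ [~ e1, e2], [~ f1, f2]] = rig [:: a; b] [~ g, h].
Proof.
pose X := rot1; pose Y := rig [:: a] rot1.
exists X, (rig [:: a; b] g), Y, (rig [:: a; b] h).
have Xm : tree_act X [:: a] <> [:: a] by rewrite rot1_act => -[/rot1_neq].
have Ym : tree_act Y [:: a; b] <> [:: a; b].
  by rewrite (rig_act [:: a] rot1 [:: b]) rot1_act => -[/rot1_neq].
have := @comm_rig [:: a] [:: b] [~ X, rig [:: a; b] g] [~ Y, rig [:: a; b] h] g h.
apply.
- by move=> u; rewrite (@comm_move X [:: a] [:: b]) ?rig_act.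
- move=> u; rewrite (@comm_move Y [:: a; b] [::]) //; last by rewrite take_size_cat.
  by rewrite cats0 rig_act.
- move=> w nw; have nw' : take (size [:: a; b]) w != [:: a; b].
    apply: contra nw => /eqP e; rewrite -(take_takel w (isT : 1 <= 2)%N) e //.
  rewrite commgEl conjgE !tactM -!rigV.
  by rewrite !(rig_act0 _ nw, rig_act0 _ nw').
- by move=> w e nw; rewrite (@comm_move X [:: a] [:: b]) // rig_act0.
Qed.

End Rigid.

Section Odometer.
Variable p : nat.
Hypothesis p_prime : prime p.
Local Open Scope group_scope.
Implicit Types (g h k e f s : Gamma p) (u v w z : seq 'I_p).
Local Notation i0 := (ord_zero p_prime).

Lemma sec_exp_fix g n z : tree_act g z = z -> sec (g ^+ n) z = sec g z ^+ n.
Proof.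
move=> gz; elim: n => [|n IH]; first by rewrite !expg0.
by rewrite !expgS secM gz IH.
Qed.

(* Its [p ^ n]-th power is nontrivial on level [n + 1] although the [p ^ n]-th
   power of any element is trivial on level [n]. *)
Fixpoint odom n : Gamma p :=
  if n is n'.+1 then rig [:: i0] (odom n') * @rot1 p else 1.

Lemma odom_actX n j : tree_act (odom n.+1 ^+ j) [:: i0] = [:: sgval (unlab (1%R : 'F_p) ^+ j) i0].
Proof.
elim: j => [|j IH]; first by rewrite !expg0 tact1 perm1.
rewrite !expgSr tactM IH permM [odom _]/=.
rewrite tactM (eqp_act (@eqp_rig1 p [:: i0] _ 1 isT)) // tact1.
exact: rot1_act.
Qed.

Lemma unlabX_val (j : nat) : (sgval (unlab (1%R : 'F_p) ^+ j) i0 : nat) = (j %% p)%N.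
Proof.
rewrite (Cp_val p_prime) add0n.
suff -> : lab p_prime (unlab (1%R : 'F_p) ^+ j) = (j%:R)%R by rewrite val_Fp_nat // modn_mod.
by elim: j => [|j IH]; rewrite ?expg0 ?lab1 // expgS labM IH unlabK mulrS.
Qed.

(** Along the cycle of letters starting at 0 only the first step has a nontrivial section. *)
Lemma sec_odom n j : (j < p)%N -> sec (odom n.+1 ^+ j.+1) [:: i0] = odom n.
Proof.
elim: j => [_|j IH jp].
  rewrite expg1 /= secM sec_rig -[RHS]mulg1; congr (_ * _).
rewrite expgSr secM IH ?(ltnW jp) // odom_actX -[RHS]mulg1; congr (_ * _).
rewrite /= secM; have ne : sgval (unlab (1%R : 'F_p) ^+ j.+1) i0 != i0.
  by rewrite -val_eqE /= unlabX_val modn_small.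
rewrite (_ : sec (rig _ _) _ = 1) ?mul1g //; apply/funext => u.
by rewrite /sec rig0 //= take0; apply: contra ne => /eqP[->].
Qed.

Lemma odom_exp n : ~ eqp n.+1 (odom n.+1 ^+ (p ^ n)) 1.
Proof.
elim: n => [|n IH] e.
  have /(congr1 (lab p_prime)) := e [::] isT.
  rewrite expn0 expg1 lab1 (_ : odom 1 = rig [:: i0] 1 * @rot1 p) // GammaME rig0 // mul1g.
  by rewrite /rot1 /lev /= unlabK => /eqP; rewrite oner_eq0.
apply: IH; have pp : p.-1.+1 = p by rewrite prednK // prime_gt0.
have := eqp_sec [:: i0] e; rewrite [size _]/= subSS subn0 sec1.
rewrite expnS expgM sec_exp_fix; last first.
  by rewrite odom_actX; congr [:: _]; apply: val_inj; rewrite /= unlabX_val modnn.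
suff -> : sec (odom n.+2 ^+ p) [:: i0] = odom n.+1 by [].
have := @sec_odom n.+1 p.-1; rewrite pp; exact.
Qed.
End Odometer.

(** * Branching from arbitrary pairs of sections *)

Section Branch.
Variable p : nat.
Hypothesis p_prime : prime p.
Local Open Scope group_scope.
Implicit Types (g h e f s : Gamma p) (u v z x y : seq 'I_p).
Variables (H : set (Gamma p)) (N m : nat).
Hypothesis sgH : is_subgroup H.
Hypothesis m_gt0 : (0 < m)%N.
Hypothesis mN : (2 * m + 1 <= N)%N.
Hypothesis pairs : forall x y, size x = m -> size y = m -> x <> y ->
  exists t, [/\ (t <= m)%N, take t x <> take t y &
  forall g h, exists w, [/\ H w, tree_act w (take t x) = take t x /\ tree_act w (take t y) = take t y,
     eqp (N - t) (sec w (take t x)) g & eqp (N - t) (sec w (take t y)) h]].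

Let H1 : H 1. Proof. by case: sgH. Qed.
Let HM g h : H g -> H h -> H (g * h). Proof. by case: sgH => _ + _; apply. Qed.
Let HV g : H g -> H g^-1. Proof. by case: sgH => _ _; apply. Qed.
Let HX g n : H g -> H (g ^+ n).
Proof. by move=> Hg; elim: n => [|n IH]; rewrite ?expg0 // expgS; apply: HM. Qed.
Let HJ g h : H g -> H h -> H (g ^ h).
Proof. by move=> Hg Hh; rewrite conjgE; do !apply: HM => //; apply: HV. Qed.
Let HR g h : H g -> H h -> H [~ g, h].
Proof. by move=> Hg Hh; rewrite commgEl; apply: HM; [apply: HV|apply: HJ]. Qed.

Lemma sec_fixV g z : tree_act g z = z -> sec g^-1 z = (sec g z)^-1.
Proof. by move=> gz; rewrite secV (_ : tree_act g^-1 z = z) // -{1}gz tactK. Qed.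

Lemma sec_fixR g h z : tree_act g z = z -> tree_act h z = z ->
  sec [~ g, h] z = [~ sec g z, sec h z].
Proof.
move=> gz hz; have gVz : tree_act g^-1 z = z by rewrite -{1}gz tactK.
have hVz : tree_act h^-1 z = z by rewrite -{1}hz tactK.
by rewrite !commgEl !conjgE !secM !sec_fixV // !(gz, hz, gVz, hVz).
Qed.

(** At the two prefixes one prescribes a section supported below [x] and the trivial one; then the
    full words are fixed too. *)
Lemma pair_elt x y g : size x = m -> size y = m -> x <> y ->
  exists w, [/\ H w, tree_act w x = x, tree_act w y = y,
     eqp (N - m) (sec w x) g & eqp (N - m) (sec w y) 1].
Proof.
move=> xm ym xy; have [t [tm txy ht]] := pairs xm ym xy.
have [w [Hw [wx wy] ex ey]] := ht (rig (drop t x) g) 1.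
have szx : size (take t x) = t by rewrite size_takel // xm.
have szy : size (take t y) = t by rewrite size_takel // ym.
have dx : size (drop t x) = (m - t)%N by rewrite size_drop xm.
have dy : size (drop t y) = (m - t)%N by rewrite size_drop ym.
have e1 : tree_act (rig (drop t x) g) (drop t x) = drop t x.
  by have := rig_act (drop t x) g [::]; rewrite cats0.
have sub : ((N - t) - (m - t) = N - m)%N by lia.
exists w; split=> //.
- rewrite -{1}(cat_take_drop t x) tact_cat wx (eqp_act ex) ?e1 ?cat_take_drop //.
  by rewrite dx; lia.
- rewrite -{1}(cat_take_drop t y) tact_cat wy (eqp_act ey) ?tact1 ?cat_take_drop //.
  by rewrite dy; lia.
- have := eqp_sec (drop t x) ex.
  by rewrite sec_cat cat_take_drop sec_rig dx sub.
- have := eqp_sec (drop t y) ey.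
  by rewrite sec_cat cat_take_drop sec1 dy sub.
Qed.

Definition St_elt r := H r /\ forall v, size v = m -> tree_act r v = v.

Lemma St_eltR r w : St_elt r -> H w -> St_elt [~ r, w].
Proof.
move=> [Hr fr] Hw; split=> [|v vm]; first exact: HR.
have fr' u : size u = m -> tree_act r^-1 u = u.
  by move=> um; rewrite -{1}(fr u) ?tactK.
by rewrite commgEl conjgE !tactM fr' // fr ?tactKV // size_tree_act.
Qed.

Lemma St_eltR2 r s : St_elt r -> St_elt s -> St_elt [~ r, s].
Proof. by move=> Sr [Hs _]; apply: St_eltR. Qed.

Lemma exists_other x : size x = m -> exists2 y, size y = m & x <> y.
Proof.
case: x => [/esym m0|a x xm]; first by move: m_gt0; rewrite m0.
exists (sgval (unlab (1%R : 'F_p)) a :: x) => // -[/esym]; exact: rot1_neq.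
Qed.

(** The [p ^ m]-th power of any element stabilizes level [m]. With an odometer as section at [x], it
    still moves some word [u] of length [m.+1] below [x], and conjugation takes [u] to [v]. *)
Lemma St_elt_move x v : size x = m -> size v = m.+1 ->
  exists2 r, St_elt r & tree_act (sec r x) v <> v.
Proof.
move=> xm vm; have [y ym xy] := exists_other xm.
have [w [Hw wx _ ew _]] := pair_elt (odom p_prime m.+1) xm ym xy.
have Sr : St_elt (w ^+ (p ^ m)).
  by split=> [|u um]; [exact: HX|rewrite exp_level // um].
have er : eqp (N - m) (sec (w ^+ (p ^ m)) x) (odom p_prime m.+1 ^+ (p ^ m)).
  rewrite sec_exp_fix //; elim: (p ^ m)%N => [|n IH]; rewrite ?expg0 //.
  by rewrite !expgS; apply: eqpM.
set r := w ^+ _ in Sr er; have [u um ru] : exists2 u, size u = m.+1 & tree_act (sec r x) u <> u.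
  apply: contrapT => hn; apply: (@odom_exp p p_prime m).
  apply: eqp_trans (_ : eqp m.+1 _ (sec r x)) _.
    by apply: eqp_sym; apply: eqp_le er; lia.
  apply: eqp_of_act => u um; rewrite tact1; apply: contrapT => nu; apply: hn.
  by exists u.
have [q [Hq qx _ eq_ _]] := pair_elt (mv v u) xm ym xy.
have qv : tree_act q (x ++ v) = x ++ u.
  by rewrite tact_cat qx (eqp_act eq_) ?mv_act ?vm //; lia.
exists (r ^ q^-1).
  split=> [|z zm]; first by apply: HJ; [case: Sr|apply: HV].
  rewrite conjgE invgK !tactM (proj2 Sr) ?size_tree_act // tactK //.
move=> e; have : tree_act (r ^ q^-1) (x ++ v) = x ++ v.
  rewrite tact_cat e; congr (_ ++ _); rewrite conjgE invgK !tactM (proj2 Sr) ?size_tree_act // tactK //.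
rewrite conjgE invgK !tactM qv => /(congr1 (tree_act q)); rewrite tactKV qv.
by rewrite tact_cat (proj2 Sr) // => /eqP; rewrite eqseq_cat // eqxx => /eqP.
Qed.

(* [St_elt_move] gives an element of [H] in the stabilizer of level [m]; double
   commutators isolate its section at [x]. Commutators of two such elements
   multiply the number of words at which the section is trivial by 2. *)
Lemma St_elt_comm k : forall (Z : seq (seq 'I_p)) x v g h,
  (size Z <= 2 ^ k)%N -> (forall z, z \in Z -> size z = m /\ z <> x) ->
  size x = m -> size v = (m.+1 + k.*2)%N ->
  exists r, [/\ St_elt r, eqp (N - m) (sec r x) (rig v [~ g, h]) &
    forall z, z \in Z -> eqp (N - m) (sec r z) 1].
Proof.
elim: k => [|k IH] Z x v g h sZ hZ xm vk.
  have [y [ym xy Zy]] : exists y, [/\ size y = m, x <> y & forall z, z \in Z -> z = y].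
    case: Z sZ hZ => [|y [|//]] _ hZ.
      by have [y ym xy] := exists_other xm; exists y.
    have [ym xy] := hZ y (mem_head _ _); exists y; split=> //; first by move/esym.
    by move=> z; rewrite inE => /eqP.
  have [r Sr rv] := St_elt_move xm (etrans vk (addn0 _)).
  (* [w1] and [w2] are trivial below [y], hence so are commutators with them; below [x],
     [comm_comm_rig] applies to the section of [r]. *)
  have [w1 [Hw1 w1x w1y ex1 ey1]] := pair_elt (rig v g) xm ym xy.
  have [w2 [Hw2 w2x w2y ex2 ey2]] := pair_elt (rig v h) xm ym xy.
  have Sr1 := St_eltR Sr Hw1.
  exists [~ [~ r, w1], w2]; split; first exact: St_eltR.
    rewrite sec_fixR //; last by case: Sr1 => _; apply.
    rewrite sec_fixR //; last by case: Sr => _; apply.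
    rewrite -(comm_comm_rig g h rv); apply: eqpR => //; exact: eqpR.
  move=> z /Zy ->; rewrite sec_fixR //; last by case: Sr1 => _; apply.
  rewrite sec_fixR //; last by case: Sr => _; apply.
  have e : eqp (N - m) [~ sec r y, sec w1 y] 1 by rewrite -(commg1 (sec r y)); apply: eqpR.
  by rewrite -(commg1 1); apply: eqpR.
have [v0 [a [b [ev v0k]]]] : exists v0 a b, v = v0 ++ [:: a; b] /\ size v0 = (m.+1 + k.*2)%N.
  move: vk; rewrite doubleS !addnS; case/lastP: v => [|v b] //.
  case/lastP: v => [|v a]; rewrite !size_rcons // => -[vk].
  exists v, a, b; split; last by rewrite vk.
  by rewrite -cats1 -cats1 -catA.
have [e1 [e2 [f1 [f2 ef]]]] := rig_double_comm p_prime a b g h.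
have [] := IH (take (2 ^ k)%N Z) x v0 e1 e2 _ _ xm v0k.
- by rewrite size_take; case: ifP => // /negbT; rewrite -leqNgt.
- by move=> z /mem_take; apply: hZ.
move=> r1 [Sr1 er1 hr1].
have [] := IH (drop (2 ^ k)%N Z) x v0 f1 f2 _ _ xm v0k.
- by rewrite size_drop leq_subLR addnn -mul2n -expnS.
- by move=> z /mem_drop; apply: hZ.
move=> r2 [Sr2 er2 hr2].
exists [~ r1, r2]; split; first exact: St_eltR2.
  rewrite sec_fixR; [|by case: Sr1 => _; apply..|by case: Sr2 => _; apply].
  by rewrite ev -rig_cat -ef !rigR; apply: eqpR; rewrite -rigR.
move=> z zZ; have [zm _] := hZ z zZ.
rewrite sec_fixR; [|by case: Sr1 => _; apply..|by case: Sr2 => _; apply].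
move: zZ; rewrite -{1}(cat_take_drop (2 ^ k) Z) mem_cat => /orP[/hr1 e|/hr2 e].
  by rewrite -(comm1g (sec r2 z)); apply: eqpR.
by rewrite -(commg1 (sec r1 z)); apply: eqpR.
Qed.

(** There are fewer than [2 ^ (p * m)] other words of length [m], so [p * m] doublings suffice, and
    each doubling costs two levels. *)
Lemma rig_comm_mem V g h : size V = (m + (m.+1 + (p * m).*2))%N ->
  exists2 r, H r & eqp N r (rig V [~ g, h]).
Proof.
move=> Vm; set x := take m V; set v := drop m V.
have xm : size x = m by rewrite size_takel // Vm leq_addr.
have vm : size v = (m.+1 + (p * m).*2)%N by rewrite size_drop Vm addKn.
pose Z := [seq z <- map (@tval m 'I_p) (enum {: m.-tuple 'I_p}) | z != x].
have [] := @St_elt_comm (p * m)%N Z x v g h _ _ xm vm.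
- rewrite size_filter (leq_trans (count_size _ _)) // size_map -cardE card_tuple card_ord.
  by rewrite expnM leq_exp2r // ltnW // ltn_expl.
- by move=> z; rewrite mem_filter => /andP[/eqP zx /mapP[t _ zt]]; split; rewrite ?zt ?size_tuple // -zt.
move=> r [[Hr fr] ex ez]; exists r => // u uN.
rewrite -(cat_take_drop m V) -/x -/v.
have [um|mu] := ltnP (size u) m.
  rewrite rig0; last by apply/eqP => /(congr1 size); rewrite size_take_min !size_cat xm vm => /minn_idPl; apply/negP; rewrite -ltnNge; apply: (leq_trans um); rewrite leq_addr.
  have : eqp m r 1 by apply/level_stabP.
  by apply.
have szu : size (take m u) = m by rewrite size_takel.
have szd : (size (drop m u) < N - m)%N by rewrite size_drop; lia.
have [e|ne] := eqVneq (take m u) x.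
  rewrite -(cat_take_drop m u) e -rig_cat -xm rigE xm.
  exact: ex.
rewrite rig0; last first.
  apply: contra ne => /eqP /(congr1 (take m)).
  rewrite take_takel; last by rewrite size_cat xm leq_addr.
  by rewrite -[in take m (x ++ v)]xm take_size_cat // => ->.
have := ez (take m u); rewrite mem_filter ne /= => ez'.
have : take m u \in map (@tval m 'I_p) (enum {: m.-tuple 'I_p}).
  apply/mapP; exists (tcast szu (in_tuple (take m u))); rewrite ?mem_enum //.
  by rewrite val_tcast.
move=> /ez' /(_ (drop m u) szd); by rewrite /sec cat_take_drop.
Qed.

End Branch.

(** * Counting the images of a branching subgroup *)

Section Words.
Variable p : nat.
Implicit Types (n : nat) (v : seq 'I_p).

(** A subtype of bounded sequences, so that the labels modulo level [n] are indexed by a finite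
    type. *)
Definition word n := {v : n.-bseq 'I_p | (size v < n)%N}.
Coercion word_seq n (v : word n) : seq 'I_p := val (val v).

Lemma word_size n (v : word n) : (size v < n)%N.
Proof. exact: (valP v). Qed.

Lemma word_inj n : injective (@word_seq n).
Proof. by move=> u v /val_inj /val_inj. Qed.

Definition to_word n v : option (word n) :=
  if insub v is Some w then insub w else None.

Lemma to_wordK n (v : word n) : to_word n v = Some v.
Proof. by rewrite /to_word /word_seq valK valK. Qed.

Lemma to_wordP n v : (size v < n)%N -> exists2 w : word n, to_word n v = Some w & w = v :> seq _.
Proof.
move=> vn; rewrite /to_word; case: insubP => [b _ bv|]; last by rewrite ltnW.
case: insubP => [w _ wb|]; last by rewrite /= bv vn.
by exists w => //; rewrite /word_seq wb.
Qed.

Lemma word_exists n v : (size v < n)%N -> exists w : word n, w = v :> seq _.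
Proof. by move=> /to_wordP[w _ e]; exists w. Qed.

Definition trunc n (g : Gamma p) : {ffun word n -> Cp p} := [ffun v : word n => g v].

Lemma truncP n g h : trunc n g = trunc n h <-> eqp n g h.
Proof.
split=> [e v vn|e]; last by apply/ffunP => v; rewrite !ffunE e ?word_size.
by have [w <-] := word_exists vn; have /ffunP/(_ w) := e; rewrite !ffunE.
Qed.

Definition untrunc n (t : {ffun word n -> Cp p}) : Gamma p :=
  fun v => if to_word n v is Some w then t w else 1%g.

Lemma untruncK n t : trunc n (untrunc t) = t.
Proof. by apply/ffunP => v; rewrite ffunE /untrunc to_wordK. Qed.

Definition img n (H : set (Gamma p)) : {set {ffun word n -> Cp p}} :=
  [set t | `[< exists2 h, H h & trunc n h = t >]].

Lemma imgP n (H : set (Gamma p)) t :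
  reflect (exists2 h, H h & trunc n h = t) (t \in img n H).
Proof. by rewrite finset.inE; apply: asboolP. Qed.

End Words.

(** * Automorphisms with zero level sums *)

Section Count.
Variable p : nat.
Hypothesis p_prime : prime p.
Local Open Scope group_scope.
Implicit Types (g h : Gamma p) (u v w : seq 'I_p).
Local Notation i0 := (ord_zero p_prime).
Local Notation lab := (lab p_prime).
Local Notation lsum := (lsum p_prime).

Variables (H : set (Gamma p)) (N M : nat).
Hypothesis sgH : is_subgroup H.
Hypothesis rigH : forall V g h, size V = M -> exists2 r, H r & eqp N r (rig V [~ g, h]).

Definition near_in (z : Gamma p) := exists2 h, H h & eqp N h z.

Lemma near_in1 : near_in 1.
Proof. by exists 1 => //; case: sgH. Qed.

Lemma near_inM (z z' : Gamma p) : near_in z -> near_in z' -> near_in (z * z').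
Proof.
move=> [h Hh e] [h' Hh' e']; exists (h * h'); last exact: eqpM.
by case: sgH => _ + _; apply.
Qed.

Lemma rig_dlt v u a : rig v (dlt u a) = dlt (v ++ u) a.
Proof.
apply/funext => w; rewrite dltE /rig; case: eqP => [e|ne].
  by rewrite dltE -{2}(cat_take_drop (size v) w) e eqseq_cat // eqxx.
by case: eqP => // e; case: ne; rewrite e take_size_cat.
Qed.

(** The commutator of a single label with an element moving [u] to [u'] is a difference of two
    single labels. *)
Lemma near_in_pair V u u' a : size V = M -> size u = size u' ->
  near_in (dlt (V ++ u) a^-1 * dlt (V ++ u') a).
Proof.
move=> VM uu; have [r Hr er] := rigH (dlt u a) (mv u u') VM; exists r => //.
move: er; rewrite commgEl (@dltJ _ u u') ?mv_act ?mv_sec //.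
rewrite rigM !rig_dlt; have -> : (dlt u a)^-1 = dlt u a^-1; last by rewrite rig_dlt.
apply/eqP; rewrite eq_sym -mulg_eq1 dltM mulVg; apply/eqP/funext => v.
by rewrite dltE; case: eqP.
Qed.

Definition flev j (f : seq 'I_p -> 'F_p) := lev j (fun v => unlab (f v)).

Lemma unlabD (c d : 'F_p) : unlab (c + d)%R = unlab c * unlab d.
Proof. by apply: (lab_inj (p_prime := p_prime)); rewrite labM !unlabK. Qed.

Lemma unlab0 : unlab (0%R : 'F_p) = 1.
Proof. by apply: (lab_inj (p_prime := p_prime)); rewrite unlabK lab1. Qed.

(* A function with zero sums is a sum of differences of two point masses in the
   same subtree, and these come from [near_in_pair]. *)
Lemma near_in_flev j f : (M <= j)%N -> (j < N)%N ->
  (forall V, size V = M -> \sum_(u : (j - M).-tuple 'I_p) f (V ++ u) = 0)%R ->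
  near_in (flev j f).
Proof.
move=> Mj jN f0.
pose base u := take M u ++ nseq (j - M) i0.
pose F u v : 'F_p := (f u * ((v == u)%:R - (v == base u)%:R))%R.
have szbase u : size u = j -> size (base u) = j.
  by move=> uj; rewrite size_cat size_nseq size_takel ?uj // subnKC.
have nF u : size u = j -> near_in (flev j (F u)).
  move=> uj; have := @near_in_pair (take M u) (nseq (j - M) i0) (drop M u) (unlab (f u)).
  rewrite size_takel ?uj // size_nseq size_drop uj => /(_ erefl erefl).
  rewrite cat_take_drop; have -> : dlt (take M u ++ nseq (j - M) i0) (unlab (f u))^-1 * dlt u (unlab (f u)) = flev j (F u).
    rewrite /dlt -/(base u) szbase // uj levM; apply: lev_eq => v vj.
    rewrite -[RHS]mulg1; rewrite /F; case: (v =P base u); case: (v =P u) => _ _ /=.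
    - by rewrite subrr mulr0 unlab0 mulVg mulg1.
    - rewrite sub0r mulrN1 !mulg1; apply: (lab_inj (p_prime := p_prime)).
      by rewrite labV !unlabK.
    - by rewrite subr0 mulr1 mulg1 mul1g.
    - by rewrite subrr mulr0 unlab0 !mulg1.
  by [].
have -> : flev j f = flev j (fun v => \sum_(u : j.-tuple 'I_p) F u v)%R.
  apply: lev_eq => v vj; congr unlab; rewrite /F.
  under eq_bigr do rewrite mulrBr.
  rewrite big_split /= -[LHS]addr0; congr (_ + _)%R.
    rewrite (bigD1 (tcast vj (in_tuple v))) //= val_tcast eqxx mulr1 big1 ?addr0 //.
    move=> u /eqP nu; case: (v =P u :> seq _) => [e|_]; last by rewrite mulr0.
    by case: nu; apply: val_inj; rewrite /= val_tcast e.
  rewrite sumrN; apply/esym/eqP; rewrite oppr_eq0; apply/eqP.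
  have [vb|nvb] := eqVneq (drop M v) (nseq (j - M) i0); last first.
    rewrite big1 // => u _; case: (v =P base u) => [e|_]; last by rewrite mulr0.
    by case/eqP: nvb; rewrite e /base drop_size_cat // size_takel // size_tuple.
  have VM : size (take M v) = M by rewrite size_takel // vj.
  rewrite -[RHS](f0 (take M v) VM).
  have szc (u : (j - M).-tuple 'I_p) : size (take M v ++ u) == j.
    by rewrite size_cat VM size_tuple subnKC.
  have szd (u : j.-tuple 'I_p) : size (drop M u) == (j - M)%N by rewrite size_drop size_tuple.
  rewrite (bigID (fun u : j.-tuple 'I_p => take M u == take M v)) /= addrC big1 ?add0r; last first.
    move=> u nu; case: (v =P base u) => [e|_]; last by rewrite mulr0.
    by case/eqP: nu; rewrite e take_size_cat // size_takel // size_tuple.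
  rewrite (reindex_onto (fun u : (j - M).-tuple 'I_p => Tuple (szc u))
     (fun u : j.-tuple 'I_p => Tuple (szd u))) /=; last first.
    by move=> u /eqP e; apply: val_inj; rewrite /= -e cat_take_drop.
  apply: congr_big => // u; first last.
    by move=> _; rewrite /base take_size_cat // -vb cat_take_drop eqxx mulr1.
  rewrite take_size_cat // eqxx /=; apply/eqP/val_inj => /=.
  by rewrite drop_size_cat.
have nFs (r : seq (j.-tuple 'I_p)) : near_in (flev j (fun v => \sum_(u <- r) F u v)%R).
  elim: r => [|u r IH].
    rewrite (_ : flev _ _ = 1); first exact: near_in1.
    by rewrite -(lev1 _ j); apply: lev_eq => v _; rewrite big_nil unlab0.
  rewrite (_ : flev _ _ = flev j (F u) * flev j (fun v => \sum_(u <- r) F u v)%R).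
    by apply: near_inM => //; apply: nF; rewrite size_tuple.
  by rewrite levM; apply: lev_eq => v _; rewrite big_cons unlabD.
exact: nFs.
Qed.

Definition zero_sums (z : Gamma p) := forall V q, size V = M -> (M + q < N)%N -> lsum q (sec z V) = 0%R.

(** Divide by the first nontrivial level, which [near_in_flev] provides; the quotient keeps zero
    sums because level sums are additive. *)
Lemma near_in_zero_sums (z : Gamma p) : eqp M z 1 -> zero_sums z -> near_in z.
Proof.
(* [k] bounds the number of levels still to be cleared. *)
suff P k : forall z : Gamma p, eqp (maxn M (N - k)) z 1 -> zero_sums z -> near_in z.
  move=> zM; apply: (P N); apply: eqp_le zM; lia.
elim: k => [|k IH] {}z ez zz.
  by exists 1; [case: sgH|apply: eqp_sym; apply: eqp_le ez; lia].
have [lt|ge] := ltnP M (N - k); last by apply: IH => //; apply: eqp_le ez; lia.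
pose e := (N - k.+1)%N; have eM : (M <= e)%N by rewrite /e; lia.
have kN : (k < N)%N by lia.
have eN : (e < N)%N by rewrite /e; lia.
have {}ez : eqp e z 1 by apply: eqp_le ez; rewrite /e; lia.
have lz : near_in (lev e z).
  rewrite (_ : lev e z = flev e (fun v => lab (z v))); last first.
    by apply: lev_eq => v _; rewrite labK.
  by apply: near_in_flev => // V VM; apply: (zz V (e - M)%N VM); rewrite subnKC.
have -> : z = lev e z * ((lev e z)^-1 * z) by rewrite mulKVg.
apply: near_inM => //; apply: IH.
  move=> v vn; have vj : (size v <= e)%N by move: vn; rewrite /e; lia.
  rewrite GammaME GammaVE.
  have -> : tree_act (lev e z)^-1 v = v.
    by apply: (tact_inj (g := lev e z)); rewrite tactKV lev_act.
  rewrite /lev; case: eqP => [_|/eqP vj']; first by rewrite mulVg.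
  by rewrite invg1 mul1g ez // ltn_neqAle vj'.
move=> V q VM qN; rewrite secM lsumM.
have fV : tree_act (lev e z) V = V by rewrite lev_act // VM.
have fV' : tree_act (lev e z)^-1 V = V by rewrite -{1}fV tactK.
rewrite fV' zz // addr0.
suff : (lsum q (sec (lev e z) V) = 0)%R.
  move=> l0; have := lsumM p_prime q (sec (lev e z)^-1 V) (sec (lev e z) V).
  rewrite l0 addr0 -{2}fV' -secM mulVg sec1 => <-.
  by rewrite /lsum big1 // => u _; rewrite lab1.
have [eq1|ne] := eqVneq (M + q)%N e.
  rewrite -[RHS](zz V q VM qN); apply: eq_bigr => u _; congr lab.
  by rewrite /sec /lev size_cat VM size_tuple eq1 eqxx.
by rewrite /lsum big1 // => u _; rewrite /sec /lev size_cat VM size_tuple (negbTE ne) lab1.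
Qed.

(** From level [M] on there is one base word per level below each vertex of level [M]; its label
    balances the level sum. *)
Definition is_base v := (size v < M)%N || (drop M v == nseq (size v - M) i0).

(* The labels at the other words of level at least [M] are determined by the zero
   sum condition on each level of each subtree of level [M]. *)
Definition free_word n := {v : word p n | ~~ is_base v}.

Definition fill n (t : {ffun free_word n -> Cp p}) : seq 'I_p -> 'F_p :=
  fun v => (if to_word n v is Some w then
     (if insub w is Some w' then lab (t w') else 0) else 0)%R.

Definition zport n (t : {ffun free_word n -> Cp p}) : Gamma p := fun v =>
  if (size v < M)%N then 1 else
  if drop M v == nseq (size v - M) i0 then
    unlab (- \sum_(u : (size v - M).-tuple 'I_p | u != nseq_tuple (size v - M) i0) fill t (take M v ++ u))%R
  else unlab (fill t v).

Lemma img_card_ge n : (n <= N)%N -> (p ^ #|{: free_word n}| <= #|img n H|)%N.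
Proof.
move=> nN; rewrite -{1}(card_Cp p_prime) -card_ffun.
have zz (t : {ffun free_word n -> Cp p}) : zero_sums (zport t).
  move=> V q VM _; rewrite /lsum (bigD1 (nseq_tuple q i0)) //= /sec /zport.
  have szV u : size u = q -> [/\ (size (V ++ u) < M)%N = false, take M (V ++ u) = V,
     drop M (V ++ u) = u & (size (V ++ u) - M)%N = q].
    move=> uq; rewrite size_cat VM uq addKn -VM take_size_cat // drop_size_cat //.
    by split=> //; rewrite ltnNge leq_addr.
  have [-> -> -> ->] := szV _ (size_nseq q i0).
  rewrite eqxx unlabK addrC; apply/eqP; rewrite subr_eq0; apply/eqP.
  apply: eq_bigr => u nu; have [-> _ -> ->] := szV _ (size_tuple u).
  by rewrite ifN ?unlabK.
have ei (t : {ffun free_word n -> Cp p}) : exists2 h, H h & trunc n h = trunc n (zport t).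
  have [|h Hh eh] := near_in_zero_sums _ (zz t).
    by move=> v vM; rewrite /zport vM.
  by exists h => //; apply/truncP; apply: eqp_le eh.
rewrite -(card_imset _ (f := fun t => trunc n (zport t))) /=.
  apply/subset_leq_card/fintype.subsetP => _ /imsetP[t _ ->]; apply/imgP.
  exact: ei.
move=> t t' /ffunP e; apply/ffunP => w; have := e (val w); rewrite !ffunE /zport.
have := valP w; rewrite negb_or => /andP[/negbTE -> /negbTE ->].
move=> /(can_inj (unlabK p_prime)); rewrite /fill to_wordK valK.
exact: lab_inj.
Qed.

(** A base word is recovered from its length and its first [M] letters, padded with zeros. *)
Lemma card_free_word n : (#|{: word p n}| <= #|{: free_word n}| + n * p ^ M)%N.
Proof.
have -> : #|{: free_word n}| = #|[pred v : word p n | ~~ is_base v]| by rewrite card_sig.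
rewrite -(cardC [pred v : word p n | ~~ is_base v]) leq_add2l.
pose pad (v : seq 'I_p) := take M v ++ nseq (M - size v) i0.
have szp v : size (pad v) == M by rewrite size_cat size_nseq size_take_min; apply/eqP; lia.
pose f (v : word p n) : 'I_n * M.-tuple 'I_p := (Ordinal (word_size v), Tuple (szp v)).
have -> : (n * p ^ M = #|{: 'I_n * M.-tuple 'I_p}|)%N.
  by rewrite card_prod card_ord card_tuple card_ord.
have recov v : is_base v -> v = take (size v) (pad v) ++ nseq (size v - M) i0.
  rewrite /is_base; have [vM _|Mv /= /eqP e] := ltnP (size v) M.
    rewrite /pad (@take_oversize _ M v (ltnW vM)) take_size_cat //.
    by rewrite (eqP (ltnW vM : (size v - M)%N == 0%N)) cats0.
  rewrite /pad (eqP (Mv : (M - size v)%N == 0%N)) cats0.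
  rewrite take_oversize; last by rewrite size_take_min; lia.
  by rewrite -e cat_take_drop.
rewrite -(card_in_imset (f := f)); first exact: max_card.
move=> u v; rewrite !inE !negbK => bu bv [e1 e2]; apply: word_inj.
by rewrite (recov _ bu) (recov _ bv) e1 e2.
Qed.

End Count.

(** * Walks along an orbit *)

Section Walks.
Variable p : nat.
Hypothesis p_prime : prime p.
Local Open Scope group_scope.
Variable g : 'I_3 -> Gamma p.
Implicit Types (s : seq 'I_3) (x y z : seq 'I_p).
Local Notation lab := (lab p_prime).

Fixpoint ev s : Gamma p := if s is i :: s' then g i * ev s' else 1.

Lemma ev_cat s s' : ev (s ++ s') = ev s * ev s'.
Proof. by elim: s => [|i s IH] /=; rewrite ?mul1g // IH mulgA. Qed.

Definition wpow s k := flatten (nseq k s).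

Lemma ev_pow s k : ev (wpow s k) = ev s ^+ k.
Proof. by elim: k => [|k IH]; rewrite ?expg0 // expgS -IH -ev_cat. Qed.

Fixpoint walk (F : 'I_3 -> seq 'I_p -> 'F_p) s x : 'F_p :=
  if s is i :: s' then (F i x + walk F s' (tree_act (g i) x))%R else 0%R.

Lemma walk_cat F s s' x :
  walk F (s ++ s') x = (walk F s x + walk F s' (tree_act (ev s) x))%R.
Proof.
elim: s x => [|i s IH] x /=; first by rewrite add0r tact1.
by rewrite IH tactM addrA.
Qed.

Lemma walkB F F' s x :
  walk (fun i z => F i z - F' i z)%R s x = (walk F s x - walk F' s x)%R.
Proof. by elim: s x => [|i s IH] x /=; rewrite ?subr0 // IH; ring. Qed.

Lemma walkD F F' s x :
  walk (fun i z => F i z + F' i z)%R s x = (walk F s x + walk F' s x)%R.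
Proof. by elim: s x => [|i s IH] x /=; rewrite ?addr0 // IH; ring. Qed.

Lemma walk_lform c r s x :
  lform p_prime c r (sec (ev s) x) = walk (fun i z => lform p_prime c r (sec (g i) z)) s x.
Proof.
elim: s x => [|i s IH] x /=; first by rewrite sec1 lform1.
by rewrite secM lformM IH.
Qed.

(* Positive words suffice: modulo each level, inverses are powers. *)
Lemma ev_inv n s : exists s', eqp n (ev s') (ev s)^-1.
Proof.
exists (wpow s (p ^ n).-1); rewrite ev_pow; apply: eqp_of_act => v vn.
apply: (tact_inj (g := ev s)); rewrite tactKV -tactM -expgSr prednK ?expn_gt0 ?prime_gt0 //.
by rewrite exp_level ?vn.
Qed.

Lemma ev_mem s : generated_subgroup (range g) (ev s).
Proof.
move=> G [sG rG]; case: (sG) => G1 GM _; elim: s => [|i s IH] //=.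
by apply: GM => //; apply: rG; exists i.
Qed.

Lemma generated_is_subgroup : is_subgroup (generated_subgroup (range g)).
Proof.
split=> [G [[]]//|a b ha hb G sG|a ha G sG].
  by case: (sG) => -[_ GM _] _; apply: GM; [apply: ha|apply: hb].
by case: (sG) => -[_ _ GV] _; apply: GV; apply: ha.
Qed.

Definition fixes s z := tree_act (ev s) z = z.

Lemma fixes_cat s s' z : fixes s z -> fixes s' z -> fixes (s ++ s') z.
Proof. by rewrite /fixes ev_cat tactM => -> . Qed.

Definition closed (A : seq 'I_3 -> Prop) := A [::] /\ forall s s', A s -> A s' -> A (s ++ s').

Definition additive_on (A : seq 'I_3 -> Prop) (f : seq 'I_3 -> 'F_p) :=
  forall s s', A s -> A s' -> f (s ++ s') = (f s + f s')%R.

(* On [A], a homomorphism vanishing on [A'] is determined by its values at [ms]. *)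
Definition determines (A A' : seq 'I_3 -> Prop) (ms : seq (seq 'I_3)) :=
  (forall s, s \in ms -> A s) /\
  forall f, additive_on A f -> (forall s, s \in ms -> f s = 0%R) ->
    (forall s, A' s -> f s = 0%R) -> forall s, A s -> f s = 0%R.

Lemma closed_pow A s k : closed A -> A s -> A (wpow s k).
Proof. by move=> [A0 AM] As; elim: k => //= k IH; apply: AM. Qed.

Lemma closedI A z : closed A -> closed (fun s => A s /\ fixes s z).
Proof.
move=> [A0 AM]; split; first by split=> //; rewrite /fixes /= tact1.
by move=> s s' [As fs] [As' fs']; split; [apply: AM|apply: fixes_cat].
Qed.

(** Fixing the child defines a subgroup of index 1 or [p], so a single word with nonzero label at
    [z] represents all cosets by its powers. *)
Lemma determines_step A z a : closed A -> (forall s, A s -> fixes s z) ->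
  exists m, determines A (fun s => A s /\ fixes s (rcons z a)) [:: m].
Proof.
move=> cA Az; have [A0 AM] := cA.
have fixE s : A s -> fixes s (rcons z a) <-> lab (ev s z) = 0%R.
  move=> /Az fz; rewrite /fixes tact_rcons fz; split.
    by move=> /rcons_inj[] /(Cp_fixP p_prime) ->; rewrite lab1.
  by move/eqP; rewrite lab_eq0 => /eqP->; rewrite perm1.
have [h|h] := pselect (forall s, A s -> fixes s (rcons z a)).
  exists [::]; split=> [s|f fA f0 fA' s As]; first by rewrite inE => /eqP->.
  by apply: fA'; split=> //; apply: h.
have [m [Am nm]] : exists m, A m /\ ~ fixes m (rcons z a).
  apply: contrapT => hn; apply: h => s As; apply: contrapT => ns; apply: hn.
  by exists s.
exists m; split=> [s|f fA f0 fA' s As]; first by rewrite inE => /eqP->.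
have lm : lab (ev m z) != 0%R by apply/eqP => /(fixE m Am).
(* The exponent for which [wpow m k] cancels the label of [s] at [z]. *)
pose k := (- (lab (ev s z) / lab (ev m z)))%R : 'F_p.
have labX j : lab (ev (wpow m j) z) = (j%:R * lab (ev m z))%R.
  rewrite ev_pow exp_label; last exact: Az.
  by elim: j => [|j IH]; rewrite ?expg0 ?lab1 ?mul0r // expgS labM IH mulrS; ring.
have fm : f m = 0%R by apply: f0; rewrite inE.
have f_nil : f [::] = 0%R.
  by apply/eqP; rewrite -(inj_eq (addrI (f [::]))) -fA // addr0.
have fX j : f (wpow m j) = 0%R.
  elim: j => [|j IH] //; rewrite /wpow /= fA //; first by rewrite fm add0r IH.
  exact: closed_pow.
have Ak : A (wpow m k) by apply: closed_pow.
have : f (s ++ wpow m k) = 0%R.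
  apply: fA'; split; first exact: AM.
  apply/fixE; first exact: AM.
  rewrite ev_cat GammaME (Az s As) labM labX natr_Zp /k.
  by field.
by rewrite fA // fX addr0.
Qed.

Lemma determines_trans A A' A'' ms ms' : (forall s, A' s -> A s) ->
  determines A A' ms -> determines A' A'' ms' -> determines A A'' (ms ++ ms').
Proof.
move=> AA [h1 h2] [h1' h2']; split=> [s|f fA f0 fA'' s As].
  by rewrite mem_cat => /orP[/h1|/h1' /AA].
apply: h2 => // {s As} s; first by move=> ms_s; apply: f0; rewrite mem_cat ms_s.
apply: h2' => // {s}; first by move=> s s' As As'; apply: fA; apply: AA.
by move=> s ms_s; apply: f0; rewrite mem_cat ms_s orbT.
Qed.

Lemma determines_vertex A z : closed A -> exists2 ms,
  size ms = size z & determines A (fun s => A s /\ fixes s z) ms.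
Proof.
move=> cA; elim/last_ind: z => [|z a [ms sms dms]].
  by exists [::] => //; split=> // f _ _ h s As; apply: h.
have [|m dm] := @determines_step (fun s => A s /\ fixes s z) z a (closedI z cA).
  by move=> s [].
exists (ms ++ [:: m]); first by rewrite size_cat size_rcons addn1 sms.
apply: (determines_trans (A' := fun s => A s /\ fixes s z)) => //; first by move=> s [].
case: dm => h1 h2; split=> // f fA f0 fA'; apply: h2 => // s [[As fs] fs'].
exact: fA'.
Qed.

Definition weight (Z : seq (seq 'I_p)) := (\sum_(z <- Z) size z)%N.

Lemma determines_list A Z : closed A -> exists2 ms,
  size ms = weight Z & determines A (fun s => A s /\ forall z, z \in Z -> fixes s z) ms.
Proof.
elim: Z A => [|z Z IH] A cA.
  exists [::]; first by rewrite /weight big_nil.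
  by split=> // f _ _ h s As; apply: h.
have [ms sms dms] := determines_vertex z cA.
have [ms' sms' dms'] := IH _ (closedI z cA).
exists (ms ++ ms'); first by rewrite size_cat sms sms' /weight big_cons.
have := determines_trans _ dms dms'; move=> /(_ (fun s => @proj1 _ _)) [h1 h2].
split=> // f fA f0 fA'; apply: h2 => // s [[As fz] fZ]; apply: fA'; split=> // y.
by rewrite inE => /orP[/eqP->|/fZ].
Qed.

Definition orb t (x : t.-tuple 'I_p) : {set t.-tuple 'I_p} :=
  [set z : t.-tuple 'I_p | `[< exists s, tree_act (ev s) x = z :> seq _ >]].

Lemma orbP t (x z : t.-tuple 'I_p) :
  reflect (exists s, tree_act (ev s) x = z :> seq _) (z \in orb x).
Proof. by rewrite finset.inE; apply: asboolP. Qed.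

Lemma orb_refl t (x : t.-tuple 'I_p) : x \in orb x.
Proof. by apply/orbP; exists [::]; rewrite tact1. Qed.

(* Differences of elements of [B] are cocycles on the orbit of [x] that vanish on
   the stabilizer of [x] and of [Z]; such a cocycle is determined by its values
   along one word for each point of the orbit and along [weight Z] more words. *)
Lemma cell_count (Om : finType) (B : {set Om}) t (x : t.-tuple 'I_p)
    (Z : seq (seq 'I_p)) (F : Om -> 'I_3 -> seq 'I_p -> 'F_p) :
  (forall o o' s, o \in B -> o' \in B -> fixes s x -> (forall z, z \in Z -> fixes s z) ->
     walk (F o) s x = walk (F o') s x) ->
  (forall o o', o \in B -> o' \in B ->
     (forall i (z : t.-tuple 'I_p), z \in orb x -> F o i z = F o' i z) -> o = o') ->
  (#|B| <= p ^ (weight Z + #|orb x|))%N.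
Proof.
move=> hwalk hinj.
have [|ms sms [dms1 dms2]] := @determines_list (fun s => fixes s x) Z.
  split; first by rewrite /fixes tact1.
  by move=> s s'; apply: fixes_cat.
have ex (z : t.-tuple 'I_p) : exists s, z \in orb x -> tree_act (ev s) x = z.
  by case: (orbP x z) => [[s e]|_]; [exists s|exists [::]].
pose vz (z : t.-tuple 'I_p) := sval (cid (ex z)).
have vzP (z : t.-tuple 'I_p) : z \in orb x -> tree_act (ev (vz z)) x = z := svalP (cid (ex z)).
pose f o := ([ffun e : 'I_(weight Z) => walk (F o) (nth [::] ms e) x],
  [ffun z : {z : t.-tuple 'I_p | z \in orb x} => walk (F o) (vz (val z)) x]).
have <- : #|{: {ffun 'I_(weight Z) -> 'F_p} * {ffun {z : t.-tuple 'I_p | z \in orb x} -> 'F_p}}| =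
  (p ^ (weight Z + #|orb x|))%N.
  by rewrite card_prod !card_ffun card_Fp // card_ord card_sig expnD.
rewrite -(card_in_imset (f := f)); first exact: max_card.
move=> o o' oB o'B [/ffunP e1 /ffunP e2]; apply: hinj => // i z zO.
pose D i z := (F o i z - F o' i z)%R.
have D0 s : fixes s x -> walk D s x = 0%R.
  apply: (dms2 (fun s => walk D s x)) => {s} [s s' fs fs'|s ms_s|s [fs fZ]].
  - by rewrite walk_cat fs.
  - rewrite walkB; apply/eqP; rewrite subr_eq0.
    have sl : (index s ms < weight Z)%N by rewrite -sms index_mem.
    by have := e1 (Ordinal sl); rewrite !ffunE nth_index // => ->.
  - by rewrite walkB (hwalk o o') // subrr.
have Dv (y : t.-tuple 'I_p) : y \in orb x -> walk D (vz y) x = 0%R.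
  move=> yO; rewrite walkB; apply/eqP; rewrite subr_eq0; apply/eqP.
  by have := e2 (exist _ y yO); rewrite !ffunE.
have [s es] := orbP _ _ zO; apply/eqP; rewrite -subr_eq0 -/(D i z); apply/eqP.
pose y := act_tuple (g i) z.
have yO : y \in orb x.
  by apply/orbP; exists (s ++ [:: i]); rewrite ev_cat tactM es /= mulg1.
have [r er] := ev_inv t (vz y).
have rback : tree_act (ev r) y = x.
  by rewrite (eqp_act er) ?size_tuple // -{1}(vzP _ yO) tactK.
(* Two loops at [x] return from [y] by the same word [r]; one reaches [y] through [z] and the step
   [i], the other by the chosen word. Comparing them isolates [D i z]. *)
have := D0 (vz z ++ i :: r); rewrite /fixes ev_cat tactM vzP //= tactM rback => /(_ erefl).
rewrite walk_cat Dv // add0r vzP //= => H1.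
have := D0 (vz y ++ r); rewrite /fixes ev_cat tactM vzP // rback => /(_ erefl).
by rewrite walk_cat Dv // add0r vzP //= => H2; move: H1; rewrite H2 addr0.
Qed.

End Walks.

(** * Probability of relations on stabilizers *)

(* [R] meets every cycle of [phi]. *)
Lemma half_transversal (T : finType) (O : {set T}) (phi : T -> T) :
  (forall z, z \in O -> phi z \in O) -> {in O &, injective phi} ->
  (forall z, z \in O -> phi z != z) ->
  exists R : {set T}, [/\ R \subset O, (#|R|.*2 <= #|O|)%N &
    forall P : T -> Prop, (forall z, z \in R -> P z) ->
      (forall z, z \in O -> P z -> P (phi z)) -> forall z, z \in O -> P z].
Proof.
move=> phiO phi_inj phi_fix.
pose sg z := if z \in O then phi z else z.
have sgO z : (sg z \in O) = (z \in O) by rewrite /sg; case: ifP => // zO; rewrite phiO.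
have sg_inj : injective sg.
  move=> u v uv; have uvO : (u \in O) = (v \in O) by rewrite -sgO uv sgO.
  by move: uv; rewrite /sg -uvO; case: ifP => // uO; apply: phi_inj; rewrite // -uvO.
have sgsym := fconnect_sym sg_inj.
(* One root per cycle. As no point is fixed, the images of the roots are not roots, which gives the
   bound by half. *)
exists [set z in O | froot sg z == z]; split.
- by apply/fintype.subsetP => z; rewrite finset.inE => /andP[].
- rewrite -addnn -[X in (_ <= X)%N](cardsID [set z in O | froot sg z == z]).
  have -> : O :&: [set z in O | froot sg z == z] = [set z in O | froot sg z == z].
    by apply/setP => z; rewrite !finset.inE; case: (z \in O).
  rewrite leq_add2l -(card_imset _ sg_inj); apply/subset_leq_card/fintype.subsetP.
  move=> _ /imsetP[z zR ->]; move: zR; rewrite !finset.inE => /andP[zO /eqP rz].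
  rewrite sgO zO /= andbT.
  have -> : froot sg (sg z) = froot sg z.
    by apply/eqP; rewrite (root_connect sgsym) sgsym fconnect1.
  by rewrite rz /sg zO eq_sym phi_fix.
- move=> P PR Pphi z zO.
  have cz : fconnect sg (froot sg z) z by rewrite sgsym connect_root.
  have iterO n u : u \in O -> iter n sg u \in O by elim: n => //= n IH uO; rewrite sgO IH.
  have rO : froot sg z \in O.
    by have := iterO (findex sg z (froot sg z)) z zO; rewrite iter_findex ?connect_root.
  rewrite -(iter_findex cz); elim: (findex _ _ _) => [|n IH] /=.
    by apply: PR; rewrite finset.inE rO (root_root sgsym) eqxx.
  have sgE u : u \in O -> sg u = phi u by rewrite /sg => ->.
  by rewrite sgE ?iterO //; apply: Pphi; rewrite ?iterO.
Qed.

Lemma card_cell (I C : finType) (J : {set I}) (o : {ffun I -> C}) :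
  #|[set o' : {ffun I -> C} | [forall i, (i \notin J) ==> (o' i == o i)]]| = (#|C| ^ #|J|)%N.
Proof.
have -> : #|[set o' : {ffun I -> C} | [forall i, (i \notin J) ==> (o' i == o i)]]| =
   #|family (fun i => if i \in J then predT else pred1 (o i))|.
  apply: eq_card => o'; rewrite finset.inE; apply/forallP/familyP => h i.
    by have := h i; case: ifP => // _ /eqP ->; rewrite !inE.
  by apply/implyP => iJ; have := h i; rewrite (negbTE iJ).
rewrite card_family; have -> : forall s : seq nat, foldr muln 1%N s = (\prod_(x <- s) x)%N.
  by elim=> [|x s IH]; rewrite ?big_nil // big_cons -IH.
rewrite big_map big_enum /= (bigID (mem J)) /= [X in (_ * X)%N]big1 ?muln1.
  rewrite (eq_bigr (fun=> #|C|)); last by move=> i ->.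
  by rewrite prod_nat_const.
by move=> i /negbTE ->; rewrite card1.
Qed.

(** * Finite samples of the generators *)

Section Sample.
Variable p : nat.
Hypothesis p_prime : prime p.
Variables (N t : nat).
Local Notation coord := ('I_3 * word p N)%type.
Definition sample := {ffun 'I_3 * word p N -> Cp p}.

Definition bar (o : sample) : sample :=
  [ffun iw : coord => if (size iw.2 < t)%N then o iw else 1%g].

(* The samples that differ from [o] only on [J]. As [J] lies in levels at least [t]
   but depends only on the labels of lower levels, cells form a partition. *)
Definition cell (J : sample -> {set coord}) (o : sample) :=
  [set o' : sample | [forall iw : coord, (iw \notin J (bar o)) ==> (o' iw == o iw)]].

Lemma mem_cell (J : sample -> {set coord}) o o' :
  (o' \in cell J o) = [forall iw : coord, (iw \notin J (bar o)) ==> (o' iw == o iw)].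
Proof. by rewrite finset.inE. Qed.

Lemma cellP (J : sample -> {set coord}) o o' :
  o' \in cell J o <-> forall iw, iw \notin J (bar o) -> o' iw = o iw.
Proof.
rewrite mem_cell; split=> [/forallP h iw iwJ|h].
  by have /implyP/(_ iwJ)/eqP := h iw.
by apply/forallP => iw; apply/implyP => /h ->.
Qed.

Lemma cell_bar (J : sample -> {set coord}) o o' :
  (forall o (iw : coord), iw \in J o -> (t <= size iw.2)%N) -> o' \in cell J o -> bar o' = bar o.
Proof.
move=> hJ /cellP h; apply/ffunP => iw; rewrite !ffunE.
case: ifP => // iwt; apply: h.
by apply/negP => /hJ; rewrite leqNgt iwt.
Qed.

Lemma cell_sym (J : sample -> {set coord}) o o' :
  (forall o (iw : coord), iw \in J o -> (t <= size iw.2)%N) ->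
  (o' \in cell J o) = (o \in cell J o').
Proof.
move=> hJ; apply/idP/idP => h; have e := cell_bar hJ h; apply/cellP => iw iwJ;
  by apply/esym; apply: (cellP J _ _).1 h _ _; rewrite ?e // -e.
Qed.

(** The weight is constant on each cell and [B] has proportion at most [eps] there. The weighted
    form is what the expectation of orbit weights requires. *)
Lemma cell_sum (J : sample -> {set coord}) (B : {set sample})
   (f : sample -> rat) (eps : rat) :
  (forall o (iw : coord), iw \in J o -> (t <= size iw.2)%N) -> (forall o, 0 <= f o)%R -> (0 <= eps)%R ->
  (forall o, o \in B -> #|B :&: cell J o|%:R <= eps * (p ^ #|J (bar o)|)%:R)%R ->
  (\sum_(o in B) f (bar o) <= eps * \sum_o f (bar o))%R.
Proof.
move=> hJ f0 eps0 hB.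
have cc o : #|cell J o| = (p ^ #|J (bar o)|)%N by rewrite card_cell card_Cp.
have c0 o : ((p ^ #|J (bar o)|)%:R != 0 :> rat)%R.
  by rewrite pnatr_eq0 -lt0n expn_gt0 prime_gt0.
have e1 o : f (bar o) = (\sum_(o' in cell J o) f (bar o) / (p ^ #|J (bar o)|)%:R)%R.
  by rewrite sumr_const cc -[RHS]mulr_natr mulfVK.
rewrite (eq_bigr _ (fun o _ => e1 o)) (exchange_big_dep predT) //= mulr_sumr.
apply: ler_sum => o' _.
have e2 o : (o \in B) && (o' \in cell J o) = (o \in B :&: cell J o').
  by rewrite finset.in_setI cell_sym.
rewrite (eq_bigl _ _ e2) (eq_bigr (fun=> f (bar o') / (p ^ #|J (bar o')|)%:R))%R; last first.
  by move=> o; rewrite finset.in_setI => /andP[_ /(cell_bar hJ) ->].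
rewrite sumr_const -[X in (X <= _)%R]mulr_natr mulrAC -[X in (_ <= X)%R]mulrC -mulrA.
apply: ler_wpM2l => //.
have [->|[q qBc]] := finset.set_0Vmem (B :&: cell J o'); first by rewrite cards0 mul0r.
move: qBc; rewrite finset.in_setI => /andP[qB qc]; have eb := cell_bar hJ qc.
rewrite ler_pdivrMr ?ltr0n ?expn_gt0 ?prime_gt0 //.
have <- : cell J q = cell J o'; last by rewrite -eb; apply: hB.
apply/setP => o''.
rewrite [LHS]mem_cell [RHS]mem_cell.
rewrite eb.
apply: eq_forallb => iw.
have [iwJ|iwJ] := boolP (iw \in J (bar o')); first by [].
by move: qc; rewrite mem_cell => /forallP/(_ iw)/implyP/(_ iwJ)/eqP ->.
Qed.

Definition gen (o : sample) (i : 'I_3) : Gamma p :=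
  fun v => if to_word N v is Some w then o (i, w) else 1%g.

Lemma genE o i (w : word p N) : gen o i w = o (i, w).
Proof. by rewrite /gen to_wordK. Qed.

Lemma gen_bar o i : (t <= N)%N -> eqp t (gen (bar o) i) (gen o i).
Proof.
move=> tN v vt; have [w e] := @word_exists p N v (leq_trans vt tN).
by rewrite -e in vt *; rewrite !genE ffunE /= vt.
Qed.

End Sample.

Section Transport.
Variable p : nat.
Hypothesis p_prime : prime p.
Local Open Scope group_scope.
Variables (n : nat) (g g' : 'I_3 -> Gamma p).
Hypothesis gg' : forall i, eqp n (g i) (g' i).

Lemma ev_eqp s : eqp n (ev g s) (ev g' s).
Proof. by elim: s => //= i s IH; apply: eqpM. Qed.

Lemma fixes_eqp s (z : seq 'I_p) : (size z <= n)%N -> fixes g s z <-> fixes g' s z.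
Proof. by move=> zn; rewrite /fixes (eqp_act (ev_eqp s)). Qed.

Lemma walk_eqp F s (x : seq 'I_p) : (size x <= n)%N -> walk g F s x = walk g' F s x.
Proof.
elim: s x => //= i s IH x xn; rewrite IH ?size_tree_act //.
by rewrite (eqp_act (gg' i)).
Qed.

Lemma orb_eqp t (x : t.-tuple 'I_p) : (t <= n)%N -> orb g x = orb g' x.
Proof.
move=> tn; apply/setP => z; apply/orbP/orbP => -[s e]; exists s;
  by rewrite -e (eqp_act (ev_eqp s)) // size_tuple.
Qed.

End Transport.

(** * Relations between words of different orbits *)

Section Bad.
Variable p : nat.
Hypothesis p_prime : prime p.
Variables (N t : nat).
Hypothesis tN : (t <= N)%N.
Local Notation coord := ('I_3 * word p N)%type.
Local Notation sample := (sample p N).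
Local Notation lab := (lab p_prime).
Local Notation lform := (lform p_prime).
Local Notation i0 := (ord_zero p_prime).
Implicit Types (o : sample) (x y z : t.-tuple 'I_p).

Lemma bar_gen o o' : bar t o' = bar t o -> forall i, eqp t (gen o' i) (gen o i).
Proof.
move=> e i; apply: eqp_trans (_ : eqp t _ (gen (bar t o) i)) _; last exact: gen_bar.
by rewrite -e; apply/eqp_sym/gen_bar.
Qed.

(** This is [cell_count] inside each cell: its samples act alike on levels up to [t], so orbits and
    stabilizers are fixed while deeper labels vary. *)
Lemma bad_sum x (Z : seq (seq 'I_p)) (F : sample -> 'I_3 -> seq 'I_p -> 'F_p)
    (J : sample -> {set coord}) (B : {set sample}) (f : sample -> rat) (eps : rat) :
  (forall o (iw : coord), iw \in J o -> (t <= size iw.2)%N) ->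
  (forall o, 0 <= f o)%R -> (0 <= eps)%R ->
  (forall o o', o \in B -> o' \in B -> bar t o' = bar t o -> o' \in cell t J o ->
    forall s, fixes (gen o) s x -> (forall z : seq 'I_p, z \in Z -> fixes (gen o) s z) ->
     walk (gen o) (F o) s x = walk (gen o) (F o') s x) ->
  (forall o o', o \in B -> o' \in B -> bar t o' = bar t o -> o' \in cell t J o ->
     (forall i z, z \in orb (gen o) x -> F o i z = F o' i z) -> o = o') ->
  (forall z : seq 'I_p, z \in Z -> size z <= t)%N ->
  (forall o, o \in B -> (p ^ (weight Z + #|orb (gen o) x|))%:R <= eps * (p ^ #|J (bar t o)|)%:R)%R ->
  (\sum_(o in B) f (bar t o) <= eps * \sum_o f (bar t o))%R.
Proof.
move=> hJ f0 eps0 hw hinj hZ hB; apply: (cell_sum p_prime hJ) => // o oB.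
apply: le_trans (hB o oB); rewrite ler_nat.
have cellT o1 o2 : o1 \in cell t J o -> o2 \in cell t J o -> bar t o2 = bar t o1 /\ o2 \in cell t J o1.
  move=> c1 c2; have e1 := cell_bar hJ c1; have e2 := cell_bar hJ c2.
  split; first by rewrite e1 e2.
  apply/cellP => iw; rewrite e1 => iwJ.
  by rewrite (proj1 (cellP t J o o1) c1 iw iwJ) (proj1 (cellP t J o o2) c2 iw iwJ).
have oo : forall o1, o1 \in cell t J o -> forall i, eqp t (gen o i) (gen o1 i).
  by move=> o1 /(cell_bar hJ) e; apply: bar_gen.
apply: (cell_count p_prime (g := gen o) (F := F)) => [q1 q2 s|q1 q2].
  rewrite !finset.in_setI => /andP[B1 c1] /andP[B2 c2] fx fZ.
  have [e12 c12] := cellT _ _ c1 c2.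
  have sx : (size x <= t)%N by rewrite size_tuple.
  rewrite (walk_eqp (oo _ c1) (F q1) s sx) (walk_eqp (oo _ c1) (F q2) s sx); apply: hw => //.
    by apply/(fixes_eqp (oo _ c1)); rewrite ?size_tuple.
  by move=> z zZ; apply/(fixes_eqp (oo _ c1)); [apply: hZ|apply: fZ].
rewrite !finset.in_setI => /andP[B1 c1] /andP[B2 c2] h.
have [e12 c12] := cellT _ _ c1 c2; apply: hinj => // i z zO; apply: h.
by rewrite (orb_eqp (oo _ c1) x (leqnn t)).
Qed.

Lemma lform_diff c r (g g' : Gamma p) (u : seq 'I_p) : (size u < r)%N ->
  (forall v, (size v < r)%N -> v <> u -> g v = g' v) ->
  (lform c r g - lform c r g' = c (size u) * (lab (g u) - lab (g' u)))%R.
Proof.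
move=> ur gg; rewrite /lform -sumrB (bigD1 (Ordinal ur)) //= -mulrBr.
rewrite [X in (_ + X)%R]big1 ?addr0 => [|j ju].
  congr (_ * _)%R; rewrite /lsum -sumrB (bigD1 (in_tuple u)) //= big1 ?addr0 //.
  move=> v /eqP vu; rewrite gg ?subrr ?size_tuple // => e; apply: vu.
  exact: val_inj.
rewrite -mulrBr /lsum -sumrB big1 ?mulr0 // => v _.
rewrite gg ?subrr ?size_tuple // => e; case/eqP: ju; apply: val_inj.
by rewrite /= -e size_tuple.
Qed.

(* The coordinates below [A] at which the labels of a sample will be varied: one
   word of relative depth [j] below each vertex of [A]. *)
Definition piv (j : nat) (A : {set t.-tuple 'I_p}) : {set coord} :=
  [set iw : coord | [exists z : t.-tuple 'I_p, (z \in A) && (iw.2 == z ++ nseq j i0 :> seq _)]].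

Lemma piv_size j A (iw : coord) : iw \in piv j A -> (t <= size iw.2)%N.
Proof.
rewrite finset.inE => /existsP[z /andP[_ /eqP ->]].
by rewrite size_cat size_tuple leq_addr.
Qed.

Lemma card_piv j A : (t + j < N)%N -> #|piv j A| = (3 * #|A|)%N.
Proof.
move=> tjN; have ex z : exists w : word p N, w = z ++ nseq j i0 :> seq _.
  by apply: word_exists; rewrite size_cat size_tuple size_nseq.
pose w z := sval (cid (ex z)); have wE z : w z = z ++ nseq j i0 :> seq _ := svalP (cid (ex z)).
have -> : piv j A = [set (iz.1, w iz.2) | iz in finset.setX [set: 'I_3] A].
  apply/setP => -[i v]; rewrite finset.inE /=; apply/existsP/imsetP => [[z /andP[zA /eqP e]]|[[i' z]]].
    exists (i, z); first by rewrite finset.in_setX finset.in_setT.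
    by congr (_, _); apply: word_inj; rewrite wE.
  by rewrite finset.in_setX /= => /andP[_ zA] [_ ->]; exists z; rewrite zA wE eqxx.
rewrite card_in_imset ?cardsX ?cardsT ?card_ord // => -[i z] [i' z'] _ _ [-> e].
congr (_, _); apply: val_inj; have := congr1 (@word_seq p N) e; rewrite !wE.
by move/eqP; rewrite eqseq_cat ?size_tuple // => /andP[/eqP].
Qed.

Lemma cell_piv j (A : sample -> {set t.-tuple 'I_p}) o o' i z v :
  o' \in cell t (fun o => piv j (A o)) o ->
  (z ++ v) <> z ++ nseq j i0 \/ z \notin A (bar t o) ->
  gen o' i (z ++ v) = gen o i (z ++ v).
Proof.
move=> /cellP h hz; rewrite /gen.
have [vN|Nv] := ltnP (size (z ++ v)) N.
  have [w -> wv] := to_wordP vN; apply: h.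
  apply/negP; rewrite finset.inE => /existsP[y /andP[yA /=]]; rewrite wv.
  move=> /eqP e; have yz : y = z.
    have := congr1 (take t) e; rewrite !take_size_cat ?size_tuple // => yz.
    exact/esym/val_inj.
  by case: hz => [|/negP]; [rewrite -{2}yz|rewrite -yz].
rewrite (_ : to_word N _ = None) // /to_word; case: insubP => // b _ bv.
by case: insubP => // w; rewrite bv ltnNge Nv.
Qed.

Definition Lf c o i (z : seq 'I_p) := lform c (N - t) (sec (gen o i) z).

Lemma Lf_diff c j (A : sample -> {set t.-tuple 'I_p}) o o' i z : (t + j < N)%N ->
  o' \in cell t (fun o => piv j (A o)) o ->
  (Lf c o i z - Lf c o' i z = c j * (lab (gen o i (z ++ nseq j i0)) - lab (gen o' i (z ++ nseq j i0))))%R.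
Proof.
move=> tjN oo; rewrite /Lf.
have -> : c j = c (size (nseq j i0)) by rewrite size_nseq.
apply: lform_diff; first by rewrite size_nseq; lia.
move=> v vr ne; apply/esym; apply: (cell_piv _ oo).
by left => /eqP; rewrite eqseq_cat // eqxx => /eqP.
Qed.

Lemma Lf_out c j (A : sample -> {set t.-tuple 'I_p}) o o' i z :
  o' \in cell t (fun o => piv j (A o)) o -> z \notin A (bar t o) ->
  Lf c o i z = Lf c o' i z.
Proof.
move=> oo zA; apply: lform_eqp => v _; by apply/esym; apply: (cell_piv _ oo); right.
Qed.

Lemma cell_eq j (A : sample -> {set t.-tuple 'I_p}) o o' :
  o' \in cell t (fun o => piv j (A o)) o ->
  (forall i z, z \in A (bar t o) ->
     gen o i (z ++ nseq j i0) = gen o' i (z ++ nseq j i0)) -> o = o'.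
Proof.
move=> oo h; apply/ffunP => -[i w].
have [|] := boolP ((i, w) \in piv j (A (bar t o))); last first.
  by move=> iwJ; apply/esym; apply: (proj1 (cellP _ _ o o') oo).
rewrite finset.inE => /existsP[z /andP[zA /= /eqP e]].
by have := h i z zA; rewrite -e !genE.
Qed.

(* The walk of the form [c] along the orbit of [x] is prescribed, whereas the
   labels of [3 * #|orb x|] coordinates enter it freely. *)
Lemma badC_sum x y (Z : seq (seq 'I_p)) (c c' : nat -> 'F_p) (b : nat) (B : {set sample})
    (f : sample -> rat) :
  (exists2 j, (t + j < N)%N & c j != 0)%R -> (forall z : seq 'I_p, z \in Z -> size z <= t)%N ->
  (forall o, 0 <= f o)%R ->
  (forall o, o \in B -> [/\ (b <= #|orb (gen o) x|)%N,
     y \notin orb (gen o) x \/ (forall j, c' j = 0%R) &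
     forall s, fixes (gen o) s x -> (forall z : seq 'I_p, z \in Z -> fixes (gen o) s z) ->
       (lform c (N - t) (sec (ev (gen o) s) x) + lform c' (N - t) (sec (ev (gen o) s) y) = 0)%R]) ->
  (\sum_(o in B) f (bar t o) <= (p ^ weight Z)%:R / (p ^ (2 * b))%:R * \sum_o f (bar t o))%R.
Proof.
move=> [j tjN cj] hZ f0 hB.
pose A o := orb (gen o) x.
have AE o : A (bar t o) = orb (gen o) x.
  by apply: orb_eqp (leqnn t) => i; apply: gen_bar.
apply: (@bad_sum x Z (Lf c) (fun o => piv j (A o))) => //.
- by move=> o iw; apply: piv_size.
- move=> o o' oB o'B e oo s fx fZ; have [_ hy rel] := hB o oB; have [_ _ rel'] := hB o' o'B.
  have gg := bar_gen e.
  have := rel s fx fZ; rewrite !walk_lform -/(Lf c o) -/(Lf c' o).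
  have := rel' s; rewrite !walk_lform => rel''.
  have {rel''} := rel'' _ _; rewrite !(walk_eqp gg) ?size_tuple // => rel''.
  have {}rel'' : (walk (gen o) (Lf c o') s x + walk (gen o) (Lf c' o') s y = 0)%R.
    apply: rel''; first by apply/(fixes_eqp gg); rewrite ?size_tuple.
    by move=> z zZ; apply/(fixes_eqp gg); [apply: hZ|apply: fZ].
  (* The walk from [y] sees no varied label: either it avoids the orbit of [x], or [c'] vanishes. *)
  move=> rel0; suff ey : walk (gen o) (Lf c' o) s y = walk (gen o) (Lf c' o') s y.
    by apply/(addIr (walk (gen o) (Lf c' o) s y)); rewrite [RHS](_ : _ = 0%R) // ey.
  case: hy => [yO|c0].
    have : forall z, z \notin orb (gen o) x -> walk (gen o) (Lf c' o) s z = walk (gen o) (Lf c' o') s z.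
      elim: s {fx fZ rel'' rel0} => //= i s IH z zO; congr (_ + _)%R.
        by apply: (Lf_out _ _ oo); rewrite AE.
      have := IH (act_tuple (gen o i) z); apply.
      apply: contra zO => /orbP[s' e']; have [r er] := ev_inv p_prime (gen o) t [:: i].
      apply/orbP; exists (s' ++ r); rewrite ev_cat tactM e' (eqp_act er) /= ?size_tree_act ?size_tuple //.
      by rewrite mulg1 tactK.
    by apply.
  have L0 o1 i (z : seq 'I_p) : Lf c' o1 i z = 0%R by rewrite /Lf /lform big1 // => k _; rewrite c0 mul0r.
  have w0 o1 : forall z : seq 'I_p, walk (gen o) (Lf c' o1) s z = 0%R.
    by elim: s {fx fZ rel'' rel0} => //= i s IH z; rewrite IH L0 addr0.
  by rewrite !w0.
- move=> o o' oB o'B e oo h; apply: (cell_eq oo) => i z; rewrite AE => zO.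
  have := Lf_diff c i z tjN oo; rewrite h // subrr => /esym/eqP.
  by rewrite mulf_eq0 (negbTE cj) subr_eq0 /= => /eqP /lab_inj.
- move=> o oB; have [bo _ _] := hB o oB; rewrite card_piv // AE.
  rewrite mulrAC ler_pdivlMr ?ltr0n ?expn_gt0 ?prime_gt0 // -!natrM ler_nat -!expnD.
  by rewrite leq_exp2l ?prime_gt1 //; lia.
Qed.

End Bad.

(** * Relations within one orbit *)

Section Phi.
Variable p : nat.
Hypothesis p_prime : prime p.
Local Open Scope group_scope.
Variables (g : 'I_3 -> Gamma p) (t : nat) (x y : t.-tuple 'I_p).

Lemma phi_ex (z : seq 'I_p) : exists s, (exists s', tree_act (ev g s') x = z) -> tree_act (ev g s) x = z.
Proof.
have [[s e]|h] := pselect (exists s', tree_act (ev g s') x = z); first by exists s.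
by exists [::].
Qed.

(* The equivariant map [orb g x -> orb g y] sending [x] to [y]; it is well
   defined when [x] and [y] have the same stabilizer. *)
Definition phi (z : seq 'I_p) : seq 'I_p := tree_act (ev g (sval (cid (phi_ex z)))) y.

Lemma size_phi z : size (phi z) = t.
Proof. by rewrite size_tree_act size_tuple. Qed.

Definition phi_tuple (z : t.-tuple 'I_p) : t.-tuple 'I_p :=
  act_tuple (ev g (sval (cid (phi_ex z)))) y.

Hypothesis xy_fix : forall s, fixes g s x <-> fixes g s y.

(** Either equality says that [s] followed by an inverse of [s'] stabilizes the point. *)
Lemma transfer s s' : (tree_act (ev g s) x = tree_act (ev g s') x) <->
  (tree_act (ev g s) y = tree_act (ev g s') y).
Proof.
have [r er] := ev_inv p_prime g t s'.
have hr (z z' : t.-tuple 'I_p) : (tree_act (ev g s) z = tree_act (ev g s') z') <-> tree_act (ev g (s ++ r)) z = z'.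
  rewrite ev_cat tactM (eqp_act er) ?size_tree_act ?size_tuple //; split=> [->|<-].
    by rewrite tactK.
  by rewrite tactKV.
split=> /hr h; apply/hr; exact/xy_fix.
Qed.

Lemma phiE s : phi (tree_act (ev g s) x) = tree_act (ev g s) y.
Proof. by rewrite /phi; case: cid => s' /= h; apply/transfer; apply: h; exists s. Qed.

Lemma phi_act i z : z \in orb g x -> phi (tree_act (g i) z) = tree_act (g i) (phi z).
Proof.
move=> /orbP[s <-]; rewrite phiE.
by have := phiE (s ++ [:: i]); rewrite ev_cat /= mulg1 !tactM.
Qed.

Lemma walk_phi F s (z : t.-tuple 'I_p) : z \in orb g x ->
  walk g (fun i u => F i (phi u)) s z = walk g F s (phi z).
Proof.
elim: s z => //= i s IH z zO; rewrite -phi_act // -[tree_act _ z]/(val (act_tuple (g i) z)) IH //.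
by case/orbP: zO => s' e; apply/orbP; exists (s' ++ [:: i]); rewrite ev_cat tactM e /= mulg1.
Qed.

Definition is_half (R : {set t.-tuple 'I_p}) := [/\ R \subset orb g x, (#|R|.*2 <= #|orb g x|)%N &
    forall P : t.-tuple 'I_p -> Prop, (forall z, z \in R -> P z) ->
      (forall z, z \in orb g x -> P z -> P (phi_tuple z)) -> forall z, z \in orb g x -> P z].

(** As [y] lies in the orbit of [x], [phi] permutes this orbit, and it has no fixed point because
    [y != x]. *)
Lemma half_ex : y \in orb g x -> y != x -> exists R, is_half R.
Proof.
move=> yO yx; apply: half_transversal => [z|z z' zO z'O|z zO].
- case/orbP => s e; case/orbP: yO => s0 e0; apply/orbP; exists (s0 ++ s).
  by rewrite ev_cat tactM e0 -[RHS]/(phi z) -e phiE.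
- move=> /(congr1 val); move: zO z'O => /orbP[s e] /orbP[s' e'].
  rewrite -[val (phi_tuple z)]/(phi z) -[val (phi_tuple z')]/(phi z') -e -e' !phiE => /transfer h.
  by apply: val_inj; rewrite /= -e -e' h.
- apply: contra yx => /eqP/(congr1 val); move: zO => /orbP[s e].
  rewrite -[val (phi_tuple z)]/(phi z) /= -e phiE => h; apply/eqP/val_inj.
  exact: tact_inj h.
Qed.

End Phi.

Section BadB.
Variable p : nat.
Hypothesis p_prime : prime p.
Variables (N t : nat).
Hypothesis tN : (t <= N)%N.
Local Notation coord := ('I_3 * word p N)%type.
Local Notation sample := (sample p N).
Local Notation lab := (lab p_prime).
Local Notation lform := (lform p_prime).
Local Notation i0 := (ord_zero p_prime).
Local Notation Lf := (Lf p_prime t).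
Implicit Types (o : sample) (x y z : t.-tuple 'I_p).

(** An arbitrary choice; cells evaluate it at [bar t o], so it is constant on each of them. *)
Definition half x y (o : sample) : {set t.-tuple 'I_p} :=
  xget finset.set0 [set R | is_half (gen o) x y R].

(* Here [x] and [y] lie in the same orbit, so that both forms see the same labels:
   only the coordinates outside a half transversal of [phi] are varied, and the
   relation propagates along the cycles of [phi]. *)
Lemma badB_sum x y (Z : seq (seq 'I_p)) (c c' : nat -> 'F_p) (b : nat) (B : {set sample})
    (f : sample -> rat) :
  (exists2 j, (t + j < N)%N & (c j != 0)%R \/ (c' j != 0)%R) ->
  (forall z : seq 'I_p, z \in Z -> size z <= t)%N -> y != x ->
  (forall o, 0 <= f o)%R ->
  (forall o, o \in B -> [/\ (b.*2 <= #|orb (gen o) x|)%N,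
     y \in orb (gen o) x, (forall s, fixes (gen o) s x <-> fixes (gen o) s y) &
     forall s, fixes (gen o) s x -> (forall z : seq 'I_p, z \in Z -> fixes (gen o) s z) ->
       (lform c (N - t) (sec (ev (gen o) s) x) + lform c' (N - t) (sec (ev (gen o) s) y) = 0)%R]) ->
  (\sum_(o in B) f (bar t o) <= (p ^ weight Z)%:R / (p ^ b)%:R * \sum_o f (bar t o))%R.
Proof.
move=> [j tjN ccj] hZ yx f0 hB.
pose O o := orb (gen o) x.
have OE o : O (bar t o) = orb (gen o) x.
  by apply: orb_eqp (leqnn t) => i; apply: gen_bar.
have hbar o (oB : o \in B) : y \in orb (gen (bar t o)) x /\
   forall s, fixes (gen (bar t o)) s x <-> fixes (gen (bar t o)) s y.
  have [_ yO fE _] := hB o oB; split; first by rewrite -/(O _) OE.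
  move=> s; have gb i := gen_bar o i tN.
  have e1 := fixes_eqp gb s (eq_leq (size_tuple x)).
  have e2 := fixes_eqp gb s (eq_leq (size_tuple y)).
  by split=> [/e1/fE/e2|/e2/fE/e1].
have hhalf o (oB : o \in B) : is_half (gen (bar t o)) x y (half x y (bar t o)).
  have [yO fE] := hbar o oB; have [S hS] := half_ex p_prime fE yO yx.
  exact: (xgetPex finset.set0 (ex_intro _ S hS)).
pose A o := O o :\: half x y o.
(* A walk from [y] becomes a walk from [x] through [phi], so both forms merge into one. Taking [phi]
   at [bar t o] makes it the same throughout a cell. *)
pose F o i (z : seq 'I_p) := (Lf c o i z + Lf c' o i (phi (gen (bar t o)) x y z))%R.
apply: (@bad_sum _ p_prime N t tN x Z F (fun o => piv p_prime N j (A o))) => //.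
- by move=> o iw; apply: piv_size.
- move=> o o' oB o'B e oo s fx fZ; have [_ _ _ rel] := hB o oB; have [_ _ _ rel'] := hB o' o'B.
  have gg := bar_gen tN e.
  have gb i := eqp_sym (gen_bar o i tN).
  have [yO fE] := hbar o oB.
  have wF o1 : bar t o1 = bar t o -> fixes (gen o1) s x ->
     (forall z : seq 'I_p, z \in Z -> fixes (gen o1) s z) -> o1 \in B -> walk (gen o) (F o1) s x = 0%R.
    move=> e1 f1 fZ1 o1B; have [_ _ _ rel1] := hB o1 o1B.
    have := rel1 s f1 fZ1; rewrite !walk_lform -/(Lf c o1) -/(Lf c' o1).
    rewrite !(walk_eqp (bar_gen tN e1)) ?size_tuple // => <-.
    rewrite walkD; congr (_ + _)%R.
    rewrite e1 (walk_eqp gb) ?size_tuple // (walk_phi p_prime fE (Lf c' o1)) ?orb_refl //.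
    rewrite -(walk_eqp gb) ?size_phi //; congr walk.
    by have := phiE p_prime fE [::]; rewrite /= !tact1.
  rewrite (wF o) // (wF o') //.
    by apply/(fixes_eqp gg); rewrite ?size_tuple.
  by move=> z zZ; apply/(fixes_eqp gg); [apply: hZ|apply: fZ].
- move=> o o' oB o'B e oo h; have [yO fE] := hbar o oB; have [Rs Rc Rind] := hhalf o oB.
  apply: (cell_eq oo) => i z; rewrite finset.in_setD => /andP[_ zO].
  have hF i' z' : z' \in O (bar t o) -> (c j * (lab (gen o i' (z' ++ nseq j i0)) - lab (gen o' i' (z' ++ nseq j i0))) +
    c' j * (lab (gen o i' (phi_tuple (gen (bar t o)) x y z' ++ nseq j i0)) - lab (gen o' i' (phi_tuple (gen (bar t o)) x y z' ++ nseq j i0))) = 0)%R.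
    rewrite OE => z'O; have := h i' z' z'O; rewrite /F e -(Lf_diff tN c i' z' tjN oo) -(Lf_diff tN c' i' (phi_tuple (gen (bar t o)) x y z') tjN oo) => /eqP.
    rewrite -subr_eq0 => /eqP <-; ring.
  have [cj|cj] := eqVneq (c' j) 0%R.
    have cj' : (c j != 0)%R by case: ccj => //; rewrite cj eqxx.
    have := hF i z zO; rewrite cj mul0r addr0 => /eqP.
    by rewrite mulf_eq0 (negbTE cj') subr_eq0 /= => /eqP /lab_inj.
  (* Labels below [R] were not varied, and for [c' j] nonzero the relation [hF] passes equality of
     labels from [z] to [phi z]. *)
  move: z zO i; apply: Rind => [z zR i|z zO IH i].
    apply/esym; apply: (cell_piv _ oo); right.
    by rewrite finset.in_setD zR.
  have := hF i z zO; rewrite IH subrr mulr0 add0r => /eqP.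
  by rewrite mulf_eq0 (negbTE cj) subr_eq0 /= => /eqP /lab_inj.
- move=> o oB; have [bo _ _ _] := hB o oB; have [Rs Rc _] := hhalf o oB.
  rewrite card_piv //; rewrite -/(O _) OE in Rc.
  have -> : #|A (bar t o)| = (#|orb (gen o) x| - #|half x y (bar t o)|)%N.
    by rewrite -OE cardsDS.
  (* The surplus is [3 * (|O| - |R|) - |O|], at least half of [|O|] and hence at least [b]. *)
  rewrite mulrAC ler_pdivlMr ?ltr0n ?expn_gt0 ?prime_gt0 // -!natrM ler_nat -!expnD.
  rewrite leq_exp2l ?prime_gt1 //; move: (#|orb _ _|) (#|half _ _ _|) Rc bo => u v; lia.
Qed.

End BadB.

(** * Growth of orbits from level to level *)

Section Growth.
Variable p : nat.
Hypothesis p_prime : prime p.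
Local Open Scope group_scope.
Local Notation lab := (lab p_prime).
Variable g : 'I_3 -> Gamma p.
Variables (t : nat) (x : t.-tuple 'I_p) (a : 'I_p).
Let xa : t.+1.-tuple 'I_p := [tuple of rcons x a].

Lemma orb_word (z : t.-tuple 'I_p) : exists s, z \in orb g x -> tree_act (ev g s) x = z.
Proof. by case: (orbP g x z) => [[s e]|_]; [exists s|exists [::]]. Qed.

Lemma orb_prefix u (y : u.-tuple 'I_p) : take t y = x -> (#|orb g x| <= #|orb g y|)%N.
Proof.
move=> yx; pose f z := act_tuple (ev g (sval (cid (orb_word z)))) y.
have fE z : z \in orb g x -> take t (f z) = z.
  by move=> zO; rewrite /= tact_take yx; apply: (svalP (cid (orb_word z)) zO).
rewrite -(card_in_imset (f := f)); first last.
  by move=> z z' zO z'O e; apply: val_inj; rewrite /= -fE // -[RHS]fE // e.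
apply/subset_leq_card/fintype.subsetP => _ /imsetP[z _ ->]; apply/orbP.
by exists (sval (cid (orb_word z))).
Qed.

Lemma orb_rcons : (#|orb g x| <= #|orb g xa|)%N.
Proof. by apply: orb_prefix; rewrite /= -cats1 take_size_cat ?size_tuple. Qed.

(** [s] fixes [x] and permutes its [p] children cyclically, so every child of every point of the
    orbit is reached. *)
Lemma orb_rcons_growth s : fixes g s x -> lab (ev g s x) != 0%R ->
  (p * #|orb g x| <= #|orb g xa|)%N.
Proof.
move=> fx lx; have -> : (p * #|orb g x| = #|finset.setX (orb g x) [set: 'I_p]|)%N.
  by rewrite cardsX cardsT card_ord mulnC.
pose f (zb : t.-tuple 'I_p * 'I_p) : t.+1.-tuple 'I_p := [tuple of rcons zb.1 zb.2].
have finj : injective f by move=> [z b] [z' b'] /(congr1 val) /= /rcons_inj[/val_inj -> ->].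
rewrite -(card_imset _ finj); apply/subset_leq_card/fintype.subsetP.
move=> _ /imsetP[[z b] + ->]; rewrite finset.in_setX /= => /andP[zO _].
pose r := sval (cid (orb_word z)).
have rE : tree_act (ev g r) x = z := svalP (cid (orb_word z)) zO.
pose k := (lab (rotto a (sgval (ev g r x)^-1 b)) / lab (ev g s x))%R : 'F_p.
have labX c (j : nat) : lab (c ^+ j) = (j%:R * lab c)%R.
  by elim: j => [|j IH]; rewrite ?expg0 ?lab1 ?mul0r // expgS labM IH mulrS; ring.
have ek : (ev g s x) ^+ (k : nat) = rotto a (sgval (ev g r x)^-1 b).
  by apply: (@lab_inj _ p_prime); rewrite labX natr_Zp /k mulfVK.
apply/orbP; exists (wpow s k ++ r); rewrite ev_cat ev_pow tactM /= !tact_rcons.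
by rewrite exp_fix // exp_label // ek (rottoE p_prime) rE permKV.
Qed.

End Growth.

Section OrbitSum.
Variable p : nat.
Hypothesis p_prime : prime p.
Local Notation lab := (lab p_prime).

(** With growth, the [p] children together weigh [p * p^-3] of the parent; without it at most [p],
    with probability at most [p^-2]. For [p = 2] the total is [1/4 + 1/2], while the square instead
    of the cube would give 1. *)
Definition orbit_weight (g : 'I_3 -> Gamma p) t (x : t.-tuple 'I_p) : rat :=
  ((#|orb g x|%:R)^-1 ^+ 3)%R.

Definition orbit_sum (g : 'I_3 -> Gamma p) t : rat :=
  (\sum_(x : t.-tuple 'I_p) orbit_weight g x)%R.

Lemma orbit_sumS g t : orbit_sum g t.+1 =
  (\sum_(x : t.-tuple 'I_p) \sum_(a : 'I_p) orbit_weight g [tuple of rcons x a])%R.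
Proof.
pose f (xa : t.-tuple 'I_p * 'I_p) : t.+1.-tuple 'I_p := [tuple of rcons xa.1 xa.2].
have finj : injective f by move=> [z b] [z' b'] /(congr1 val) /= /rcons_inj[/val_inj -> ->].
rewrite pair_bigA /= /orbit_sum (reindex f) //=; apply/onW_bij/inj_card_bij => //.
by rewrite card_prod !card_tuple card_ord expnSr.
Qed.

(** The form with these coefficients reads the label at the root of a section, which turns
    conditions on labels into relations. *)
Definition dirac0 (j : nat) : 'F_p := (if j is 0 then 1 else 0)%R.

Lemma lform_dirac0 c r (g : Gamma p) : (0 < r)%N ->
  lform p_prime (fun j => c * dirac0 j)%R r g = (c * lab (g [::]))%R.
Proof.
case: r => // r _; rewrite /lform big_ord_recl big1 ?addr0 => [|i _]; last first.
  by rewrite /= mulr0 mul0r.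
rewrite mulr1; congr (_ * _)%R; rewrite /lsum (bigD1 [tuple]) //= big1 ?addr0 // => u /eqP ne; case: ne; exact: tuple0.
Qed.

Lemma orb_gt0 (g : 'I_3 -> Gamma p) u (y : u.-tuple 'I_p) : (0 < #|orb g y|)%N.
Proof. by apply/card_gt0P; exists y; apply: orb_refl. Qed.

Lemma orbit_weight_ge0 g t (x : t.-tuple 'I_p) : (0 <= orbit_weight g x)%R.
Proof. by apply: exprn_ge0; rewrite invr_ge0 ler0n. Qed.

Variable N : nat.

(* An orbit grows by the factor [p] from [x] to its children unless the labels at
   [x] vanish on the stabilizer of [x], which has probability at most [p ^- 2]. *)
Lemma orbit_sum_step t : (t < N)%N ->
  (\sum_(o : sample p N) orbit_sum (gen o) t.+1 <=
   3%:R / 4%:R * \sum_(o : sample p N) orbit_sum (gen o) t)%R.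
Proof.
move=> tN; under eq_bigr => o _ do rewrite orbit_sumS.
rewrite exchange_big /= /orbit_sum [X in (_ <= _ * X)%R]exchange_big /= mulr_sumr.
apply: ler_sum => x _.
pose f (o : sample p N) : rat := orbit_weight (gen o) x.
have f0 o : (0 <= f o)%R by apply: orbit_weight_ge0.
have fbar (o : sample p N) : f (bar t o) = f o.
  rewrite /f /orbit_weight (_ : orb (gen (bar t o)) x = orb (gen o) x) //.
  by apply: orb_eqp (leqnn t) => i; apply: gen_bar; apply: ltnW.
have p2 : (2 <= p%:R :> rat)%R by rewrite ler_nat prime_gt1.
have p0 : (0 < p%:R :> rat)%R by apply: lt_le_trans p2.
pose B : {set sample p N} :=
  [set o | `[< forall s, fixes (gen o) s x -> lab (ev (gen o) s x) = 0%R >]].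
have BP o : o \in B <-> forall s, fixes (gen o) s x -> lab (ev (gen o) s x) = 0%R.
  by rewrite finset.inE; split => /asboolP.
have wle (k : nat) (o : sample p N) (a : 'I_p) : (0 < k)%N -> (k * #|orb (gen o) x| <= #|orb (gen o) [tuple of rcons x a]|)%N ->
    (orbit_weight (gen o) [tuple of rcons x a] <= (k%:R^-1)^+3 * f o)%R.
  move=> k0 le; rewrite /f /orbit_weight -exprMn -invfM -natrM.
  apply: lerXn2r; rewrite ?nnegrE ?invr_ge0 ?ler0n //.
  by rewrite lef_pV2 ?posrE ?ltr0n ?muln_gt0 ?k0 ?orb_gt0 // ler_nat.
rewrite (bigID (mem B)) /=.
pose q : rat := (p%:R^-1)%R.
have q0 : (0 <= q)%R by rewrite invr_ge0 ltW.
have q2 : (q <= 2%:R^-1)%R by rewrite lef_pV2 ?posrE.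
have pq : (p%:R * q = 1)%R by rewrite mulfV // gt_eqF.
have S0 : (0 <= \sum_o f o)%R by apply: sumr_ge0 => o _; apply: f0.
have le1 : (\sum_(o in B) \sum_(a : 'I_p) orbit_weight (gen o) [tuple of rcons x a] <=
   p%:R * (q ^+ 2 * \sum_o f o))%R.
  apply: le_trans (_ : \sum_(o in B) p%:R * f (bar t o) <= _)%R.
    apply: ler_sum => o _; rewrite fbar mulr_natl -[p in X in (_ <= X)%R]card_ord -sumr_const.
    apply: ler_sum => a _; have := wle 1%N o a isT.
    by rewrite invr1 expr1n !mul1n mul1r; apply; apply: orb_rcons.
  rewrite -mulr_sumr; apply: ler_wpM2l; first exact: ltW.
  rewrite -[X in (_ <= _ * X)%R](eq_bigr _ (fun o _ => fbar o)).
  have -> : (q ^+ 2 = (p ^ weight (Nil (seq 'I_p)))%:R / (p ^ (2 * 1))%:R)%R.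
    by rewrite /weight big_nil expn0 muln1 natrX mul1r exprVn.
  apply: (@badC_sum p p_prime N t (ltnW tN) x x [::] (fun j => 1 * dirac0 j)%R (fun=> 0)%R 1 B f) => // [|o /BP oB].
    by exists 0%N; rewrite ?addn0 //= mulr1 oner_eq0.
  split=> [| |s fx _]; [exact: orb_gt0|by right|].
  rewrite lform_dirac0 ?subn_gt0 // mul1r.
  have -> : sec (ev (gen o) s) x [::] = ev (gen o) s x by rewrite /sec cats0.
  by rewrite oB // add0r /lform big1 // => j _; rewrite mul0r.
have le2 : (\sum_(o | o \notin B) \sum_(a : 'I_p) orbit_weight (gen o) [tuple of rcons x a] <=
   q ^+ 2 * \sum_o f o)%R.
  apply: le_trans (_ : \sum_(o | o \notin B) q ^+ 2 * f o <= _)%R.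
    apply: ler_sum => o /negP oB.
    have [s [fx lx]] : exists s, fixes (gen o) s x /\ lab (ev (gen o) s x) != 0%R.
      apply: contrapT => h; apply: oB; apply/BP => s fx; apply/eqP.
      apply: contrapT => lx; apply: h; exists s; split=> //; exact/negP.
    have -> : (q ^+ 2 * f o = \sum_(a : 'I_p) q ^+ 3 * f o)%R.
      rewrite sumr_const card_ord -[RHS]mulr_natl [(q ^+ 3)%R]exprS !mulrA pq mul1r //.
    apply: ler_sum => a _; apply: wle; first exact: prime_gt0.
    exact: orb_rcons_growth fx lx.
  rewrite -mulr_sumr; apply: ler_wpM2l; first exact: exprn_ge0.
  rewrite [X in (_ <= X)%R](bigID (mem B)) /= lerDr; apply: sumr_ge0 => o _; apply: f0.
apply: le_trans (lerD le1 le2) _.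
rewrite mulrA [(p%:R * _)%R]mulrA pq mul1r -mulrDl; apply: ler_wpM2r => //.
nra.
Qed.

Lemma orbit_sum_le t : (t <= N)%N ->
  (\sum_(o : sample p N) orbit_sum (gen o) t <= (3%:R / 4%:R) ^+ t * #|sample p N|%:R)%R.
Proof.
elim: t => [|t IH] tN; last first.
  apply: le_trans (orbit_sum_step tN) _; rewrite exprS -[X in (_ <= X)%R]mulrA.
  by apply: ler_wpM2l; [lra|apply: IH; apply: ltnW].
rewrite mul1r -sumr_const; apply: ler_sum => o _.
rewrite /orbit_sum (bigD1 [tuple]) //= big1 => [|u /eqP ne]; last by case: ne; apply: tuple0.
by rewrite addr0 exprn_ile1 ?invr_ge0 ?ler0n // invf_le1 ?ltr0n ?orb_gt0 // ler1n orb_gt0.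
Qed.

Definition small_orbits t b : {set sample p N} :=
  [set o : sample p N | [exists x : t.-tuple 'I_p, #|orb (gen o) x| < b]%N].

(** Markov's inequality: an orbit of size below [b] contributes more than [b^-3] to the orbit
    sum. *)
Lemma small_orbits_card t b : (t <= N)%N ->
  (#|small_orbits t b|%:R <= (b ^ 3)%:R * ((3%:R / 4%:R) ^+ t * #|sample p N|%:R) :> rat)%R.
Proof.
move=> tN; apply: le_trans (_ : (b ^ 3)%:R * \sum_(o in small_orbits t b) orbit_sum (gen o) t <= _)%R.
  rewrite mulr_sumr -sumr_const; apply: ler_sum => o; rewrite finset.inE => /existsP[x xb].
  rewrite /orbit_sum (bigD1 x) //= mulrDr; apply: le_trans (_ : _ <= (b ^ 3)%:R * orbit_weight (gen o) x)%R _.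
    rewrite /orbit_weight natrX -exprMn exprn_ege1 // ler_pdivlMr ?ltr0n ?orb_gt0 // mul1r.
    by rewrite ler_nat ltnW.
  rewrite lerDl; apply: mulr_ge0; first exact: ler0n.
  by apply: sumr_ge0 => y _; apply: orbit_weight_ge0.
apply: ler_wpM2l; first exact: ler0n.
apply: le_trans _ (orbit_sum_le tN).
rewrite [X in (_ <= X)%R](bigID (mem (small_orbits t b))) /= lerDl.
by apply: sumr_ge0 => o _; apply: sumr_ge0 => y _; apply: orbit_weight_ge0.
Qed.

End OrbitSum.

(** * Pairs of sections *)

Section Pairs.
Variable p : nat.
Hypothesis p_prime : prime p.
Local Open Scope group_scope.
Variable g : 'I_3 -> Gamma p.
Implicit Types (s w : seq 'I_3) (x y z u : seq 'I_p) (c : nat -> 'F_p).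
Local Notation lab := (lab p_prime).
Local Notation lform := (lform p_prime).
Local Notation ev := (ev g).
Local Notation fixes := (fixes g).

Lemma fixes_take s n x : fixes s x -> fixes s (take n x).
Proof. by move=> fx; rewrite /fixes -tact_take fx. Qed.

Lemma fixes_rcons s x a : fixes s (rcons x a) <-> fixes s x /\ ev s x = 1.
Proof.
rewrite /fixes tact_rcons; split=> [/rcons_inj[-> /(Cp_fixP p_prime)]|[-> ->]] //.
by rewrite perm1.
Qed.

Lemma conj_word N w s : exists s', eqp N (ev s') (ev w * ev s * (ev w)^-1).
Proof.
have [r er] := ev_inv p_prime g N w; exists (w ++ s ++ r).
by rewrite !ev_cat mulgA; apply: eqpM.
Qed.

Lemma fixes_conj N w s s' x : eqp N (ev s') (ev w * ev s * (ev w)^-1) ->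
  (size x <= N)%N -> fixes s' x <-> fixes s (tree_act (ev w) x).
Proof.
move=> e xN; rewrite /fixes (eqp_act e) // !tactM; split=> [h|->]; last by rewrite tactK.
by rewrite -[in RHS]h tactKV.
Qed.

(** The sections of [w] and of its inverse contribute opposite values. *)
Lemma lform_conj N w s s' x c r : eqp N (ev s') (ev w * ev s * (ev w)^-1) ->
  (size x + r <= N)%N -> fixes s (tree_act (ev w) x) ->
  lform c r (sec (ev s') x) = lform c r (sec (ev s) (tree_act (ev w) x)).
Proof.
move=> e xr fs; have e' : eqp r (sec (ev s') x) (sec (ev w * ev s * (ev w)^-1) x).
  by apply: eqp_le (eqp_sec x e); lia.
rewrite (lform_eqp p_prime c e') !secM tactM fs secV tactK !lformM lformV; ring.
Qed.

Lemma lab_conj N w s s' x : eqp N (ev s') (ev w * ev s * (ev w)^-1) ->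
  (size x < N)%N -> fixes s (tree_act (ev w) x) ->
  lab (ev s' x) = lab (ev s (tree_act (ev w) x)).
Proof.
move=> e xr fs; have := @lform_conj N w s s' x (fun j => 1 * dirac0 p j)%R 1 e.
by rewrite addn1 !lform_dirac0 // !mul1r /sec !cats0; apply.
Qed.

Definition moves_to x y := exists s, tree_act (ev s) x = y.
Definition nonzero r c := exists2 j, (j < r)%N & (c j != 0)%R.
Definition relation r (Z : seq (seq 'I_p)) x y c c' := forall s, fixes s x ->
  (forall z, z \in Z -> fixes s z) ->
  (lform c r (sec (ev s) x) + lform c' r (sec (ev s) y) = 0)%R.

(* [bad_B] relates two words of one orbit with the same stabilizer, [bad_C] a
   word to itself or to a word of another orbit. *)
Definition bad_B r Z x y c c' := [/\ moves_to x y, y <> x,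
  forall s, fixes s x <-> fixes s y, nonzero r c \/ nonzero r c' & relation r Z x y c c'].

Definition bad_C r Z x y c c' := [/\ ~ moves_to x y \/ (forall j, c' j = 0%R),
  nonzero r c & relation r Z x y c c'].

Definition sections_onto r x y := forall a b : Gamma p, exists s,
  [/\ fixes s x, fixes s y, eqp r (sec (ev s) x) a & eqp r (sec (ev s) y) b].

Lemma sections_ontoP r x y : sections_onto r x y \/ exists c c',
  (nonzero r c \/ nonzero r c') /\ relation r [:: y] x y c c'.
Proof.
have [[c [c' h]]|h] := pselect (exists c c',
  (nonzero r c \/ nonzero r c') /\ relation r [:: y] x y c c'); first by right; exists c, c'.
left=> a b.
pose B : set (Gamma p * Gamma p)%type :=
  [set ab | exists s, [/\ fixes s x, fixes s y, sec (ev s) x = ab.1 & sec (ev s) y = ab.2]]%classic.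
have [||c c' [j [jr cj]]|ab [[s [fx fy e1 e2]] ea eb]] := @pair_onto p p_prime r B _ _ _ a b.
- by exists [::]; rewrite /= !sec1 /fixes /= !tact1.
- move=> [a1 b1] [a2 b2] [s [fx fy /= <- <-]] [s' [fx' fy' /= <- <-]].
  by exists (s ++ s'); rewrite ev_cat /= !secM fx fy; split=> //; apply: fixes_cat.
- apply: contrapT => hB; apply: h; exists c, c'; split.
    by case: cj => cj; [left|right]; exists j.
  move=> s fx fZ; apply/eqP/negPn/negP => ne; apply: hB.
  exists (sec (ev s) x, sec (ev s) y); split=> //.
  by exists s; split=> //; apply: fZ; rewrite inE.
by exists s; rewrite e1 e2.
Qed.

(** [C_p] acts freely on the letters: fixing one child forces a trivial label at the parent and so
    fixes all children. *)
Lemma sibling_fixes s x y n : size x = n.+1 -> size y = n.+1 -> take n x = take n y ->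
  fixes s x <-> fixes s y.
Proof.
elim/last_ind: x => // x a _; elim/last_ind: y => // y b _.
rewrite !size_rcons => -[xn] [yn]; rewrite -!cats1 !take_size_cat // => ->.
by rewrite !cats1 !fixes_rcons.
Qed.

Lemma relation_sym r x y c c' : relation r [:: y] x y c c' -> relation r [:: x] y x c' c.
Proof. by move=> h s fy fx; rewrite addrC; apply: h => [|z]; [apply: fx|]; rewrite inE // => /eqP->. Qed.

Lemma relation0 r Z x y c c' : ~ nonzero r c' -> relation r Z x y c c' ->
  relation r Z x y c (fun=> 0%R).
Proof.
move=> nz h s fx fZ; rewrite -[RHS](h s fx fZ); congr (_ + _)%R.
apply: eq_bigr => j _; congr (_ * _)%R; apply/esym/eqP/negPn/negP => cj.
by apply: nz; exists j.
Qed.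

Variables (N i j : nat).
Hypotheses (ij : (i < j)%N) (jN : (j.+1 < N)%N).
Hypothesis noB : forall t x y z c c', (i < t <= j.+1)%N ->
  size x = t -> size y = t -> size z = t -> ~ bad_B (N - t) [:: z] x y c c'.
Hypothesis noC : forall t x y z c c', (i < t <= j.+1)%N ->
  size x = t -> size y = t -> size z = t -> ~ bad_C (N - t) [:: z] x y c c'.
Definition words_of i := [seq tval u | u : i.-tuple 'I_p].
(** On level [j] relations are excluded even on the subgroup fixing all words of length [i], which
    every [ev s] normalizes. *)
Hypothesis noB' : forall x y c c', size x = j -> size y = j ->
  ~ bad_B (N - j) (words_of i) x y c c'.
Hypothesis noC' : forall x z c, size x = j -> size z = j ->
  ~ bad_C (N - j) (z :: words_of i) x x c (fun=> 0%R).

(* Conjugating a relation by [w] and subtracting leaves a relation between [Y] and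
   its sibling [Y ^ w], which have the same stabilizer. *)
Lemma onto_moving t X Y w : (i < t <= j.+1)%N -> size X = t -> size Y = t ->
  fixes w X -> fixes w (take t.-1 Y) -> ~ fixes w Y -> sections_onto (N - t) X Y.
Proof.
move=> it sX sY fX fY' nY; have [//|[c [c' [nz rel]]]] := sections_ontoP (N - t) X Y.
have t1 : t.-1.+1 = t by lia.
exfalso; have [nz'|z'] := pselect (nonzero (N - t) c'); last first.
  apply: (noC (x := X) (y := Y) (z := Y) it sX sY sY (c := c) (c' := fun=> 0%R)).
  by split; [right|case: nz|apply: relation0 rel].
pose Yw := tree_act (ev w) Y.
have sYw : size Yw = t by rewrite size_tree_act.
have fE s : fixes s Y <-> fixes s Yw.
  by apply: (@sibling_fixes s _ _ t.-1); rewrite ?t1 // /Yw tact_take fY'.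
apply: (noB (x := Y) (y := Yw) (z := X) it sY sYw sX (c := c') (c' := fun j => - c' j)%R).
split=> //; [by exists w|by left|].
move=> s fY fZ; have fX' := fZ X (mem_head _ _).
have [s' es'] := conj_word N w s.
have h1 := rel s fX' (fun z => _); rewrite -[X in _ = X](subrr (0 : 'F_p)%R).
have {}h1 : (lform c (N - t) (sec (ev s) X) + lform c' (N - t) (sec (ev s) Y) = 0)%R.
  by apply: rel => // z; rewrite inE => /eqP->.
have h2 : (lform c (N - t) (sec (ev s') X) + lform c' (N - t) (sec (ev s') Y) = 0)%R.
  apply: rel => [|z]; first by apply/(fixes_conj es'); rewrite ?sX ?fX //; lia.
  rewrite inE => /eqP->; apply/(fixes_conj es'); first by rewrite sY; lia.
  by apply/fE.
rewrite -[X in (_ = X - _)%R]h1 -[X in (_ = _ - X)%R]h2.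
rewrite !(lform_conj c es', lform_conj c' es') ?sX ?sY; try lia.
- rewrite fX -/Yw /lform.
  have -> : (\sum_(j0 < N - t) - c' j0 * lsum p_prime j0 (sec (ev s) Yw) = - lform c' (N - t) (sec (ev s) Yw))%R.
    by rewrite /lform -sumrN; apply: eq_bigr => k _; rewrite mulNr.
  rewrite /lform; ring.
- by apply/fE.
- by rewrite fX.
Qed.

(** Siblings have the same stabilizer, so a relation between them is a [bad_B] within one orbit and
    a [bad_C] otherwise. *)
Lemma onto_sibling x y t : (i < t <= j.+1)%N -> size x = t -> size y = t -> x <> y ->
  take t.-1 x = take t.-1 y -> sections_onto (N - t) x y.
Proof.
move=> it sx sy xy e; have [//|[c [c' [nz rel]]]] := sections_ontoP (N - t) x y.
have t1 : t.-1.+1 = t by lia.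
have fE s : fixes s x <-> fixes s y by apply: (@sibling_fixes s _ _ t.-1); rewrite ?t1.
exfalso; have [m|nm] := pselect (moves_to x y).
  apply: (noB it sx sy sy (c := c) (c' := c')).
  by split=> // /esym.
have nm' : ~ moves_to y x.
  move=> [s e']; apply: nm; have [r er] := ev_inv p_prime g N s; exists r.
  by rewrite -e' (eqp_act er) ?tactK // size_tree_act sy; lia.
case: nz => nz.
  by apply: (noC it sx sy sy (c := c) (c' := c')); split=> //; left.
apply: (noC it sy sx sx (c := c') (c' := c)); split=> //; first by left.
exact: relation_sym.
Qed.

(** At the first prefix of [y] moved by [w], the parent is still fixed and [onto_moving] applies. *)
Lemma onto_path n x y w : (i <= n <= j.+1)%N -> size x = n -> size y = n ->
  fixes w x -> fixes w (take i y) -> ~ fixes w y ->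
  exists t, [/\ (t <= n)%N, take t x <> take t y & sections_onto (N - t) (take t x) (take t y)].
Proof.
move=> inj sx sy fx fi ny.
have ex : exists t, `[< ~ fixes w (take t y) >].
  by exists n; apply/asboolP; rewrite -sy take_size.
case: (ex_minnP ex) => t /asboolP nt tmin.
have tn : (t <= n)%N by apply: tmin; apply/asboolP; rewrite -sy take_size.
have it : (i < t)%N.
  rewrite ltnNge; apply/negP => ti; apply: nt.
  by rewrite -(take_takel _ ti); apply: fixes_take.
exists t; split=> // [e|]; first by apply: nt; rewrite -e; apply: fixes_take.
apply: (@onto_moving _ _ _ w); rewrite ?size_takel ?sx ?sy //; [lia|exact: fixes_take|].
rewrite take_takel; last lia.
apply: contrapT => h; have := tmin t.-1; suff: `[< ~ fixes w (take t.-1 y) >] by move=> -> /(_ isT); lia.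
exact/asboolP.
Qed.

Definition normalizes n (A : seq 'I_3 -> Prop) b := forall s s',
  eqp n (ev s') (ev b * ev s * (ev b)^-1) -> A s' <-> A s.

(* Normalizers grow in the finite p-group induced on level [n]. *)
Lemma normalizer_word n (A B : seq 'I_3 -> Prop) b0 :
  closed A -> closed B -> (forall s, A s -> B s) ->
  (forall s s', eqp n (ev s) (ev s') -> A s -> A s') ->
  B b0 -> ~ A b0 -> exists b, [/\ B b, ~ A b & normalizes n A b].
Proof.
move=> [A0 AM] [B0 BM] AB Aeq Bb Ab.
pose im (D : seq 'I_3 -> Prop) : {set {perm n.-tuple 'I_p}} :=
  [set q | `[< exists2 s, D s & act_perm n (ev s) = q >]].
have imP (D : seq 'I_3 -> Prop) q : reflect (exists2 s, D s & act_perm n (ev s) = q) (q \in im D).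
  by rewrite finset.inE; apply: asboolP.
have gim (D : seq 'I_3 -> Prop) : D [::] -> (forall s s', D s -> D s' -> D (s ++ s')) -> group_set (im D).
  move=> D0 DM; apply/group_setP; split; first by apply/imP; exists [::] => //=; apply: act_perm1.
  move=> _ _ /imP[s Ds <-] /imP[s' Ds' <-]; apply/imP; exists (s ++ s'); first exact: DM.
  by rewrite ev_cat act_permM.
have memA s : act_perm n (ev s) \in im A -> A s.
  by case/imP => s' As' /act_perm_eqp e; apply: Aeq As'.
pose GA := Group (gim A A0 AM); pose GB := Group (gim B B0 BM).
have pB : p.-group GB.
  by apply: pgroup_elts => // _ /imP[s _ <-]; apply: act_perm_pelt.
have : GA \proper GB.
  apply/fintype.properP; split.
    by apply/fintype.subsetP => _ /imP[s As <-]; apply/imP; exists s => //; apply: AB.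
  by exists (act_perm n (ev b0)); [apply/imP; exists b0|apply/negP => /memA].
move/(nilpotent_proper_norm (pgroup_nil pB)) => /fintype.properP[_ [q]].
rewrite finset.in_setI => /andP[/imP[b Bb' <-] nb] nA; exists b; split=> //.
  by move=> Ab'; case/negP: nA; apply/imP; exists b.
move=> s s' /act_perm_eqp e.
have bV : act_perm n (ev b)^-1 = (act_perm n (ev b))^-1.
  by apply/(mulgI (act_perm n (ev b))); rewrite -act_permM !mulgV act_perm1.
have ec : act_perm n (ev s') = act_perm n (ev s) ^ (act_perm n (ev b))^-1.
  by rewrite e !act_permM bV conjgE invgK mulgA.
have mE : (act_perm n (ev s') \in im A) = (act_perm n (ev s) \in im A).
  by rewrite ec; apply: memJ_norm; rewrite groupV.
split=> As; apply: memA; [rewrite -mE|rewrite mE]; apply/imP; by [exists s'|exists s].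
Qed.

Lemma mem_words u : u \in words_of i <-> size u = i.
Proof.
split=> [/mapP[v _ ->]|su]; first exact: size_tuple.
by apply/mapP; exists (Tuple (introT eqP su)) => //; rewrite mem_enum.
Qed.

(* If every element fixing the words of length [i] and [x'] also fixes [y'], the
   labels at [y'] are a multiple [k] of those at [x'] on these elements. For
   [k != 0], [normalizer_word] replaces [y'] by a word with the same stabilizer
   as [x']. *)
Lemma pairs_onto x y : size x = j.+1 -> size y = j.+1 -> x <> y ->
  exists t, [/\ (t <= j.+1)%N, take t x <> take t y & sections_onto (N - t) (take t x) (take t y)].
Proof.
move=> sx sy xy; have [exy|nxy] := eqVneq (take i x) (take i y).
  have ex : exists t, take t x != take t y.
    by exists j.+1; rewrite -{1}sx -sy !take_size; apply/eqP.
  case: (ex_minnP ex) => t nt tmin.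
  have tn : (t <= j.+1)%N by apply: tmin; rewrite -{1}sx -sy !take_size; apply/eqP.
  have it : (i < t)%N.
    rewrite ltnNge; apply/negP => ti; case/eqP: nt.
    by rewrite -(take_takel x ti) exy take_takel.
  exists t; split=> //; first exact/eqP.
  apply: onto_sibling; rewrite ?size_takel ?sx ?sy ?it //; first exact/eqP.
  rewrite !take_takel; try lia; apply/eqP/negPn/negP => ne; have := tmin _ ne; lia.
apply: contrapT => fail.
have path n w : (i <= n <= j.+1)%N -> fixes w (take n x) -> fixes w (take i y) -> fixes w (take n y).
  move=> inj fx fi; apply: contrapT => ny; apply: fail.
  have [|||t [tn ne so]] := @onto_path n (take n x) (take n y) w inj _ _ fx _ ny.
  - by rewrite size_takel ?sx //; lia.
  - by rewrite size_takel ?sy //; lia.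
  - by rewrite take_takel //; lia.
  by exists t; move: ne so; rewrite !take_takel //; split=> //; lia.
pose x' := take j x; pose y' := take j y.
have sx' : size x' = j by rewrite size_takel // sx.
have sy' : size y' = j by rewrite size_takel // sy.
have xy' : x' <> y'.
  move=> e; case/eqP: nxy; rewrite -(take_takel x (ltnW ij)) -/x' e.
  by rewrite take_takel // ltnW.
have rN : (0 < N - j)%N by rewrite subn_gt0 ltnW.
pose d (a : 'F_p) := (fun k => a * dirac0 p k)%R.
have nzd a : a != 0%R -> nonzero (N - j) (d a) by exists 0%N; rewrite /d /= ?mulr1.
have labE a s z : lform (d a) (N - j) (sec (ev s) z) = (a * lab (ev s z))%R.
  by rewrite lform_dirac0 // /sec cats0.
pose W s := (forall u, size u = i -> fixes s u) /\ fixes s x'.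
have WZ s : fixes s x' -> (forall z, z \in words_of i -> fixes s z) -> W s.
  by move=> fx fZ; split=> // u /mem_words/fZ.
have Wy s : W s -> fixes s y'.
  case=> fi fx; apply: path => //; first lia.
  by apply: fi; rewrite size_takel // sy; lia.
have split_last z : size z = j.+1 -> exists a, z = rcons (take j z) a.
  case: (lastP z) => // v a; rewrite size_rcons => -[sz].
  by exists a; rewrite -[in take _ _]cats1 -sz take_size_cat.
have [a ea] := split_last x sx; have [b eb] := split_last y sy.
rewrite -/x' in ea; rewrite -/y' in eb.
(* On level [j.+1], [path] compares the labels at [x'] and [y']; hence words one letter longer than
   [x']. *)
have Wxy s : W s -> lab (ev s x') = 0%R -> lab (ev s y') = 0%R.
  move=> Ws /eqP; rewrite lab_eq0 => /eqP l0; case: (Ws) => fi fx.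
  have : fixes s (take j.+1 y).
    apply: path; first lia.
      by rewrite -sx take_size ea; apply/fixes_rcons.
    by apply: fi; rewrite size_takel // sy; lia.
  by rewrite -sy take_size eb => /fixes_rcons[_ ->]; rewrite lab1.
have labX s q z : fixes s z -> lab (ev (wpow s q) z) = (q%:R * lab (ev s z))%R.
  move=> fz; rewrite ev_pow exp_label //.
  by elim: q => [|q IH]; rewrite ?expg0 ?lab1 ?mul0r // expgS labM IH mulrS; ring.
have clW : closed W.
  split; first by split=> [u _|]; rewrite /fixes /= tact1.
  by move=> s s' [fi fx] [fi' fx']; split=> [u su|]; apply: fixes_cat => //; [apply: fi|apply: fi'].
(* A homomorphism to the prime field vanishing on the kernel of another is a multiple of it. *)
have [k hk] : exists k : 'F_p, forall s, W s -> lab (ev s y') = (k * lab (ev s x'))%R.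
  have [[w0 [W0 l0]]|h] := pselect (exists w0, W w0 /\ lab (ev w0 x') != 0%R); last first.
    exists 0%R => s Ws; rewrite mul0r; apply: Wxy => //; apply/eqP/negPn/negP => l.
    by apply: h; exists s.
  exists (lab (ev w0 y') / lab (ev w0 x'))%R => s Ws.
  pose q := (- (lab (ev s x') / lab (ev w0 x')))%R : 'F_p.
  have Wq : W (wpow w0 q) by apply: closed_pow.
  have [_ WM] := clW; have /Wxy := WM _ _ Ws Wq; rewrite ev_cat !GammaME !labM.
  have [_ fsx] := Ws; have [_ fwx] := W0; rewrite fsx (Wy s) // !labX ?natr_Zp //; last exact: Wy.
  rewrite {1}/q mulNr mulfVK // subrr => /(_ erefl) /eqP; rewrite addr_eq0 => /eqP ->.
  by rewrite /q; ring.
(* For [k = 0] the label at [y'] vanishes on [W], a relation involving [y'] alone. *)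
have [k0|k0] := eqVneq k 0%R.
  apply: (noC' (x := y') (z := x') (c := d 1%R) sy' sx'); split; [by right|exact: nzd (oner_neq0 _)|].
  move=> s fy fZ; rewrite labE mul1r.
  rewrite [lform (fun=> _) _ _]big1 => [|q _]; last by rewrite mul0r.
  rewrite addr0 hk ?k0 ?mul0r //; apply: WZ => [|z zw]; apply: fZ; first exact: mem_head.
  by rewrite inE zw orbT.
have onto_j : ~ sections_onto (N - j) x' y' by move=> h; apply: fail; exists j; split.
have [m|nm] := pselect (moves_to x' y'); last first.
  have nm' : ~ moves_to y' x'.
    move=> [s e']; apply: nm; have [r er] := ev_inv p_prime g N s; exists r.
    by rewrite -e' (eqp_act er) ?tactK // size_tree_act sy'; lia.
  have [//|[c [c' [nz rel]]]] := sections_ontoP (N - j) x' y'.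
  have it : (i < j <= j.+1)%N by lia.
  case: nz => nz.
    by apply: (noC it sx' sy' sy' (c := c) (c' := c')); split=> //; left.
  by apply: (noC it sy' sx' sx' (c := c') (c' := c)); split; [left| |apply: relation_sym].
have [g0 eg0] := m.
(* [B] consists of the words carrying [x'] to a point whose labels on [W] are a nonzero multiple of
   those at [x']. It contains [g0], so it is larger than the stabilizer [A]. *)
pose A s := fixes s x'.
pose B s := exists2 e : 'F_p, e != 0%R & forall w, W w ->
  fixes w (tree_act (ev s) x') /\ lab (ev w (tree_act (ev s) x')) = (e * lab (ev w x'))%R.
have [||||||bb [[e e0 hB] nA nor]] := @normalizer_word j.+1 A B g0.
- split; first by rewrite /A /fixes /= tact1.
  by move=> s s'; apply: fixes_cat.
- split; first by exists 1%R; rewrite ?oner_neq0 // => w [_ fw]; rewrite /= tact1 mul1r.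
  move=> s s' [e1 ne1 h1] [e2 ne2 h2]; exists (e1 * e2)%R; first by rewrite mulf_neq0.
  move=> w Ww; have [f2 l2] := h2 w Ww; have [w1 ew1] := conj_word N s' w.
  have Ww1 : W w1.
    split=> [u su|]; apply/(fixes_conj ew1) => //; [by rewrite su; lia| |by rewrite sx'; lia].
    by case: Ww => fi _; apply: fi; rewrite size_tree_act.
  have [f1 l1] := h1 w1 Ww1; rewrite ev_cat tactM.
  have sz : (size (tree_act (ev s) x') < N)%N by rewrite size_tree_act sx'; lia.
  have f3 := proj1 (fixes_conj ew1 (ltnW sz)) f1; split=> //.
  rewrite -(lab_conj ew1) // l1 (lab_conj ew1) ?sx' //; last lia.
  by rewrite l2 mulrA.
- move=> s fs; exists 1%R; rewrite ?oner_neq0 // => w [_ fw].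
  by rewrite fs mul1r.
- by move=> s s' es; rewrite /A /fixes (eqp_act es) // sx'.
- exists k => // w Ww; rewrite eg0; split; [exact: Wy|exact: hk].
- by rewrite /A /fixes eg0 => /esym.
pose y2 := tree_act (ev bb) x'.
have sy2 : size y2 = j by rewrite size_tree_act.
(* As [bb] normalizes [A], the word [y2] has the stabilizer of [x']; the proportionality of labels
   on [W] is the relation. *)
apply: (noB' sx' sy2 (c := d e) (c' := d (-1)%R)); split=> //.
- by exists bb.
- move=> s; have [s' es'] := conj_word N bb s.
  have es : eqp j.+1 (ev s') (ev bb * ev s * (ev bb)^-1) by apply: eqp_le es'; apply: ltnW.
  have h1 := nor s s' es; have xN : (size x' <= N)%N by rewrite sx'; lia.
  by have h2 := fixes_conj es' xN; split=> [/h1/h2|/h2/h1].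
- by left; apply: nzd.
- move=> s fx fZ; have Ws := WZ s fx fZ; have [f2 l2] := hB s Ws.
  by rewrite !labE l2; ring.
Qed.

End Pairs.

(** * The union bound over all relations *)

Section Count.
Variable p : nat.
Hypothesis p_prime : prime p.
Variable N : nat.
Local Notation sample := (sample p N).
Local Notation bad_B o := (bad_B p_prime (@gen p N o)).
Local Notation bad_C o := (bad_C p_prime (@gen p N o)).
Local Notation coeffs := {ffun 'I_N -> 'F_p}.

Lemma card_exists_le (I : finType) (P : I -> sample -> Prop) (K : rat) :
  (forall q, #|[set o : sample | `[< P q o >]]|%:R <= K)%R ->
  (#|[set o : sample | `[< exists q, P q o >]]|%:R <= #|I|%:R * K)%R.
Proof.
move=> h; rewrite mulr_natl.
apply: le_trans (_ : _ <= \sum_(q in I) #|[set o : sample | `[< P q o >]]|%:R)%R _; last first.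
  by rewrite -[X in (_ <= X)%R]sumr_const; apply: ler_sum => q _; apply: h.
rewrite -natr_sum ler_nat; apply: leq_trans (_ : _ <= #|\bigcup_(q in I) [set o : sample | `[< P q o >]]|)%N _.
  apply/subset_leq_card/fintype.subsetP => o; rewrite finset.inE => /asboolP[q Pq].
  by apply/finset.bigcupP; exists q => //; rewrite finset.inE; apply/asboolP.
elim/big_ind2: _ => [|a A b B Aa Bb|//].
  by rewrite cards0.
have [le _] := leq_card_setU A B; by apply: leq_trans le _; apply: leq_add.
Qed.

Lemma badB_card t (x y : t.-tuple 'I_p) Z c c' b : (t <= N)%N ->
  (forall z : seq 'I_p, z \in Z -> size z <= t)%N ->
  (#|[set o : sample | `[< (b.*2 <= #|orb (gen o) x|)%N /\ bad_B o (N - t) Z x y c c' >]]|%:R <=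
    (p ^ weight Z)%:R / (p ^ b)%:R * #|sample|%:R :> rat)%R.
Proof.
move=> tN hZ; set B : {set sample} := [set o | _].
have BP o : o \in B -> (b.*2 <= #|orb (gen o) x|)%N /\ bad_B o (N - t) Z x y c c'.
  by rewrite finset.inE => /asboolP.
(* The conditions on words and coefficients alone are read off from one bad sample. *)
have [->|[q qB]] := finset.set_0Vmem B.
  by rewrite cards0 mulr_ge0 ?divr_ge0 ?ler0n.
have [_ [_ yx _ nz _]] := BP q qB.
have /= := @badB_sum p p_prime N t tN x y Z c c' b B (fun=> 1%R).
rewrite !sumr_const; apply=> //.
- by case: nz => -[j jr cj]; exists j; [lia|left|lia|right].
- by apply/eqP => e; apply: yx; rewrite e.
- by move=> o /BP[bo [/orbP yO _ fE _ rel]]; split.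
Qed.

Lemma badC_card t (x y : t.-tuple 'I_p) Z c c' b : (t <= N)%N ->
  (forall z : seq 'I_p, z \in Z -> size z <= t)%N ->
  (#|[set o : sample | `[< (b.*2 <= #|orb (gen o) x|)%N /\ bad_C o (N - t) Z x y c c' >]]|%:R <=
    (p ^ weight Z)%:R / (p ^ b)%:R * #|sample|%:R :> rat)%R.
Proof.
move=> tN hZ; set B : {set sample} := [set o | _].
have BP o : o \in B -> (b.*2 <= #|orb (gen o) x|)%N /\ bad_C o (N - t) Z x y c c'.
  by rewrite finset.inE => /asboolP.
have [->|[q qB]] := finset.set_0Vmem B.
  by rewrite cards0 mulr_ge0 ?divr_ge0 ?ler0n.
have [_ [_ nz _]] := BP q qB.
apply: le_trans (_ : _ <= (p ^ weight Z)%:R / (p ^ (2 * b))%:R * #|sample|%:R)%R _; last first.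
  apply: ler_wpM2r; rewrite ?ler0n //; apply: ler_wpM2l; rewrite ?ler0n //.
  rewrite lef_pV2 ?posrE ?ltr0n ?expn_gt0 ?prime_gt0 // ler_nat leq_exp2l ?prime_gt1 //.
  by rewrite mul2n -addnn leq_addr.
have /= := @badC_sum p p_prime N t tN x y Z c c' b B (fun=> 1%R).
rewrite !sumr_const; apply=> //.
- by case: nz => j jr cj; exists j; [lia|].
- move=> o /BP[bo [h _ rel]]; split=> //; first by apply: leq_trans bo; rewrite -addnn leq_addr.
  by case: h => h; [left; apply/negP => /orbP|right].
Qed.

(* Only the coefficients of index less than [N] matter, so that relations form a
   finite family. *)
Definition cf (c : coeffs) (k : nat) : 'F_p := (if insub k is Some q then c q else 0)%R.
Definition cut (c : nat -> 'F_p) : coeffs := [ffun q : 'I_N => c q].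

Lemma cfK c k : (k < N)%N -> cf (cut c) k = c k.
Proof. by move=> kN; rewrite /cf insubT ffunE. Qed.

Lemma lform_cut r c g : (r <= N)%N -> lform p_prime (cf (cut c)) r g = lform p_prime c r g.
Proof.
move=> rN; apply: eq_bigr => k _; rewrite cfK //.
exact: leq_trans (ltn_ord k) rN.
Qed.

Lemma nonzero_cut r c : (r <= N)%N -> nonzero r c -> nonzero r (cf (cut c)).
Proof. by move=> rN [k kr ck]; exists k; rewrite ?cfK //; apply: leq_trans rN. Qed.

Lemma relation_cut g r Z x y c c' : (r <= N)%N ->
  relation p_prime g r Z x y c c' -> relation p_prime g r Z x y (cf (cut c)) (cf (cut c')).
Proof. by move=> rN h s fx fZ; rewrite !lform_cut //; apply: h. Qed.

Lemma bad_B_cut o r Z x y c c' : (r <= N)%N ->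
  bad_B o r Z x y c c' -> bad_B o r Z x y (cf (cut c)) (cf (cut c')).
Proof.
move=> rN [h1 h2 h3 h4 h5]; split=> //; last exact: relation_cut.
by case: h4 => /(nonzero_cut rN); [left|right].
Qed.

Lemma bad_C_cut o r Z x y c c' : (r <= N)%N ->
  bad_C o r Z x y c c' -> bad_C o r Z x y (cf (cut c)) (cf (cut c')).
Proof.
move=> rN [h1 h2 h3]; split=> //; last exact: relation_cut; last exact: nonzero_cut.
case: h1 => h1; [by left|right => k].
by rewrite /cf; case: insubP => // q _ _; rewrite ffunE h1.
Qed.

Variables (i j : nat).
Hypotheses (ij : (i < j)%N) (jN : (j.+1 < N)%N).

Definition bad_event t (Z : t.-tuple 'I_p -> seq (seq 'I_p)) b
   (q : t.-tuple 'I_p * t.-tuple 'I_p * t.-tuple 'I_p * coeffs * coeffs) (o : sample) :=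
  let: (x, y, z, c, c') := q in
  ((b.*2 <= #|orb (gen o) x|)%N /\ bad_B o (N - t) (Z z) x y (cf c) (cf c')) \/
  ((b.*2 <= #|orb (gen o) x|)%N /\ bad_C o (N - t) (Z z) x y (cf c) (cf c')).

(** Three words and two coefficient vectors give at most [p ^ (5 * N)] events, each of proportion at
    most [2 * p ^ w / p ^ b]. *)
Lemma bad_event_card t Z b w : (t <= N)%N ->
  (forall z : t.-tuple 'I_p, forall u : seq 'I_p, u \in Z z -> size u <= t)%N ->
  (forall z : t.-tuple 'I_p, weight (Z z) <= w)%N -> (6 * N + w <= b)%N ->
  (#|[set o : sample | `[< exists q, bad_event Z b q o >]]|%:R <=
    2%:R / (p ^ N)%:R * #|sample|%:R :> rat)%R.
Proof.
move=> tN hZ hw wb.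
have pgt k : (0 < (p ^ k)%:R :> rat)%R by rewrite ltr0n expn_gt0 prime_gt0.
apply: le_trans (@card_exists_le _ (bad_event Z b) (2%:R * ((p ^ w)%:R / (p ^ b)%:R * #|sample|%:R))%R _) _.
  case=> -[[[x y] z] c] c' /=.
  pose E1 := [set o : sample | `[< (b.*2 <= #|orb (gen o) x|)%N /\ bad_B o (N - t) (Z z) x y (cf c) (cf c') >]].
  pose E2 := [set o : sample | `[< (b.*2 <= #|orb (gen o) x|)%N /\ bad_C o (N - t) (Z z) x y (cf c) (cf c') >]].
  apply: le_trans (_ : _ <= (#|E1| + #|E2|)%:R)%R _.
    rewrite ler_nat; apply: leq_trans (leq_card_setU E1 E2).1; apply/subset_leq_card/fintype.subsetP => o.
    rewrite finset.inE => /asboolP[h|h]; rewrite finset.in_setU.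
      by apply/orP; left; rewrite finset.inE; apply/asboolP.
    by apply/orP; right; rewrite finset.inE; apply/asboolP.
  have le1 : ((p ^ weight (Z z))%:R / (p ^ b)%:R * #|sample|%:R <= (p ^ w)%:R / (p ^ b)%:R * #|sample|%:R :> rat)%R.
    apply: ler_wpM2r; rewrite ?ler0n //; apply: ler_wpM2r; first by rewrite invr_ge0 ler0n.
    by rewrite ler_nat leq_exp2l ?prime_gt1.
  rewrite natrD [X in (_ <= X)%R]mulrDl mul1r; apply: lerD; apply: le_trans le1.
    exact: badB_card (hZ z).
  exact: badC_card (hZ z).
rewrite !mulrA; apply: ler_wpM2r; rewrite ?ler0n //.
rewrite !card_prod !card_tuple card_ffun card_Fp // !card_ord -!expnD.
rewrite ler_pdivrMr // [X in (_ <= X)%R]mulrAC ler_pdivlMr // -!natrM ler_nat.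
rewrite -!mulnA mulnCA -!expnD leq_mul2l leq_exp2l ?prime_gt1 //=; lia.
Qed.

Definition near_list t (z : t.-tuple 'I_p) : seq (seq 'I_p) := [:: tval z].
Definition far_list (z : j.-tuple 'I_p) : seq (seq 'I_p) := tval z :: words_of p i.

Lemma weight_words : weight (words_of p i) = (i * p ^ i)%N.
Proof.
rewrite /weight /words_of big_map big_enum /= (eq_bigr (fun=> i)); last first.
  by move=> u _; rewrite size_tuple.
by rewrite sum_nat_const card_tuple card_ord mulnC.
Qed.

(** This is [6 * N + w] with [w] made of [N] for the word [z] and [i * p ^ i] for all words of
    length [i]. *)
Definition far_bound := (7 * N + i * p ^ i)%N.

Definition near_set : {set sample} := [set o : sample | `[< exists t : 'I_N, (i < t <= j.+1)%N /\
    exists q, bad_event (@near_list t) (7 * N) q o >]].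
Definition far_set : {set sample} :=
  [set o : sample | `[< exists q, bad_event far_list far_bound q o >]].

Definition bad_set : {set sample} :=
  (small_orbits p N i (7 * N).*2 :|: small_orbits p N j far_bound.*2) :|: (near_set :|: far_set).

Lemma near_set_card :
  (#|near_set|%:R <= N%:R * (2%:R / (p ^ N)%:R * #|sample|%:R) :> rat)%R.
Proof.
have -> : (N%:R = #|{: 'I_N}|%:R :> rat)%R by rewrite card_ord.
apply: card_exists_le => t.
have [it|it] := boolP (i < t <= j.+1)%N; last first.
  rewrite (_ : [set o : sample | _] = finset.set0); last first.
    by apply/setP => o; rewrite finset.inE finset.in_set0; apply/asboolP => -[].
  by rewrite cards0 mulr_ge0 ?divr_ge0 ?ler0n.
apply: le_trans (@bad_event_card t (@near_list t) (7 * N) N (ltnW (ltn_ord t)) _ _ _).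
- rewrite ler_nat; apply/subset_leq_card/fintype.subsetP => o; rewrite !finset.inE.
  by move=> /asboolP[_ h]; apply/asboolP.
- by move=> z u; rewrite inE => /eqP->; rewrite size_tuple.
- by move=> z; rewrite /weight big_seq1 size_tuple ltnW.
- by lia.
Qed.

Lemma far_set_card : (#|far_set|%:R <= 2%:R / (p ^ N)%:R * #|sample|%:R :> rat)%R.
Proof.
have jN' : (j <= N)%N by lia.
apply: (@bad_event_card j far_list far_bound (N + i * p ^ i) jN').
- move=> z u; rewrite inE => /orP[/eqP->|/mem_words->]; first by rewrite size_tuple.
  exact: ltnW.
- by move=> z; rewrite /weight big_cons size_tuple -/(weight _) weight_words leq_add2r.
- by rewrite /far_bound addnA leq_add2r; lia.
Qed.

Lemma bad_set_card : (#|bad_set|%:R <=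
  (((7 * N).*2 ^ 3)%:R * (3%:R / 4%:R) ^+ i + (far_bound.*2 ^ 3)%:R * (3%:R / 4%:R) ^+ j +
   (2 * N.+1)%:R / (p ^ N)%:R) * #|sample|%:R :> rat)%R.
Proof.
have iN : (i <= N)%N by lia.
have jN' : (j <= N)%N by lia.
have h1 := small_orbits_card p_prime (7 * N).*2 iN.
have h2 := small_orbits_card p_prime far_bound.*2 jN'.
have h3 := near_set_card; have h4 := far_set_card.
have [u1 _] := leq_card_setU (small_orbits p N i (7 * N).*2 :|: small_orbits p N j far_bound.*2) (near_set :|: far_set).
have [u2 _] := leq_card_setU (small_orbits p N i (7 * N).*2) (small_orbits p N j far_bound.*2).
have [u3 _] := leq_card_setU near_set far_set.
apply: le_trans (_ : _ <= (#|small_orbits p N i (7 * N).*2| + #|small_orbits p N j far_bound.*2| +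
   (#|near_set| + #|far_set|))%:R)%R _.
  by rewrite ler_nat; apply: leq_trans u1 _; apply: leq_add.
rewrite !natrD; apply: le_trans (lerD (lerD h1 h2) (lerD h3 h4)) _.
rewrite natrM -natr1 le_eqVlt; apply/orP; left; apply/eqP; ring.
Qed.

Lemma good_pairs o : o \notin bad_set -> forall x y, size x = j.+1 -> size y = j.+1 -> x <> y ->
  exists t, [/\ (t <= j.+1)%N, take t x <> take t y &
    sections_onto (@gen p N o) (N - t) (take t x) (take t y)].
Proof.
rewrite !finset.in_setU !negb_or => /andP[/andP[s1 s2] /andP[hn hf]].
have orb_large t k b x : o \notin small_orbits p N k b -> (k <= t)%N -> size x = t ->
    (forall x' : t.-tuple 'I_p, tval x' = x -> b <= #|orb (gen o) x'|)%N.
  move=> so kt sx x' ex'; have sk : size (take k x) == k by rewrite size_takel // sx.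
  have le : (#|orb (gen o) (Tuple sk)| <= #|orb (gen o) x'|)%N.
    by apply: orb_prefix; rewrite [tval x']ex'.
  apply: leq_trans le.
  by rewrite leqNgt; apply: contra so => h; rewrite finset.inE; apply/existsP; exists (Tuple sk).
have near t x y z c c' : (i < t <= j.+1)%N -> size x = t -> size y = t -> size z = t ->
   ~ (bad_B o (N - t) [:: z] x y c c' \/ bad_C o (N - t) [:: z] x y c c').
  move=> it sx sy sz h; case/negP: hn; rewrite finset.inE; apply/asboolP.
  have tN : (t < N)%N by lia.
  exists (Ordinal tN); split=> //.
  exists (Tuple (introT eqP sx), Tuple (introT eqP sy), Tuple (introT eqP sz), cut c, cut c').
  have bo := @orb_large t i (7 * N).*2 x s1 (ltnW (proj1 (andP it))) sx (Tuple (introT eqP sx)) erefl.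
  by case: h => h; [left|right]; split=> //=; [apply: bad_B_cut|apply: bad_C_cut] => //; apply: leq_subr.
have far x y z c c' : size x = j -> size y = j -> size z = j ->
   ~ (bad_B o (N - j) (z :: words_of p i) x y c c' \/ bad_C o (N - j) (z :: words_of p i) x y c c').
  move=> sx sy sz h; case/negP: hf; rewrite finset.inE; apply/asboolP.
  exists (Tuple (introT eqP sx), Tuple (introT eqP sy), Tuple (introT eqP sz), cut c, cut c').
  have bo := @orb_large j j far_bound.*2 x s2 (leqnn j) sx (Tuple (introT eqP sx)) erefl.
  by case: h => h; [left|right]; split=> //=; [apply: bad_B_cut|apply: bad_C_cut] => //; apply: leq_subr.
apply: (@pairs_onto p p_prime (gen o) N i j ij jN).
- by move=> t x y z c c' it sx sy sz h; apply: (near t x y z c c') => //; left.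
- by move=> t x y z c c' it sx sy sz h; apply: (near t x y z c c') => //; right.
(* The extra word of [far_list] is taken to be [x], which is fixed anyway. *)
- move=> x y c c' sx sy [h1 h2 h3 h4 h5]; apply: (far x y x c c') => //; left; split=> //.
  by move=> s fx fZ; apply: h5 => // u uw; apply: fZ; rewrite inE uw orbT.
- by move=> x z c sx sz h; apply: (far x x z c (fun=> 0%R)) => //; right.
Qed.

End Count.

(** * Numerical estimates *)

Lemma three_quarters k : ((3%:R / 4%:R : rat) ^+ (10 * k) <= (2%:R^-1) ^+ (4 * k))%R.
Proof.
have gen (x y : rat) : (0 <= x)%R -> (0 <= y)%R -> (x ^+ 10 <= y ^+ 4)%R -> (x ^+ (10 * k) <= y ^+ (4 * k))%R.
  by move=> x0 y0 xy; rewrite !exprM; apply: lerXn2r; rewrite ?nnegrE ?exprn_ge0.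
(* The tenth power of 3/4 is about 0.056, below 1/16. *)
by apply: gen; lra.
Qed.

Lemma sq_le_exp n : (n * n.+1 <= 4 * 2 ^ n)%N.
Proof.
have h k : (k < 2 ^ k)%N by apply: ltn_expl.
elim: n => // n IH; have := h n; rewrite expnS; nia.
Qed.

Lemma linear_le_exp a b : exists l0, forall l, (l0 <= l)%N -> (a * l + b <= 2 ^ l)%N.
Proof.
exists (4 * (a + b)).+1 => l hl; have := sq_le_exp l; nia.
Qed.

(** Meant for [n = 2 ^ l], [P = p ^ (2 * n)] and [y = 2 ^- l]. *)
Lemma tail_bound (P n : nat) (y : rat) : (2 * n * (2 * n).+1 <= 4 * P)%N -> (0 < P)%N ->
  (n%:R * y = 1)%R -> (0 <= y)%R -> ((2 * (2 * n).+1)%:R / P%:R <= 4%:R * y)%R.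
Proof.
move=> h P0 ny y0; rewrite ler_pdivrMr ?ltr0n //.
have -> : ((2 * (2 * n).+1)%:R = (2 * n * (2 * n).+1)%:R * y :> rat)%R.
  by rewrite [(2 * n * _)%N]mulnAC [in RHS]natrM -mulrA ny mulr1.
apply: le_trans (_ : _ <= (4 * P)%:R * y)%R _; first by apply: ler_wpM2r; rewrite ?ler_nat.
by rewrite natrM -mulrA [(P%:R * y)%R]mulrC mulrA.
Qed.

Section Density.
Variable p : nat.
Hypothesis p_prime : prime p.

(** Level [10 * l] yields [2^-(4l)] against [2^(3l)] from the cube of the threshold. Level
    [90 * p * l] yields [2^-(36pl)] against [p^(33l)], which is at most [2^(33pl)]. *)
Lemma bad_density : exists K : rat, forall l, (0 < l)%N -> ((90 * p * l).+1 < 2 ^ l.+1)%N ->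
  (#|bad_set p_prime (2 ^ l.+1) (10 * l) (90 * p * l)|%:R <=
   K * 2%:R^-1 ^+ l * #|sample p (2 ^ l.+1)|%:R :> rat)%R.
Proof.
(* [28 = 2 * 7 * 2] and [48 = 28 + 2 * 10] come from the doubled thresholds; naming them keeps their
   cubes symbolic. *)
have [a ea] : exists a, a = 28%N by exists 28%N.
have [b eb] : exists b, b = 48%N by exists 48%N.
exists (a%:R ^+ 3 + b%:R ^+ 3 + 4%:R)%R => l l0 jN; have p1 := prime_gt1 p_prime.
have ij : (10 * l < 90 * p * l)%N by nia.
apply: le_trans (bad_set_card p_prime ij jN) _.
apply: ler_wpM2r; first exact: ler0n.
rewrite [X in (_ <= X)%R]mulrDl [X in (_ <= X + _)%R]mulrDl; have hge k : (0 <= (2%:R^-1 : rat) ^+ k)%R by apply: exprn_ge0; lra.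
have two k : ((2 ^ k)%:R * 2%:R^-1 ^+ k = 1 :> rat)%R.
  by rewrite natrX -exprMn mulfV ?expr1n // pnatr_eq0.
apply: lerD; first apply: lerD.
- have -> : ((7 * 2 ^ l.+1).*2 = a * 2 ^ l)%N by rewrite expnS -mul2n ea; lia.
  rewrite natrX natrM exprMn -mulrA; apply: ler_wpM2l; first by apply: exprn_ge0; apply: ler0n.
  apply: le_trans (_ : _ <= ((2 ^ l)%:R ^+ 3 * 2%:R^-1 ^+ (4 * l)))%R _.
    apply: ler_wpM2l (three_quarters l); exact/exprn_ge0/ler0n.
  have -> : (4 * l = l * 3 + l)%N by lia.
  by rewrite exprD mulrA exprM -exprMn two expr1n mul1r.
- have le1 : ((far_bound p (2 ^ l.+1) (10 * l)).*2 <= b * p ^ (11 * l))%N.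
    rewrite /far_bound expnS -mul2n eb.
    have h2 : (2 ^ l <= p ^ l)%N by rewrite leq_exp2r.
    have h3 : (l <= p ^ l)%N by apply: leq_trans h2; apply: ltnW; apply: ltn_expl.
    have -> : (p ^ (11 * l) = p ^ l * p ^ (10 * l))%N by rewrite -expnD; congr expn; lia.
    have : (0 < p ^ (10 * l))%N by rewrite expn_gt0 ltnW.
    move: h2 h3; move: (2 ^ l)%N (p ^ l)%N (p ^ (10 * l))%N => u v w; nia.
  apply: le_trans (_ : _ <= (b%:R ^+ 3 * (p ^ (11 * l))%:R ^+ 3) * (2%:R^-1) ^+ (36 * p * l))%R _.
    apply: ler_pM; [exact: ler0n|apply: exprn_ge0; lra| |].
      move: le1; move: (_.*2) (p ^ _)%N => u v uv; rewrite natrX -exprMn -natrM.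
      by apply: lerXn2r; rewrite ?nnegrE ?ler0n // ler_nat.
    rewrite (_ : 90 * p * l = 10 * (9 * p * l))%N; last lia.
    rewrite (_ : 36 * p * l = 4 * (9 * p * l))%N; last lia.
    exact: three_quarters.
  rewrite -mulrA; apply: ler_wpM2l; first by apply: exprn_ge0; apply: ler0n.
  have h2 : (p ^ (11 * l) <= 2 ^ (11 * p * l))%N.
    have -> : (11 * p * l = p * (11 * l))%N by lia.
    rewrite [X in (_ <= X)%N]expnM leq_exp2r; last lia.
    by apply: ltnW; apply: ltn_expl.
  apply: le_trans (_ : _ <= (2 ^ (11 * p * l))%:R ^+ 3 * 2%:R^-1 ^+ (36 * p * l))%R _.
    by apply: ler_wpM2r => //; apply: lerXn2r; rewrite ?nnegrE ?ler0n // ler_nat.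
  have -> : (36 * p * l = 11 * p * l * 3 + 3 * p * l)%N by lia.
  rewrite exprD mulrA exprM -exprMn two expr1n mul1r.
  apply: ler_wiXn2l; [lra|lra|nia].
- have h : ((2 ^ l.+1 * (2 ^ l.+1).+1) <= 4 * p ^ (2 ^ l.+1))%N.
    apply: leq_trans (sq_le_exp _) _; rewrite leq_mul2l /= leq_exp2r //.
    by rewrite expn_gt0.
  have P0 : (0 < p ^ (2 ^ l.+1))%N by rewrite expn_gt0 ltnW.
  move: h P0; move: (p ^ (2 ^ l.+1))%N => P; rewrite [(2 ^ l.+1)%N]expnS => h P0.
  exact: tail_bound.
Qed.

End Density.

(** * Size of the images for good samples *)

Section Growth.
Variable p : nat.
Hypothesis p_prime : prime p.
Variable X : 'I_3 -> Gamma p.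
Local Notation H := (generated_subgroup (range X)).

Definition sample_of N : sample p N := [ffun iw : 'I_3 * word p N => X iw.1 iw.2].

Lemma gen_sample_of N q : eqp N (gen (sample_of N) q) (X q).
Proof. by move=> v vN; have [w <-] := @word_exists p N v vN; rewrite genE ffunE. Qed.

Definition good l := [/\ (0 < l)%N, (2 * (90 * p * l).+1 + 1 <= 2 ^ l.+1)%N &
  sample_of (2 ^ l.+1) \notin bad_set p_prime (2 ^ l.+1) (10 * l) (90 * p * l)].

(** The level [M] of [rig_comm_mem] for [m = j.+1]. *)
Definition depth l := let m := (90 * p * l).+1 in (m + (m.+1 + (p * m).*2))%N.

Lemma good_img l n : good l -> (n <= 2 ^ l.+1)%N ->
  exists2 f, (p ^ f <= #|img n H|)%N & (#|{: word p n}| <= f + n * p ^ depth l)%N.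
Proof.
move=> [l0 mN ok] nN; have p1 := prime_gt1 p_prime.
have ij : (10 * l < 90 * p * l)%N by nia.
have jN : ((90 * p * l).+1 < 2 ^ l.+1)%N by lia.
set N := (2 ^ l.+1)%N in mN ok nN jN *.
have pairs := good_pairs ij jN ok.
have eqX s := ev_eqp (gen_sample_of (N := N)) s.
have sgH := generated_is_subgroup X.
have rigH V g h : size V = depth l -> exists2 r, H r & eqp N r (rig V [~ g, h]%g).
  apply: (@rig_comm_mem p p_prime H N (90 * p * l).+1) => // x y sx sy xy.
  have [t [tm ne so]] := pairs x y sx sy xy; exists t; split=> // a b.
  have [s [fx fy ea eb]] := so a b; exists (ev X s).
  have szt z : size z = (90 * p * l).+1 -> size (take t z) = t by move=> sz; rewrite size_takel ?sz.
  have tN : (t <= N)%N by lia.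
  have fE z : size z = t -> fixes (gen (sample_of N)) s z -> tree_act (ev X s) z = z.
    by move=> sz fz; rewrite -(eqp_act (eqX s)) ?sz.
  have sE z a' : size z = t -> eqp (N - t) (sec (ev (gen (sample_of N)) s) z) a' -> eqp (N - t) (sec (ev X s) z) a'.
    move=> sz; apply: eqp_trans; apply: eqp_sym; rewrite -sz; exact: eqp_sec (eqX s).
  by split; [exact: ev_mem|split; apply: fE; rewrite ?szt|apply: sE; rewrite ?szt|apply: sE; rewrite ?szt].
exists #|{: free_word p_prime (depth l) n}|; first exact: (img_card_ge p_prime sgH rigH nN).
exact: card_free_word.
Qed.

Lemma card_word_ge n : (p ^ n <= #|{: word p n.+1}|)%N.
Proof.
have ex (u : n.-tuple 'I_p) : exists w : word p n.+1, w = u :> seq _.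
  by apply: word_exists; rewrite size_tuple.
pose f u := sval (cid (ex u)); have fE u : f u = u :> seq _ := svalP (cid (ex u)).
rewrite -[X in (X <= _)%N](_ : #|{: n.-tuple 'I_p}| = _); last by rewrite card_tuple card_ord.
rewrite -(card_imset _ (f := f)); first exact: max_card.
by move=> u v e; apply: val_inj; rewrite /= -fE e fE.
Qed.

(** In logarithms: log |H_n| is at least (1 - 1/k) log |Gamma_n|. The loss [n * p ^ depth l] is
    polynomial in [n], as [depth l] is linear in log n, whereas the number of words is
    exponential. *)
Lemma good_growth l1 k : (forall l, (l1 <= l)%N -> good l) -> exists n0, forall n, (n0 <= n)%N ->
  ((p ^ #|{: word p n}|) ^ k <= p ^ #|{: word p n}| * #|img n H| ^ k)%N.
Proof.
move=> hgood; have p1 := prime_gt1 p_prime.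
have [l2 hl2] := linear_le_exp (1 + 180 * p + 180 * p * p) (k + 2 * p + 6).
exists (2 ^ (maxn l1 l2))%N => n hn.
have n0 : (0 < n)%N by apply: leq_trans hn; rewrite expn_gt0.
pose l := trunc_log 2 n; have /andP[ln nl] := trunc_log_bounds (leqnn 2) n0.
rewrite -/l in ln nl.
have ll : (maxn l1 l2 <= l)%N by apply: trunc_log_max.
have l1l : (l1 <= l)%N by apply: leq_trans ll; apply: leq_maxl.
have l2l : (l2 <= l)%N by apply: leq_trans ll; apply: leq_maxr.
have [f hf hw] := good_img (hgood l l1l) (ltnW nl).
suff hk : (k * (n * p ^ depth l) <= #|{: word p n}|)%N.
  apply: leq_trans (_ : _ <= p ^ #|{: word p n}| * (p ^ f) ^ k)%N _.
    rewrite -!expnM -expnD leq_exp2l //; nia.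
  by rewrite leq_mul2l; apply/orP; right; case: (k) => // k'; rewrite leq_exp2r.
apply: leq_trans (_ : _ <= p ^ (2 ^ l).-1)%N _; last first.
  have ln' : ((2 ^ l).-1 < n)%N by rewrite prednK ?expn_gt0.
  apply: leq_trans (_ : _ <= p ^ n.-1)%N _; first by rewrite leq_exp2l //; lia.
  by have := card_word_ge n.-1; rewrite prednK.
apply: leq_trans (_ : _ <= p ^ k * (p ^ l.+1 * p ^ depth l))%N _.
  apply: leq_mul; first by apply: ltnW; apply: ltn_expl.
  rewrite leq_mul2r; apply/orP; right; apply: leq_trans (ltnW nl) _.
  by rewrite leq_exp2r.
rewrite -!expnD leq_exp2l //; have := hl2 l l2l; rewrite /depth.
move: (2 ^ l)%N => u; rewrite -mul2n => hu; have : (p * (90 * p * l).+1 = 90 * (p * p * l) + p)%N by lia.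
move: hu; rewrite !mulnDl mul1n; lia.
Qed.

End Growth.

(** * Hausdorff dimension *)

Section Metric.
Variable p : nat.
Hypothesis p_prime : prime p.
Implicit Types g h : Gamma p.

Lemma stab_cosetP n g : stab_coset n g = [set h | eqp n h g]%classic.
Proof.
apply/seteqP; split=> h /=; rewrite /stab_coset /= level_stabP => e.
  by have := eqpM e (@eqp_refl _ n g); rewrite mulgVK mul1g.
by have := eqpM e (@eqp_refl _ n g^-1%g); rewrite mulgV.
Qed.

Definition levels n : nat := (p ^ #|{: word p n}|)%N.

Lemma quo_cardE n : quo_card p n = levels n.
Proof.
pose f (t : {ffun word p n -> Cp p}) : set (Gamma p) := [set h | trunc n h = t]%classic.
rewrite /quo_card (_ : [set stab_coset n g | g in [set: Gamma p]]%classic = (f @` setT)%classic); last first.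
  apply/seteqP; split=> [_ [g _ <-]|_ [t _ <-]].
    exists (trunc n g) => //; rewrite stab_cosetP.
    by apply/seteqP; split=> h /truncP.
  exists (untrunc t) => //; rewrite stab_cosetP.
  apply/seteqP; split=> h /=; first by move=> /truncP; rewrite untruncK.
  by rewrite /f /= => <-; apply/truncP; rewrite untruncK.
have finj : injective f.
  move=> t t' e; have : f t (untrunc t) by rewrite /f /= untruncK.
  by rewrite e /f /= untruncK.
rewrite fset_set_image; last exact: finite_finset.
rewrite card_imfset //= /levels.
have <- : #|{: {ffun word p n -> Cp p}}| = (p ^ #|{: word p n}|)%N by rewrite card_ffun card_Cp.
rewrite cardE; apply/perm_size/uniq_perm; [exact: fset_uniq|exact: enum_uniq|].
by move=> t; rewrite mem_enum [LHS](in_fset_set (finite_finset (X := setT))) in_setT.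
Qed.

Lemma levels_gt0 n : (0 < levels n)%N.
Proof. by rewrite expn_gt0 prime_gt0. Qed.

Lemma levels_le m n : (m <= n)%N -> (levels m <= levels n)%N.
Proof.
move=> mn; rewrite leq_exp2l ?prime_gt1 //.
have ex (w : word p m) : exists v : word p n, v = w :> seq _.
  by apply: word_exists; apply: leq_trans mn; apply: word_size.
pose f w := sval (cid (ex w)); have fE w : f w = w :> seq _ := svalP (cid (ex w)).
rewrite -(card_imset _ (f := f)); first exact: max_card.
by move=> w w' e; apply: word_inj; rewrite -!fE e.
Qed.

Lemma levels_ge n : (n < levels n)%N.
Proof.
apply: leq_trans (ltn_expl n (prime_gt1 p_prime)) _; rewrite leq_exp2l ?prime_gt1 //.
case: n => // n; apply: leq_trans (ltn_expl n (prime_gt1 p_prime)) _.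
exact: card_word_ge.
Qed.

Lemma dist_spec (R : realType) g h : g <> h -> exists n, [/\ eqp n g h,
  forall m, eqp m g h -> (m <= n)%N & Gamma_dist R g h = ((levels n)%:R^-1)%R].
Proof.
move=> gh.
have stabE k : level_stab k (g * h^-1)%g <-> eqp k g h.
  rewrite (_ : level_stab k (g * h^-1)%g = stab_coset k h g) // stab_cosetP.
  by split.
have [m nm] : exists m, ~ eqp m g h.
  apply: contrapT => all; apply: gh; apply/funext => v; apply: contrapT => ne.
  by apply: all; exists (size v).+1 => e; apply: ne; apply: e.
have ex : exists k, `[< eqp k g h >] by exists 0%N; apply/asboolP.
have ub k : `[< eqp k g h >] -> (k <= m)%N.
  move=> /asboolP e; rewrite leqNgt; apply/negP => mk; apply: nm.
  exact: eqp_le (ltnW mk) e.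
case: (ex_maxnP ex ub) => n /asboolP en nmax.
exists n; split=> // [k ek|]; first by apply: nmax; apply/asboolP.
rewrite /Gamma_dist; case: eqP => // _; rewrite quo_cardE.
suff -> : agree_level g h = n by [].
rewrite /agree_level; apply: get_unique.
  by split; [apply/stabE|move=> k /stabE ek; apply: nmax; apply/asboolP].
move=> k [/stabE ek kmax]; apply/eqP; rewrite eqn_leq kmax ?andbT; last exact/stabE.
by apply: nmax; apply/asboolP.
Qed.

Lemma dist_le (R : realType) n g h : eqp n g h -> (Gamma_dist R g h <= (levels n)%:R^-1)%R.
Proof.
move=> e; have [->|gh] := pselect (g = h).
  by rewrite /Gamma_dist eqxx invr_ge0 ler0n.
have [m [_ mmax ->]] := dist_spec R gh.
by rewrite lef_pV2 ?posrE ?ltr0n ?levels_gt0 // ler_nat levels_le // mmax.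
Qed.

Section Upper.
Variable R : realType.
Local Open Scope ereal_scope.
Local Notation dist := (@Gamma_dist R p).

Lemma diam_cyl n g : diam dist [set h | eqp n g h]%classic <= ((levels n)%:R^-1)%:E.
Proof.
apply: ge_ereal_sup => _ [[a b] [/= ga gb] <-]; rewrite lee_fin; apply: dist_le.
by apply: eqp_trans gb; apply: eqp_sym.
Qed.

Lemma diam_pow_ge0 s (U : set (Gamma p)) : 0 <= diam_pow dist s U.
Proof. by rewrite /diam_pow; case: ifP => // _; apply: poweR_ge0. Qed.

Lemma content_ge0 s delta (A : set (Gamma p)) : 0 <= hausdorff_content dist s delta A.
Proof.
apply: le_ereal_inf_tmp => _ [U _ <-]; apply: nneseries_ge0 => n _ _.
exact: diam_pow_ge0.
Qed.

Lemma diam_pow_le s (U : set (Gamma p)) r : (0 <= s)%R -> diam dist U <= r%:E ->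
  diam_pow dist s U <= (r `^ s)%:E.
Proof.
move=> s0 Ur; rewrite /diam_pow; case: asboolP => [_|U0].
  by rewrite lee_fin powR_ge0.
have [g Ug] : exists g, U g.
  by apply: contrapT => h; apply: U0; apply/seteqP; split=> // g Ug; apply: h; exists g.
have d0 : 0 <= diam dist U.
  apply: ereal_sup_ubound; exists (g, g) => //=; by rewrite /Gamma_dist eqxx.
rewrite -poweR_EFin; apply: gt0_ler_poweR => //; rewrite in_itv /= ?leey ?andbT //.
exact: le_trans Ur.
Qed.

(** Covers are infinite sequences, so the finitely many cylinders are followed by empty sets. *)
Lemma cover_cyl n : exists2 U : nat -> set (Gamma p),
  (forall g, exists2 k, (k < levels n)%N & U k g) &
  (forall k, diam dist (U k) <= ((levels n)%:R^-1)%:E) /\ (forall k, (levels n <= k)%N -> U k = set0).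
Proof.
have cL : #|{: {ffun word p n -> Cp p}}| = levels n by rewrite card_ffun card_Cp.
exists (fun k => if insub k is Some q then [set h | eqp n (untrunc (enum_val (q : 'I_#|{: {ffun word p n -> Cp p}}|))) h]%classic else set0).
  move=> g; exists (enum_rank (trunc n g)); first by rewrite -cL.
  rewrite insubT // => lt /=; set q := Sub _ _.
  have -> : q = enum_rank (trunc n g) by apply: val_inj.
  by rewrite enum_rankK; apply/truncP; rewrite untruncK.
split=> k; first by case: insubP => [q _ _|_]; [apply: diam_cyl|rewrite /diam setX0 image_set0 ereal_sup0 leNye].
by move=> kL; rewrite insubF // cL ltnNge kL.
Qed.

(** All L cylinders of a level cost at most L * L^-s, which tends to 0 as the level grows. *)
Lemma measure_zero s (A : set (Gamma p)) : (1 < s)%R -> hausdorff_measure dist s A = 0.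
Proof.
move=> s1; apply/eqP; rewrite eq_le; apply/andP; split; last first.
  apply: le_trans (content_ge0 s 1 A) _; apply: ereal_sup_ubound.
  by exists 1%R => //=; apply: ltr01.
apply: ge_ereal_sup => _ [delta /= d0 <-].
apply/lee_addgt0Pr => e e0; rewrite add0e.
have s10 : (0 < s - 1)%R by rewrite subr_gt0.
(* The first summand bounds the cost by [e], the second the diameters by [delta]. *)
pose K : R := (e^-1 `^ ((s - 1)^-1) + delta^-1)%R.
have K1 : (0 <= e^-1 `^ ((s - 1)^-1))%R by apply: powR_ge0.
have K2 : (0 <= delta^-1)%R by rewrite invr_ge0 ltW.
have [n nK] : exists n, (K <= (levels n)%:R)%R.
  exists (Num.bound K); apply: le_trans (ltW (archi_boundP (addr_ge0 K1 K2))) _.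
  by rewrite ler_nat ltnW // levels_ge.
have L0 : (0 < (levels n)%:R :> R)%R by rewrite ltr0n levels_gt0.
have [U cU [dU U0]] := cover_cyl n.
have cover : delta_cover dist delta A U.
  split=> [g _|k]; first by have [k _ Ug] := cU g; exists k.
  apply: le_trans (dU k) _; rewrite lee_fin -[delta]invrK lef_pV2 ?posrE ?invr_gt0 //.
  by apply: le_trans nK; rewrite /K lerDr.
apply: ge_ereal_inf; exists (\sum_(0 <= k <oo) diam_pow dist s (U k)); first by exists U.
rewrite (nneseries_split 0 (levels n)) => [|k _]; last exact: diam_pow_ge0.
rewrite add0n (eseries0 (f := fun k => diam_pow dist s (U k))) => [|k kL _]; last first.
  by rewrite /diam_pow U0 //; case: asboolP.
rewrite adde0; have s0 : (0 <= s)%R by apply: le_trans (ltW s1).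
apply: le_trans (_ : _ <= \sum_(0 <= k < levels n) (((levels n)%:R^-1 : R) `^ s)%:E) _.
  by apply: lee_sum => k _; apply: diam_pow_le.
rewrite sumEFin sumr_const_nat subn0 lee_fin -[X in (X <= _)%R]mulr_natl.
have -> : ((levels n)%:R * (levels n)%:R^-1 `^ s = ((levels n)%:R `^ (s - 1))^-1 :> R)%R.
  have Ln0 : ((levels n)%:R != 0 :> R)%R by rewrite gt_eqF.
  rewrite -powR_inv1 ?ltW // -powRrM mulN1r -[RHS]powRN opprB powRD ?Ln0 ?implybT //.
  by rewrite powRr1 ?ltW.
rewrite -[e]invrK lef_pV2 ?posrE ?invr_gt0 ?powR_gt0 //.
have -> : (e^-1 = (e^-1 `^ ((s - 1)^-1)) `^ (s - 1))%R.
  by rewrite -powRrM mulVf ?gt_eqF // powRr1 // invr_ge0 ltW.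
apply: ge0_ler_powR; [exact: ltW|by rewrite nnegrE powR_ge0|by rewrite nnegrE ler0n|].
by apply: le_trans nK; rewrite /K lerDl.
Qed.

Lemma hausdorff_dim_le1 (A : set (Gamma p)) : hausdorff_dim dist A <= 1.
Proof.
apply/lee_addgt0Pr => e e0; apply: ereal_inf_lbound.
exists (1 + e)%R => //; split; first by rewrite addr_ge0 // ltW.
by apply: measure_zero; rewrite ltrDl.
Qed.

End Upper.

End Metric.

(** * Compactness and proportions of cylinders *)

Section Compactness.
Variable p : nat.
Implicit Types (g h : Gamma p) (A : set (Gamma p)).

Lemma cyl_open n g : open [set h : Gamma p | eqp n g h]%classic.
Proof.
move=> h /= gh; exists n => k; rewrite stab_cosetP /= => hk.
exact: eqp_trans gh (eqp_sym hk).
Qed.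

Lemma closureE A g : closure A g <-> forall n, exists2 h, A h & eqp n g h.
Proof.
split=> [clg n|h B].
  have ng : nbhs g [set h | eqp n g h]%classic.
    by apply: open_nbhs_nbhs; split; [apply: cyl_open|apply: eqp_refl].
  by have [h [Ah gh]] := clg _ ng; exists h.
rewrite nbhsE => -[U [oU Ug] UB]; have [n nU] := oU g Ug.
have [k Ak gk] := h n; exists k; split=> //; apply: UB; apply: nU.
by rewrite stab_cosetP; apply: eqp_sym.
Qed.

(* Compactness: otherwise some branch of cylinders is not finitely covered. *)
Lemma finite_cover A (n : nat -> nat) (c : nat -> Gamma p) :
  (forall g, closure A g -> exists i, eqp (n i) (c i) g) ->
  exists k, forall g, closure A g -> exists2 i, (i < k)%N & eqp (n i) (c i) g.
Proof.
move=> cov; pose P m g := ~ exists k, forall h, closure A h -> eqp m g h ->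
  exists2 i, (i < k)%N & eqp (n i) (c i) h.
apply: contrapT => nk.
have P0 : P 0%N 1%g.
  by move=> [k hk]; apply: nk; exists k => g Ag; apply: hk.
have step m g : exists g', P m g -> eqp m g g' /\ P m.+1 g'.
  apply: contrapT => none.
  have Pg : P m g by apply: contrapT => nP; apply: none; exists g.
  have ex (t : {ffun word p m.+1 -> Cp p}) : exists k, eqp m g (untrunc t) ->
      forall h, closure A h -> eqp m.+1 (untrunc t) h -> exists2 i, (i < k)%N & eqp (n i) (c i) h.
    have [e|ne] := pselect (eqp m g (untrunc t)); last by exists 0%N.
    have [k hk] : exists k, forall h, closure A h -> eqp m.+1 (untrunc t) h ->
      exists2 i, (i < k)%N & eqp (n i) (c i) h.
      by apply: contrapT => nP; apply: none; exists (untrunc t).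
    by exists k.
  apply: Pg; exists (\max_t sval (cid (ex t)))%N => h Ah gh.
  have eh : eqp m.+1 (untrunc (trunc m.+1 h)) h by apply/truncP; rewrite untruncK.
  have egh : eqp m g (untrunc (trunc m.+1 h)).
    by apply: eqp_trans gh _; apply: eqp_sym; apply: eqp_le eh.
  have [i ik ci] := svalP (cid (ex (trunc m.+1 h))) egh h Ah eh.
  by exists i => //; apply: leq_trans ik _; apply: leq_bigmax.
pose next m g := sval (cid (step m g)).
pose x := fix x m := if m is m'.+1 then next m' (x m') else 1%g.
have Px m : P m (x m).
  by elim: m => // m IH; have [] := svalP (cid (step m (x m))) IH.
have xS m : eqp m (x m) (x m.+1) by have [] := svalP (cid (step m (x m))) (Px m).
have xle m m' : (m <= m')%N -> eqp m (x m) (x m').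
  move=> /subnK <-; elim: (m' - m)%N => [|d IH]; first by [].
  by apply: eqp_trans IH _; apply: eqp_le (xS _); rewrite leq_addl.
pose lim : Gamma p := fun v => x (size v).+1 v.
have limE m : eqp m (x m) lim.
  move=> v vm; rewrite /lim; have [h|h] := leqP m (size v).+1.
    by apply: (xle _ _ h).
  by apply/esym; apply: (xle _ _ (ltnW h)).
have Alim : closure A lim.
  apply/closureE => m.
  have [k Ak xk] : exists2 k, closure A k & eqp m (x m) k.
    apply: contrapT => none; apply: (Px m); exists 0%N => h Ah xh.
    by case: none; exists h.
  have [h Ah kh] := proj1 (closureE A k) Ak m; exists h => //.
  by apply: eqp_trans kh; apply: eqp_trans xk; apply: eqp_sym.
have [i ci] := cov lim Alim; apply: (Px (n i)); exists i.+1 => h Ah xh.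
exists i => //; apply: eqp_trans xh; apply: eqp_trans ci _; exact/eqp_sym/limE.
Qed.

Variable H : set (Gamma p).
Hypothesis sgH : is_subgroup H.

Lemma img_gt0 n : (0 < #|img n H|)%N.
Proof.
by apply/card_gt0P; exists (trunc n 1%g); apply/imgP; exists 1%g => //; case: sgH.
Qed.

(* [H] is a union of [#|img m H|] translates of its intersection with a level
   [m] cylinder, so this intersection has a proportion at most [1 / #|img m H|]
   of the image of [H] at every deeper level. *)
Lemma img_cyl m n c : (m <= n)%N ->
  (#|img n (H `&` [set h | eqp m c h])%classic| * #|img m H| <= #|img n H|)%N.
Proof.
move=> mn; have [H1 HM HV] := sgH; set I := img n _.
have [->|[u uI]] := finset.set_0Vmem I; first by rewrite cards0.
have /imgP[h0 [Hh0 ch0] _] := uI.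
have ex (t : {ffun word p n -> Cp p}) : exists h, t \in I -> (H h /\ eqp m c h) /\ trunc n h = t.
  by case: (imgP (H `&` [set h | eqp m c h])%classic t) => [[h hH ht]|_]; [exists h|exists 1%g].
have ex' (t : {ffun word p m -> Cp p}) : exists h, t \in img m H -> H h /\ trunc m h = t.
  by case: (imgP H t) => [[h hH ht]|_]; [exists h|exists 1%g].
pose r t := sval (cid (ex t)); pose r' t := sval (cid (ex' t)).
have rP t : t \in I -> (H (r t) /\ eqp m c (r t)) /\ trunc n (r t) = t := svalP (cid (ex t)).
have r'P t : t \in img m H -> H (r' t) /\ trunc m (r' t) = t := svalP (cid (ex' t)).
(* Dividing by [h0] from the cylinder makes the product agree with the second component modulo level
   [m], so both components can be recovered. *)
pose f (tt : {ffun word p n -> Cp p} * {ffun word p m -> Cp p}) :=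
  trunc n (r tt.1 * h0^-1 * r' tt.2)%g.
have fm t t' : t \in I -> t' \in img m H -> eqp m (r t * h0^-1 * r' t')%g (untrunc t').
  move=> tI t'I; have [[_ cr] _] := rP t tI; have [_ er'] := r'P t' t'I.
  have e1 : eqp m (r t) h0 by apply: eqp_trans (eqp_sym cr) ch0.
  have := eqpM (eqpM e1 (@eqp_refl _ m h0^-1%g)) (@eqp_refl _ m (r' t')).
  rewrite mulgV mul1g => e; apply: eqp_trans e _.
  by apply/truncP; rewrite untruncK.
rewrite -cardsX -(card_in_imset (f := f)).
  apply/subset_leq_card/fintype.subsetP => _ /imsetP[[t t'] + ->].
  rewrite finset.in_setX /= => /andP[tI t'I]; apply/imgP; exists (r t * h0^-1 * r' t')%g => //.
  have [[Hr _] _] := rP t tI; have [Hr' _] := r'P t' t'I.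
  by apply: (HM) => //; apply: (HM) => //; apply: HV.
move=> [t t'] [v v']; rewrite !finset.in_setX /= => /andP[tI t'I] /andP[vI v'I] /truncP e.
have ett : t' = v'.
  rewrite -[t']untruncK -[v']untruncK; apply/truncP.
  apply: eqp_trans (eqp_sym (fm t t' tI t'I)) _.
  by apply: eqp_trans (fm v v' vI v'I); apply: eqp_le e.
congr (_, _) => //; have [_ <-] := rP t tI; have [_ <-] := rP v vI; apply/truncP.
move: e; rewrite /= ett => e.
have := eqpM (eqpM e (@eqp_refl _ n (r' v')^-1%g)) (@eqp_refl _ n h0).
by rewrite !mulgK !mulgKV.
Qed.

End Compactness.

(** * Lower bound for the dimension *)

Section Lower.
Variables (R : realType) (p : nat).
Hypothesis p_prime : prime p.
Variable H : set (Gamma p).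
Hypothesis sgH : is_subgroup H.
Hypothesis growth : forall k, exists n0, forall n, (n0 <= n)%N ->
  (levels p n ^ k <= levels p n * #|img n H| ^ k)%N.
Local Notation a n := #|img n H|.
Local Notation dist := (@Gamma_dist R p).
Implicit Types (U : set (Gamma p)) (s eta : R).

Lemma img_levels s : (0 <= s)%R -> (s < 1)%R -> exists2 K : R, (0 < K)%R &
  forall n, ((levels p n)%:R `^ s <= K * (a n)%:R)%R.
Proof.
move=> s0 s1; have d0 : (0 < 1 - s)%R by rewrite subr_gt0.
(* The loss [1/k] in the exponent then stays below [1 - s]; the constant [levels p n0] takes care of
   the levels below [n0]. *)
pose k := Num.bound (1 - s)^-1.
have hk : ((1 - s)^-1 < k%:R)%R by apply: archi_boundP; rewrite invr_ge0 ltW.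
have [n0 hn0] := growth k.
have Lgt0 n : (0 < (levels p n)%:R :> R)%R by rewrite ltr0n levels_gt0.
have Lge1 n : (1 <= (levels p n)%:R :> R)%R by rewrite ler1n levels_gt0.
have a1 n : (1 <= (a n)%:R :> R)%R by rewrite ler1n img_gt0.
exists (levels p n0)%:R%R => // n; have [n0n|nn0] := leqP n0 n; last first.
  apply: le_trans (_ : _ <= (levels p n0)%:R)%R _; last by apply: ler_peMr => //; apply: ltW.
  apply: le_trans (_ : _ <= (levels p n)%:R `^ 1)%R _; first by apply: ler_powR => //; apply: ltW.
  by rewrite powRr1 ?ler0n // ler_nat; apply: levels_le => //; apply: ltnW.
apply: le_trans (_ : _ <= (a n)%:R)%R _; last by apply: ler_peMl; [apply: ler0n|].
have k0 : (0 < k)%N.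
  by rewrite -(ltr_nat R); apply: le_lt_trans hk; rewrite invr_ge0 ltW.
have h : ((levels p n)%:R ^+ k <= (levels p n)%:R * (a n)%:R ^+ k :> R)%R.
  by rewrite -!natrX -natrM ler_nat hn0.
rewrite -(@ler_pXn2r R k k0) ?nnegrE ?powR_ge0 ?ler0n //.
rewrite -(ler_pM2l (Lgt0 n)); apply: le_trans h.
rewrite -[((_ `^ s) ^+ k)%R]powR_mulrn ?powR_ge0 // -powRrM.
rewrite -[X in (X * _)%R]powRr1 ?ler0n //.
have Ln0 : ((levels p n)%:R != 0 :> R)%R by rewrite gt_eqF.
rewrite -powRD ?Ln0 ?implybT // -powR_mulrn ?ler0n //; apply: ler_powR => //.
have : (1 <= k%:R * (1 - s))%R by rewrite -ler_pdivrMr // mul1r ltW.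
nra.
Qed.

Lemma img_unbounded eta : (0 < eta)%R -> exists n, ((a n)%:R^-1 <= eta)%R.
Proof.
(* With exponent 2, the square of the size of the image is at least [levels p n]. *)
move=> e0; have [n0 hn0] := growth 2.
have b0 : (0 <= eta^-1 ^+ 2)%R by rewrite exprn_ge0 // invr_ge0 ltW.
pose n := maxn n0 (Num.bound (eta^-1 ^+ 2)); exists n.
have a0 : (0 < (a n)%:R :> R)%R by rewrite ltr0n img_gt0.
rewrite -[eta]invrK lef_pV2 ?posrE ?invr_gt0 //.
rewrite -(@ler_pXn2r R 2) ?nnegrE ?ler0n ?invr_ge0 ?(ltW e0) //.
apply: le_trans (ltW (archi_boundP b0)) _; rewrite -natrX ler_nat.
have := hn0 n (leq_maxl _ _); rewrite expnS expn1 leq_mul2l => /orP[/eqP h|h].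
  by have := levels_gt0 p_prime n; rewrite h.
apply: leq_trans h; apply: leq_trans (ltnW (levels_ge p_prime n)).
exact: leq_maxr.
Qed.

Local Open Scope ereal_scope.

(* The term [eta] is only needed when [U] has at most one point. *)
Lemma cyl_hull s (K eta : R) U : (0 <= s)%R -> (0 < eta)%R -> (0 < K)%R ->
  (forall n, ((levels p n)%:R `^ s <= K * (a n)%:R)%R) ->
  exists n c, (forall g, U g -> eqp n c g) /\
    ((a n)%:R^-1)%:E <= K%:E * diam_pow dist s U + eta%:E.
Proof.
move=> s0 e0 K0 hK.
have [[x [y [Ux Uy xy]]]|single] := pselect (exists x y, [/\ U x, U y & x <> y]); last first.
  have [n hn] := img_unbounded e0.
  have [c Uc] : exists c, forall g, U g -> c = g.
    have [[c Uc]|U0] := pselect (exists c, U c); last by exists 1%g => g Ug; case: U0; exists g.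
    by exists c => g Ug; apply: contrapT => cg; apply: single; exists c, g.
  exists n, c; split=> [g /Uc ->|]; first exact: eqp_refl.
  apply: le_trans (_ : eta%:E <= _); first by rewrite lee_fin.
  by rewrite leeDr // mule_ge0 ?diam_pow_ge0 // lee_fin ltW.
have U0 : U <> set0 by move=> e; move: Ux; rewrite e.
(* The pair of points of [U] that separates first gives the smallest cylinder containing [U], and
   its distance bounds the diameter from below. *)
pose P n := `[< exists g h, [/\ U g, U h & g <> h] /\ [/\ eqp n g h,
  forall m, eqp m g h -> (m <= n)%N & dist g h = ((levels p n)%:R^-1)%R] >].
have ex : exists n, P n.
  by have [n hn] := dist_spec p_prime R xy; exists n; apply/asboolP; exists x, y.
case: (ex_minnP ex) => n /asboolP[g [h [[Ug Uh gh] [egh _ dgh]]]] nmin.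
exists n, g; split=> [z Uz|].
  have [->|gz] := pselect (g = z); first exact: eqp_refl.
  have [m hm] := dist_spec p_prime R gz; apply: eqp_le (_ : (n <= m)%N) _; last by case: hm.
  by apply: nmin; apply/asboolP; exists g, z.
apply: le_trans (_ : K%:E * diam_pow dist s U <= _); last by rewrite leeDl // lee_fin ltW.
have L0 : (0 < (levels p n)%:R :> R)%R by rewrite ltr0n levels_gt0.
have a0 : (0 < (a n)%:R :> R)%R by rewrite ltr0n img_gt0.
apply: le_trans (_ : K%:E * ((levels p n)%:R^-1 `^ s)%:E <= _).
  rewrite -EFinM lee_fin -(powR_inv1 (ltW L0)) powRAC powR_inv1 ?powR_ge0 //.
  rewrite ler_pdivlMr ?powR_gt0 // mulrC ler_pdivrMr // hK.
apply: lee_wpmul2l; first by rewrite lee_fin ltW.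
rewrite /diam_pow; case: asboolP => // _; rewrite -poweR_EFin.
have dd : ((levels p n)%:R^-1)%:E <= diam dist U.
  by apply: ereal_sup_ubound; exists (g, h) => //=; rewrite dgh.
have d0 : 0 <= ((levels p n)%:R^-1 : R)%:E by rewrite lee_fin invr_ge0 ltW.
apply: gt0_ler_poweR => //; rewrite in_itv /= ?leey ?andbT //.
exact: le_trans dd.
Qed.

Lemma content_pos s : (0 <= s)%R -> (s < 1)%R ->
  0 < hausdorff_content dist s 1 (closure H).
Proof.
move=> s0 s1; have [K K0 hK] := img_levels s0 s1.
apply: lt_le_trans (_ : ((2 * K)^-1)%:E <= _); first by rewrite lte_fin invr_gt0 mulr_gt0.
apply: le_ereal_inf_tmp => _ [U [Hcov Ud] <-].
(* These errors sum to at most 1/2, leaving half of the lower bound 1 in [cnt]. *)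
pose eta i : R := (2^-1 ^+ i.+2)%R.
have hull i : exists nc : nat * Gamma p, (forall g, U i g -> eqp nc.1 nc.2 g) /\
    ((a nc.1)%:R^-1)%:E <= K%:E * diam_pow dist s (U i) + (eta i)%:E.
  have e0 : (0 < eta i)%R by apply: exprn_gt0; lra.
  by have [n [c h]] := cyl_hull (U i) s0 e0 K0 hK; exists (n, c).
pose nc i := sval (cid (hull i)).
have ncP i : (forall g, U i g -> eqp (nc i).1 (nc i).2 g) /\
    ((a (nc i).1)%:R^-1)%:E <= K%:E * diam_pow dist s (U i) + (eta i)%:E := svalP (cid (hull i)).
have [|k hk] := @finite_cover p H (fun i => (nc i).1) (fun i => (nc i).2).
  by move=> g /Hcov [i _ Ug]; exists i; apply: (ncP i).1.
pose n := (\max_(i < k) (nc i).1)%N.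
have a0 m : (0 < (a m)%:R :> R)%R by rewrite ltr0n img_gt0.
(* Count the image of [H] on a level [n] at least as deep as all the cylinders: they cover it, and
   [img_cyl] bounds the share of each. *)
have cnt : (1 <= \sum_(0 <= i < k) (a (nc i).1)%:R^-1 :> R)%R.
  rewrite -(ler_pM2l (a0 n)) mulr1 mulr_sumr big_mkord.
  apply: le_trans (_ : _ <= (\sum_(i < k) #|img n (H `&` [set h | eqp (nc i).1 (nc i).2 h])%classic|)%:R)%R _.
    rewrite ler_nat; apply: leq_trans (_ : _ <= #|\bigcup_(i < k) img n (H `&` [set h | eqp (nc i).1 (nc i).2 h])%classic|)%N _.
      apply/subset_leq_card/fintype.subsetP => _ /imgP[h Hh <-].
      have [i ik ci] := hk h (subset_closure Hh).
      apply/finset.bigcupP; exists (Ordinal ik) => //; apply/imgP; by exists h.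
    elim/big_ind2: _ => [|n1 A n2 B An Bn|//]; first by rewrite cards0.
    by have [le _] := leq_card_setU A B; apply: leq_trans le _; apply: leq_add.
  rewrite natr_sum; apply: ler_sum => i _; rewrite ler_pdivlMr // -natrM ler_nat.
  apply: img_cyl => //; exact: (leq_bigmax (F := fun i : 'I_k => (nc i).1)).
have half : (\sum_(0 <= i < k) eta i <= 2^-1 :> R)%R.
  suff -> : (\sum_(0 <= i < k) eta i = 2^-1 - 2^-1 ^+ k.+1 :> R)%R.
    by rewrite gerBl exprn_ge0.
  elim: (k) => [|k' IH]; first by rewrite big_geq // expr1 subrr.
  rewrite big_nat_recr //= IH /eta !exprS; lra.
pose S := \sum_(0 <= i < k) diam_pow dist s (U i).
have SS : S <= \sum_(0 <= i <oo) diam_pow dist s (U i).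
  by apply: nneseries_lim_ge => i _ _; apply: diam_pow_ge0.
apply: le_trans SS.
have : 1%:E <= K%:E * S + (2^-1)%:E.
  apply: le_trans (_ : (\sum_(0 <= i < k) (a (nc i).1)%:R^-1)%:E <= _); first by rewrite lee_fin.
  apply: le_trans (_ : \sum_(0 <= i < k) (K%:E * diam_pow dist s (U i) + (eta i)%:E) <= _).
    by rewrite -sumEFin; apply: lee_sum => i _; apply: (ncP i).2.
  rewrite big_split /= sumEFin; apply: leeD; last by rewrite lee_fin.
  by rewrite ge0_sume_distrr // => i _; apply: diam_pow_ge0.
have S0 : 0 <= S by apply: sume_ge0 => i _; apply: diam_pow_ge0.
case: S S0 => [r|_ _|//]; last by rewrite leey.
rewrite -EFinM -EFinD !lee_fin => r0 h.
rewrite -[X in (X <= _)%R]mul1r ler_pdivrMr ?mulr_gt0 // mulrCA [(r * K)%R]mulrC.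
move: (K * r)%R h => u h; lra.
Qed.

Lemma hausdorff_dim_ge1 : 1 <= hausdorff_dim dist (closure H).
Proof.
apply: le_ereal_inf_tmp => _ [s [s0 m0] <-]; rewrite lee_fin leNgt; apply/negP => s1.
have := content_pos s0 s1; rewrite ltNge => /negP; apply.
rewrite -m0; apply: ereal_sup_ubound; exists 1%R => //=; exact: ltr01.
Qed.

End Lower.

(** * Haar random generators *)

Section Probability.
Variables (R : realType) (p : nat).
Hypothesis p_prime : prime p.
Variables (d : measure_display) (Omega : measurableType d) (P : probability Omega R).
Variable X : 'I_3 -> {RV P >-> Gamma p}.
Hypothesis X_indep : mutually_independent X.
Hypothesis X_haar : forall i : 'I_3, is_haar (distribution P (X i)).
Local Open Scope classical_set_scope.
Local Open Scope ereal_scope.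

Lemma measurable_cyl n (g : Gamma p) : measurable [set h : Gamma p | eqp n g h].
Proof. by apply: sub_sigma_algebra; apply: cyl_open. Qed.

Lemma haar_cyl i n g : P (X i @^-1` [set h | eqp n g h]) = P (X i @^-1` [set h | eqp n 1%g h]).
Proof.
apply: etrans (@X_haar i g _ (measurable_cyl n 1%g)); rewrite /distribution /pushforward.
congr (P (_ @^-1` _)); apply/seteqP; split=> [h /= gh|_ [h /= eh <-]].
  exists (g^-1 * h)%g; last by rewrite mulKVg.
  have := eqpM (@eqp_refl _ n g^-1%g) gh; by rewrite mulVg.
by have := eqpM (@eqp_refl _ n g) eh; rewrite mulg1.
Qed.

Variable N : nat.
Definition sampled (w : Omega) : sample p N := sample_of (fun i => X i w) N.

Lemma sampledE o w : sampled w = o <-> forall i, eqp N (gen o i) (X i w).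
Proof.
split=> [<- i|h]; first exact: gen_sample_of.
apply/ffunP => -[i v]; rewrite ffunE -genE; apply/esym/(h i).
exact: word_size.
Qed.

Definition cell_prob := \prod_(i in [set: 'I_3]%SET) P (X i @^-1` [set h | eqp N 1%g h]).

Lemma sampled_event o : [set w | sampled w = o] =
  \bigcap_(i in [set` [set: 'I_3]%SET]) (X i @^-1` [set h | eqp N (gen o i) h]).
Proof.
apply/seteqP; split=> w /=; first by move=> /sampledE h i _; apply: h.
by move=> h; apply/sampledE => i; apply: h => /=; rewrite finset.in_setT.
Qed.

Lemma measurable_sampled o : measurable [set w | sampled w = o].
Proof.
rewrite sampled_event; apply: fin_bigcap_measurable => [|i _]; first exact: finite_finset.
by apply: measurable_funPTI; apply: measurable_cyl.
Qed.

Lemma sampled_prob o : P [set w | sampled w = o] = cell_prob.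
Proof.
rewrite sampled_event X_indep; first by apply: eq_bigr => i _; apply: haar_cyl.
by move=> i _; apply: measurable_cyl.
Qed.

Lemma sampled_prob_seq (s : seq (sample p N)) : uniq s ->
  measurable [set w | sampled w \in s] /\ P [set w | sampled w \in s] = (size s)%:R%:E * cell_prob.
Proof.
elim: s => [|o s IH] /=.
  move=> _; rewrite (_ : [set w | sampled w \in [::]] = set0); last by apply/seteqP; split.
  by rewrite measure0 mul0e.
move=> /andP[os /IH[mS PS]].
rewrite (_ : [set w | sampled w \in o :: s] = [set w | sampled w = o] `|` [set w | sampled w \in s]); last first.
  apply/seteqP; split=> w /=; rewrite inE; first by move=> /orP[/eqP|]; [left|right].
  by move=> [->|->]; rewrite ?eqxx ?orbT.
split; first by apply: measurableU => //; apply: measurable_sampled.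
set E := [set w | sampled w = o]; set S := [set w | sampled w \in s].
have -> : P (E `|` S) = P E + P S.
  apply: measureU => //; first exact: measurable_sampled.
  apply/seteqP; split=> // w [/= e]; by rewrite /S /= e (negbTE os).
by rewrite PS sampled_prob -natr1 EFinD ge0_muleDl ?mul1e 1?addeC // lee_fin.
Qed.

(** By invariance and independence all samples have the same probability; since the total is 1, the
    law is uniform without computing [cell_prob]. *)
Lemma sampled_prob_set (B : {set sample p N}) :
  measurable [set w | sampled w \in B] /\
  P [set w | sampled w \in B] = (#|B|%:R / #|{: sample p N}|%:R)%:E.
Proof.
have eB (A : {set sample p N}) : [set w | sampled w \in A] = [set w | sampled w \in enum A].
  by apply/seteqP; split=> w /=; rewrite mem_enum.
have [mB PB] := sampled_prob_seq (enum_uniq B).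
have [_ PT] := sampled_prob_seq (enum_uniq [set: sample p N]%SET).
rewrite eB; split=> //; rewrite PB -cardE.
move: PT; rewrite -eB -cardE cardsT (_ : [set w | _] = setT); last first.
  by apply/seteqP; split=> // w _ /=; rewrite finset.in_setT.
rewrite probability_setT.
case: cell_prob => [r| |].
- rewrite -!EFinM => -[h]; congr (_%:E); have h0 : (#|{: sample p N}|%:R != 0 :> R)%R.
    by apply/eqP => h0; move: h; rewrite h0 mul0r => /eqP; rewrite oner_eq0.
  by apply: (mulIf h0); rewrite mulfVK // -mulrA [(r * _)%R]mulrC -h mulr1.
- case: #|{: sample p N}| => [|n]; first by rewrite mul0e => /eqP; rewrite onee_eq0.
  by rewrite mulry gtr0_sg ?ltr0n // mul1e.
- case: #|{: sample p N}| => [|n]; first by rewrite mul0e => /eqP; rewrite onee_eq0.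
  by rewrite mulrNy gtr0_sg ?ltr0n // mul1e.
Qed.

End Probability.

(** Natural numbers carry the rational estimate over to [R]. *)
Lemma bad_density_nat p (p_prime : prime p) : exists K : nat, forall l, (0 < l)%N ->
  ((90 * p * l).+1 < 2 ^ l.+1)%N ->
  (#|bad_set p_prime (2 ^ l.+1) (10 * l) (90 * p * l)| * 2 ^ l <= K * #|{: sample p (2 ^ l.+1)}|)%N.
Proof.
have [K hK] := bad_density p_prime; exists (Num.bound `|K|%R) => l l0 jN.
rewrite -(ler_nat rat) !natrM; apply: le_trans (ler_wpM2r (ler0n _ _) (hK l l0 jN)) _.
have two : ((2%:R^-1 : rat) ^+ l * (2 ^ l)%:R = 1)%R.
  by rewrite natrX -exprMn mulVf ?expr1n // pnatr_eq0.
rewrite mulrAC -[X in (X * _)%R]mulrA two mulr1; apply: ler_wpM2r; first exact: ler0n.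
by apply: ltW; apply: le_lt_trans (ler_norm K) _; apply: archi_boundP (normr_ge0 K).
Qed.

(** * Borel-Cantelli and conclusion *)

Section Final.
Variables (R : realType) (p : nat).
Hypothesis p_prime : prime p.
Variables (d : measure_display) (Omega : measurableType d) (P : probability Omega R).
Variable X : 'I_3 -> {RV P >-> Gamma p}.
Hypothesis X_indep : mutually_independent X.
Hypothesis X_haar : forall i : 'I_3, is_haar (distribution P (X i)).
Local Open Scope classical_set_scope.
Local Open Scope ereal_scope.

Definition large_enough l := (0 < l)%N && (2 * (90 * p * l).+1 + 1 <= 2 ^ l.+1)%N.

(** Empty for small [l], so that the summable bound holds for every [l]. *)
Definition bad_at l : set Omega := if large_enough l then
  [set w | sampled X (2 ^ l.+1) w \in bad_set p_prime (2 ^ l.+1) (10 * l) (90 * p * l)] else set0.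

Lemma measurable_bad_at l : measurable (bad_at l).
Proof.
rewrite /bad_at; case: ifP => // _.
exact: (sampled_prob_set X_indep X_haar _).1.
Qed.

Lemma bad_at_limsup : P (lim_sup_set bad_at) = 0.
Proof.
have [K hK] := bad_density_nat p_prime.
apply: lim_sup_set_cvg0; first exact: measurable_bad_at.
(* The factor 2 matches the terms [2 * K / 2 ^ l.+1] of the geometric series in [epsilon_trick0]. *)
apply: le_lt_trans (_ : (2 * K)%:R%:E < _); last exact: ltry.
have K0 : (0 <= (2 * K)%:R :> R)%R by apply: ler0n.
apply: le_trans (epsilon_trick0 xpredT K0); apply: lee_nneseries => [l _ _|l _].
  exact: measure_ge0.
rewrite /bad_at; case: ifP => [/andP[l0 hl]|_]; last by rewrite measure0 lee_fin divr_ge0.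
have [_ e] := sampled_prob_set X_indep X_haar (bad_set p_prime (2 ^ l.+1) (10 * l) (90 * p * l)).
apply: le_trans (_ : (#|bad_set p_prime (2 ^ l.+1) (10 * l) (90 * p * l)|%:R / #|{: sample p (2 ^ l.+1)}|%:R)%:E <= _).
  by rewrite le_eqVlt; apply/orP; left; apply/eqP; exact: e.
have jN : ((90 * p * l).+1 < 2 ^ l.+1)%N by lia.
have := hK l l0 jN; move: #|bad_set _ _ _ _| => b hb.
have S0 : (0 < #|{: sample p (2 ^ l.+1)}|)%N by apply/card_gt0P; exists [ffun=> 1%g].
move: hb S0; move: #|{: sample p _}| => S hb S0.
rewrite lee_fin ler_pdivrMr ?ltr0n // mulrAC ler_pdivlMr ?ltr0n ?expn_gt0 //.
by rewrite -!natrM ler_nat expnS mulnCA -mulnA leq_mul2l.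
Qed.

Lemma good_eventually w : ~ lim_sup_set bad_at w ->
  exists l1, forall l, (l1 <= l)%N -> good p_prime (fun i => X i w) l.
Proof.
move=> nw; have [l1 hl1] : exists l1, forall l, (l1 <= l)%N -> ~ bad_at l w.
  apply: contrapT => h; apply: nw => n _; apply: contrapT => h'.
  by apply: h; exists n => l nl bl; apply: h'; exists l.
have [l2 hl2] := linear_le_exp (180 * p)%N 3.
exists (maxn l1 (maxn l2 1))%N => l; rewrite !geq_max => /and3P[ll1 ll2 l0].
have hl : (2 * (90 * p * l).+1 + 1 <= 2 ^ l.+1)%N by have := hl2 l ll2; rewrite expnS; nia.
by split=> //; apply/negP => bl; apply: (hl1 l ll1); rewrite /bad_at /large_enough l0 hl.
Qed.

End Final.

Theorem theorem7p2 (R : realType) (p : nat) (p_prime : prime p)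
    (d : measure_display) (Omega : measurableType d) (P : probability Omega R)
    (X : 'I_3 -> {RV P >-> Gamma p})
    (X_indep : mutually_independent X)
    (X_haar : forall i : 'I_3, is_haar (distribution P (X i))) :
  {ae P, forall w : Omega,
    hausdorff_dim (@Gamma_dist R p)
      (closure (generated_subgroup (range (fun i : 'I_3 => X i w)))) = 1%:E}.
Proof.
exists (lim_sup_set (bad_at p_prime X)); split.
- apply: bigcap_measurableType => n _; apply: bigcup_measurable => l _.
  exact: (measurable_bad_at p_prime X_indep X_haar).
- exact: bad_at_limsup.
- move=> w /=; apply: contra_notP => /good_eventually[l1 hl1].
  apply/eqP; rewrite eq_le hausdorff_dim_le1 //=.
  apply: hausdorff_dim_ge1 => // [|k]; first exact: generated_is_subgroup.
  exact: good_growth hl1.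
Qed.
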